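(* Let $(G,H,\sigma)$ be a reduced $n$-dimensional Hecke triple with Schlichting completion $(G_\sigma,H_\sigma,\sigma)$, and let $\mu$ be the left invariant Haar measure on $G_\sigma$ with $\mu(H_\sigma)=1$. Then the function $p_\sigma(x):=\chi_{H_\sigma}(x)\sigma(x)$ is a self-adjoint projection in $C_c(G_\sigma,\mathcal{B}(V_\sigma))$, and there are isomorphisms between the $*$-algebras $p_\sigma C_c(G_\sigma,\mathcal{B}(V_\sigma))p_\sigma=\mathcal{H}_\sigma(G_\sigma,H_\sigma)$ and $\mathcal{H}_\sigma(G,H)$, and between the Banach $*$-algebras $p_\sigma L^1(G_\sigma,\mathcal{B}(V_\sigma))p_\sigma$ and $l^1(G,H,\sigma)$.
   Context: A Hecke pair $(G,H)$ is a group $G$ with a subgroup $H$ such that $[H:H\cap xHx^{-1}]<\infty$ for all $x\in G$. The Hecke topology from $(G,H)$ is the group topology on $G$ with $\{xHx^{-1}\mid x\in G\}$ as neighbourhood subbase at $e$; the pair is reduced if $\bigcap_{x\in G}xHx^{-1}=\{e\}$. The Schlichting completion of a reduced Hecke pair consists of the completion of $G$ in the Hecke topology (locally compact, totally disconnected) and the closure of the subgroup in it (compact open). An $n$-dimensional Hecke triple $(G,H,\sigma)$ is a Hecke pair $(G,H)$ with a unitary representation $\sigma$ of $H$ on an $n$-dimensional Hilbert space $V_\sigma$ with finite range; $K=\ker\sigma$; it is reduced if the Hecke pair $(G,K)$ is. Its Schlichting completion $(G_\sigma,H_\sigma,\sigma)$: $(G_\sigma,K_\sigma)$ is the Schlichting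 completion of $(G,K)$, $H_\sigma$ is the closure of $H$ in $G_\sigma$ (compact open), and $\sigma$ denotes also the unique continuous extension to $H_\sigma$. The generalised Hecke algebra $\mathcal{H}_\sigma(G,H)$ is the vector space of functions $f:G\to\mathcal{B}(V_\sigma)$ with finite support in $H\backslash G/H$ and $f(hxk)=\sigma(h)f(x)\sigma(k)$ for $h,k\in H$, $x\in G$, with convolution $f*g(x)=\sum_{yH\in G/H}f(y)g(y^{-1}x)$ and involution $f^*(x)=\Delta_K(x^{-1})f(x^{-1})^*$, where $\Delta_K(x)=[K:K\cap xKx^{-1}]/[K:K\cap x^{-1}Kx]$. $\mathcal{H}_\sigma(G_\sigma,H_\sigma)$ is defined in the same way from $(G_\sigma,H_\sigma,\sigma)$. The space $l^1(G,H,\sigma)$ is the completion of $\mathcal{H}_\sigma(G,H)$ in the norm $\|f\|_1=\sum_{y\in G/H}\|f(y)\|$. $C_c(G_\sigma,\mathcal{B}(V_\sigma))$ and $L^1(G_\sigma,\mathcal{B}(V_\sigma))$ carry convolution with respect to $\mu$, the involution $f^*(x)=\Delta(x^{-1})f(x^{-1})^*$ with $\Delta$ the modular function of $G_\sigma$, and the usual $L^1$-norm $\int\|f(x)\|\,d\mu(x)$. *)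

(* Defs.v *)
From HB Require Import structures.
From mathcomp Require Import all_boot all_order all_algebra.
From mathcomp Require Import finmap complex.
From mathcomp Require Import all_classical all_reals all_analysis.
Import numFieldNormedType.Exports.
Set Implicit Arguments.
Unset Strict Implicit.
Unset Printing Implicit Defensive.
Import Order.TTheory GRing.Theory Num.Theory.
Local Open Scope classical_set_scope.
Local Open Scope complex_scope.
Local Open Scope sesquilinear_scope.
Local Open Scope ring_scope.

(* The norm topology of the complex numbers, which the library only provides on
   the alias R[i]^o. *)
HB.instance Definition _ (R : rcfType) := PseudoPointedMetric.copy R[i] R[i]^o.

HB.mixin Record isTopologicalGroup G of Group G & Topological G := {
  mulg_continuous : continuous (fun xy : G * G => (xy.1 * xy.2)%g);
  invg_continuous : continuous (fun x : G => x^-1%g)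
}.

(* The (arbitrary) base point is only there because the library builds
   generated sigma-algebras on pointed types. *)
#[short(type="topGroupType")]
HB.structure Definition TopologicalGroup :=
  {G of PointedTopological G & Group G & isTopologicalGroup G}.

Section HeckePairs.
Variable G : groupType.
Implicit Types (A B H K : set G) (x : G).

Definition ltrans x A : set G := [set (x * a)%g | a in A].
Definition rtrans A x : set G := [set (a * x)%g | a in A].
Definition conjset x A : set G := [set (x * a * x^-1)%g | a in A].
Definition dcoset A x B : set G :=
  [set y | exists a b, [/\ A a, B b & y = (a * x * b)%g]].

Definition subgroup H : Prop :=
  H 1%g /\ forall x y, H x -> H y -> H (x * y^-1)%g.

Definition left_cosets A B : set (set G) := [set ltrans a B | a in A].

(* [A : B]; meaningful when the coset space is finite. *)
Definition subgroup_index A B : nat := #|` fset_set (left_cosets A B)|%fset.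

Definition hecke_pair H : Prop :=
  subgroup H /\ forall x, finite_set (left_cosets H (H `&` conjset x H)).

Definition reduced H : Prop := \bigcap_x conjset x H = [set 1%g].

(* Open sets of the group topology having the conjugates of H as a
   neighbourhood subbase at 1: a neighbourhood of a contains the left translate
   by a of an intersection of finitely many conjugates. *)
Definition hecke_open H A : Prop :=
  forall a, A a -> exists s : seq G,
    ltrans a (\bigcap_(x in [set` s]) conjset x H) `<=` A.

End HeckePairs.

Section Completion.

(* Two-sided (Raikov) uniformity. *)
Definition cauchy_group (Gs : topGroupType) (F : set_system Gs) : Prop :=
  forall U, nbhs 1%g U -> exists2 A, F A &
    forall x y, A x -> A y -> U (x^-1 * y)%g /\ U (x * y^-1)%g.

Definition complete_group (Gs : topGroupType) : Prop :=
  forall F : set_system Gs, ProperFilter F -> cauchy_group F ->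
    exists x : Gs, F --> x.

(* iota : G -> Gs exhibits Gs as the Hausdorff completion of G endowed with the
   group topology whose open sets are op. *)
Record is_completion (G : groupType) (op : set (set G)) (Gs : topGroupType)
    (iota : G -> Gs) : Prop := {
  completion_morph : forall x y, iota (x * y)%g = (iota x * iota y)%g;
  completion_induced :
    forall A, op A <-> exists2 U : set Gs, open U & A = iota @^-1` U;
  completion_dense : dense (range iota);
  completion_hausdorff : hausdorff_space Gs;
  completion_complete : complete_group Gs }.

End Completion.

(* B(C^n) is 'M[R[i]]_n, acting on column vectors. *)
Section Operators.
Variables (R : realType) (n : nat).

Definition vnorm (v : 'cV[R[i]]_n) : R :=
  Num.sqrt (\sum_k (complex.Re `|v k 0|) ^+ 2).

Definition opnorm (A : 'M[R[i]]_n) : R :=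
  sup [set vnorm (A *m v) | v in [set v | vnorm v <= 1]].

End Operators.

Section HeckeTriples.
Variables (R : realType) (n : nat) (G : groupType).
(* Only the restriction of sigma to H is relevant. *)
Variables (H : set G) (sigma : G -> 'M[R[i]]_n).
Implicit Types f g : G -> 'M[R[i]]_n.

Definition rep_ker : set G := [set h | H h /\ sigma h = 1%:M].

Record hecke_triple : Prop := {
  triple_pair : hecke_pair H;
  triple_morph :
    forall h k, H h -> H k -> sigma (h * k)%g = sigma h *m sigma k;
  triple_unitary : forall h, H h -> sigma h \is unitarymx;
  triple_finite : finite_set (sigma @` H) }.

Definition reduced_triple : Prop := reduced rep_ker.

Definition hecke_alg : set (G -> 'M[R[i]]_n) := [set f |
  finite_set [set dcoset H x H | x in [set x | f x != 0]] /\
  forall h x k, H h -> H k ->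
    f (h * x * k)%g = sigma h *m f x *m sigma k].

(* Sums over G/H: the summands below depend only on the coset, which is
   evaluated at a chosen representative. *)
Definition coset_repr (A : set G) : G := xget 1%g A.

Definition hecke_conv f g : G -> 'M[R[i]]_n := fun x =>
  \sum_(A \in left_cosets setT H) (f (coset_repr A) *m g ((coset_repr A)^-1 * x)%g).

Definition hecke_modular (x : G) : R :=
  (subgroup_index rep_ker (rep_ker `&` conjset x rep_ker))%:R /
  (subgroup_index rep_ker (rep_ker `&` conjset x^-1%g rep_ker))%:R.

Definition hecke_inv f : G -> 'M[R[i]]_n := fun x =>
  (hecke_modular x^-1%g)%:C *: (f x^-1%g)^t*.

Definition hecke_norm1 f : R :=
  \sum_(A \in left_cosets setT H) opnorm (f (coset_repr A)).

End HeckeTriples.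

Record schlichting_completion (R : realType) (n : nat) (G : groupType)
    (H : set G) (sigma : G -> 'M[R[i]]_n) (Gs : topGroupType)
    (iota : G -> Gs) (Hs : set Gs) (sigmas : Gs -> 'M[R[i]]_n) : Prop := {
  schlichting_group : is_completion (hecke_open (rep_ker H sigma)) iota;
  schlichting_closure : Hs = closure (iota @` H);
  schlichting_continuous : {within Hs, continuous sigmas};
  schlichting_extends : forall h, H h -> sigmas (iota h) = sigma h }.

Notation borel T := (g_sigma_algebraType (@open T)).

Section Haar.
Variables (R : realType) (Gs : topGroupType).
Variable mu : {measure set (borel Gs) -> \bar R}.

Record haar_measure : Prop := {
  haar_invariant : forall (x : Gs) (E : set (borel Gs)), measurable E ->
    mu (ltrans x E) = mu E;
  haar_nonzero : mu setT != 0%E;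
  haar_compact : forall K : set Gs, compact K -> (mu K < +oo)%E;
  haar_outer : forall E : set (borel Gs), measurable E ->
    mu E = ereal_inf [set mu U | U in [set U : set Gs | open U /\ E `<=` U]];
  haar_inner : forall U : set Gs, open U ->
    mu U = ereal_sup [set mu K | K in [set K : set Gs | compact K /\ K `<=` U]] }.

(* This is the convention for which f^*(x) = Delta(x^-1) f(x^-1)^* preserves the
   L^1-norm, and which matches hecke_modular. *)
Definition modular_function (Delta : Gs -> R) : Prop :=
  forall x, 0 < Delta x /\
    forall E : set (borel Gs), measurable E ->
      mu (rtrans E x) = ((Delta x)%:E * mu E)%E.

End Haar.

Section GroupAlgebras.
Variables (R : realType) (n : nat) (Gs : topGroupType).
Variable mu : {measure set (borel Gs) -> \bar R}.
Implicit Types f g : Gs -> 'M[R[i]]_n.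

(* Integrals of matrix-valued functions are taken entrywise. *)
Definition cintegral (u : Gs -> R[i]) : R[i] :=
  Complex (Rintegral mu setT (fun x => complex.Re (u x)))
          (Rintegral mu setT (fun x => complex.Im (u x))).

Definition convol f g : Gs -> 'M[R[i]]_n := fun x =>
  \matrix_(k, l) cintegral (fun y => (f y *m g (y^-1 * x)%g) k l).

Definition grp_inv (Delta : Gs -> R) f : Gs -> 'M[R[i]]_n := fun x =>
  (Delta x^-1%g)%:C *: (f x^-1%g)^t*.

Definition Cc : set (Gs -> 'M[R[i]]_n) := [set f : Gs -> 'M[R[i]]_n |
  continuous f /\ compact (closure [set x | f x != 0])].

(* Functions, not classes modulo almost everywhere equality. *)
Definition L1fun : set (Gs -> 'M[R[i]]_n) := [set f : Gs -> 'M[R[i]]_n |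
  (forall k l,
    measurable_fun [set: borel Gs] (fun x => complex.Re (f x k l)) /\
    measurable_fun [set: borel Gs] (fun x => complex.Im (f x k l))) /\
  (\int[mu]_x (opnorm (f x))%:E < +oo)%E].

Definition L1norm f : R := Rintegral mu setT (fun x => opnorm (f x)).

Definition ae_equal f g : Prop := {ae mu, forall x : borel Gs, f x = g x}.

Definition proj_fun (Hs : set Gs) (sigmas : Gs -> 'M[R[i]]_n) :
    Gs -> 'M[R[i]]_n := fun x => if x \in Hs then sigmas x else 0.

Definition corner_Cc p : set (Gs -> 'M[R[i]]_n) := [set f |
  exists2 g, Cc g & f = convol (convol p g) p].

(* Saturated for almost everywhere equality. *)
Definition corner_L1 p : set (Gs -> 'M[R[i]]_n) := [set f |
  L1fun f /\ exists2 g, L1fun g & ae_equal f (convol (convol p g) p)].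

End GroupAlgebras.

Section StarAlgebras.
Variable C : numClosedFieldType.

Definition star_closed (U : lmodType C) (A : set U)
    (mul : U -> U -> U) (star : U -> U) : Prop :=
  [/\ A 0,
      forall a f g, A f -> A g -> A (a *: f + g),
      forall f g, A f -> A g -> A (mul f g) &
      forall f, A f -> A (star f)].

Definition star_hom (U V : lmodType C) (A : set U)
    (mul : U -> U -> U) (star : U -> U)
    (mul' : V -> V -> V) (star' : V -> V) (phi : U -> V) : Prop :=
  [/\ forall a f g, A f -> A g -> phi (a *: f + g) = a *: phi f + phi g,
      forall f g, A f -> A g -> phi (mul f g) = mul' (phi f) (phi g) &
      forall f, A f -> phi (star f) = star' (phi f)].

Record banach_star_algebra (L : completeNormedModType C)
    (mul : L -> L -> L) (star : L -> L) : Prop := {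
  bsa_assoc : forall a b c, mul a (mul b c) = mul (mul a b) c;
  bsa_linl : forall z a b c, mul (z *: a + b) c = z *: mul a c + mul b c;
  bsa_linr : forall z a b c, mul c (z *: a + b) = z *: mul c a + mul c b;
  bsa_submul : forall a b, `|mul a b| <= `|a| * `|b|;
  bsa_conj : forall z a b, star (z *: a + b) = z^* *: star a + star b;
  bsa_antimul : forall a b, star (mul a b) = mul (star b) (star a);
  bsa_invol : forall a, star (star a) = a;
  bsa_isom : forall a, `|star a| = `|a| }.

End StarAlgebras.

(* j : H_sigma(G,H) -> L exhibits the Banach *-algebra L as l^1(G,H,sigma), the
   completion of H_sigma(G,H) for the norm hecke_norm1. *)
Record l1_completion (R : realType) (n : nat) (G : groupType) (H : set G)
    (sigma : G -> 'M[R[i]]_n) (L : completeNormedModType R[i])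
    (mulL : L -> L -> L) (starL : L -> L) (j : (G -> 'M[R[i]]_n) -> L) :
    Prop := {
  l1_banach : banach_star_algebra mulL starL;
  l1_hom : star_hom (hecke_alg H sigma) (hecke_conv H) (hecke_inv H sigma)
             mulL starL j;
  l1_isometric : forall f, hecke_alg H sigma f ->
    `|j f| = (hecke_norm1 H f)%:C;
  l1_dense : dense (j @` hecke_alg H sigma) }.

(* Main.v *)
(* A function f on Gs satisfies p * f * p = f exactly when f is biequivariant,
   f (h x k) = sigma h f x sigma k for h, k in the compact open subgroup Hs.  Such
   an f is locally constant, and its operator norm is constant on the cosets of
   Hs, which have measure 1.  Hence integrals over Gs become sums over Gs/Hs, and
   p C_c p is the Hecke algebra of (Gs, Hs, sigmas).  Pulling cosets back along
   the dense map iota is a bijection from Gs/Hs onto G/H that preserves the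
   relevant subgroup indices, so f |-> f o iota is an isometric *-isomorphism onto
   the Hecke algebra of (G, H, sigma).  Every element of p L^1 p is almost
   everywhere equal to exactly one integrable biequivariant function; these
   functions form a complete space in which the Hecke algebra is dense, and two
   completions of the same normed *-algebra are isometrically *-isomorphic. *)

Require Import Defs.
From HB Require Import structures.
From mathcomp Require Import all_boot all_order all_algebra.
From mathcomp Require Import finmap complex ring lra.
From mathcomp Require Import all_classical all_reals all_analysis measurable_realfun.
Import numFieldNormedType.Exports.
Import Order.TTheory GRing.Theory Num.Theory.
Set Implicit Arguments.
Unset Strict Implicit.
Unset Printing Implicit Defensive.
Local Open Scope classical_set_scope.
Local Open Scope complex_scope.
Local Open Scope sesquilinear_scope.
Local Open Scope ring_scope.

(** * The operator norm *)

(** No countability assumption is made on [G], so [Gs/Hs] may be uncountable and [mu] need not be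
    sigma-finite. In place of Fubini's theorem, integrals of nonnegative functions that are right
    invariant under [Hs] become unordered sums over [Gs/Hs], and exchanging two such sums gives the
    norm inequality for convolution. Countable additivity can be applied because a summable family
    has countable support. A second obstacle is inversion: the modular function controls right
    translates, but convolution respects almost everywhere equality only if [y -> y^-1] preserves
    null sets. This is extracted from the regularity of [mu], starting from finite unions of cosets
    inside [Hs]. Finally, elements of [p L^1 p] are functions rather than classes; the map
    [f -> p * f * p] selects the biequivariant function in each class, and the isomorphism is the
    extension by density composed with this selection. *)

Section ComplexVectors.
Variables (R : realType) (n : nat).
Implicit Types (u v w : 'cV[R[i]]_n) (A B : 'M[R[i]]_n).

(** The real part of the Hermitian product, that is, the Euclidean inner product of R^(2n). It
    induces the same norm and keeps Cauchy-Schwarz and duality real valued. *)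
Definition rdot u v : R :=
  \sum_k (complex.Re (u k 0) * complex.Re (v k 0) +
          complex.Im (u k 0) * complex.Im (v k 0)).

Lemma cReD (a b : R[i]) : complex.Re (a + b) = complex.Re a + complex.Re b.
Proof. by case: a; case: b. Qed.
Lemma cImD (a b : R[i]) : complex.Im (a + b) = complex.Im a + complex.Im b.
Proof. by case: a; case: b. Qed.
Lemma cReM (a b : R[i]) : complex.Re (a * b) =
  complex.Re a * complex.Re b - complex.Im a * complex.Im b.
Proof. by case: a; case: b. Qed.
Lemma cImM (a b : R[i]) : complex.Im (a * b) =
  complex.Re a * complex.Im b + complex.Im a * complex.Re b.
Proof. by case: a; case: b. Qed.

Lemma cRe_sum (I : Type) (s : seq I) (P : pred I) (f : I -> R[i]) :
  complex.Re (\sum_(i <- s | P i) f i) = \sum_(i <- s | P i) complex.Re (f i).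
Proof. by apply: (big_morph _ cReD). Qed.
Lemma cIm_sum (I : Type) (s : seq I) (P : pred I) (f : I -> R[i]) :
  complex.Im (\sum_(i <- s | P i) f i) = \sum_(i <- s | P i) complex.Im (f i).
Proof. by apply: (big_morph _ cImD). Qed.

Lemma rdotC u v : rdot u v = rdot v u.
Proof. by apply: eq_bigr => k _; rewrite ![complex.Re (u _ _) * _]mulrC ![complex.Im (u _ _) * _]mulrC. Qed.

Lemma rdotDl u v w : rdot (u + v) w = rdot u w + rdot v w.
Proof. by rewrite -big_split; apply: eq_bigr => k _ /=; rewrite mxE cReD cImD; ring. Qed.

Lemma rdotDr u v w : rdot w (u + v) = rdot w u + rdot w v.
Proof. by rewrite rdotC rdotDl !(rdotC w). Qed.

Lemma rdotZl (a : R) u v : rdot (a%:C *: u) v = a * rdot u v.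
Proof.
rewrite big_distrr; apply: eq_bigr => k _ /=.
by rewrite mxE cReM cImM /=; ring.
Qed.

Lemma rdotZr (a : R) u v : rdot u (a%:C *: v) = a * rdot u v.
Proof. by rewrite rdotC rdotZl rdotC. Qed.

Lemma rdot_ge0 u : 0 <= rdot u u.
Proof. by apply: sumr_ge0 => k _; rewrite -!expr2 addr_ge0 ?sqr_ge0. Qed.

Lemma sqr_vnorm u : vnorm u ^+ 2 = rdot u u.
Proof.
rewrite /vnorm sqr_sqrtr; last by apply: sumr_ge0 => k _; exact: sqr_ge0.
apply: eq_bigr => k _; rewrite normc_def /= sqr_sqrtr -?expr2 //.
by rewrite addr_ge0 ?sqr_ge0.
Qed.

Lemma vnorm_ge0 u : 0 <= vnorm u.
Proof. exact: sqrtr_ge0. Qed.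

Lemma vnormE u : vnorm u = Num.sqrt (rdot u u).
Proof. by rewrite -sqr_vnorm sqrtr_sqr ger0_norm ?vnorm_ge0. Qed.

Lemma rdot_le u v : rdot u v <= vnorm u * vnorm v.
Proof.
have [r0|r0] := leP (rdot u v) 0.
  by rewrite (le_trans r0)// mulr_ge0 ?vnorm_ge0.
suff : rdot u v ^+ 2 <= (vnorm u * vnorm v) ^+ 2.
  by rewrite ler_sqr ?nnegrE ?(ltW r0) ?mulr_ge0 ?vnorm_ge0.
rewrite exprMn !sqr_vnorm.
have [v0|v0] := eqVneq (rdot v v) 0.
  suff -> : rdot u v = 0 by rewrite expr0n /= mulr_ge0 ?rdot_ge0.
  apply: big1 => k _.
  have /psumr_eq0P H := v0.
  have := H _ k isT => /(_ _)/eqP; rewrite -!expr2 paddr_eq0 ?sqr_ge0//.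
  rewrite !sqrf_eq0 => /(_ _) /andP[]; last by move=> /eqP-> /eqP->; ring.
  by move=> i _; rewrite -!expr2 addr_ge0 ?sqr_ge0.
have v1 : 0 < rdot v v by rewrite lt_def v0 rdot_ge0.
(* The vector is [<v,v> u - <u,v> v]; its squared length is [<v,v>] times the Cauchy-Schwarz
   defect. *)
have := rdot_ge0 ((rdot v v)%:C *: u + (- rdot u v)%:C *: v).
rewrite !(rdotDl, rdotDr, rdotZl, rdotZr) (rdotC v u).
set a := rdot u u; set b := rdot v v; set c := rdot u v.
rewrite [X in 0 <= X -> _](_ : _ = b * (a * b - c ^+ 2)); last by ring.
by rewrite pmulr_rge0 // subr_ge0.
Qed.

Lemma vnorm0 : vnorm (0 : 'cV[R[i]]_n) = 0.
Proof.
by rewrite vnormE /rdot big1 ?sqrtr0 // => k _; rewrite mxE /= !mul0r addr0.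
Qed.

Lemma vnormD u v : vnorm (u + v) <= vnorm u + vnorm v.
Proof.
suff : vnorm (u + v) ^+ 2 <= (vnorm u + vnorm v) ^+ 2.
  by rewrite ler_sqr ?nnegrE ?addr_ge0 ?vnorm_ge0.
rewrite sqrrD !sqr_vnorm rdotDl !rdotDr (rdotC v u).
have := rdot_le u v; rewrite mulr2n; lra.
Qed.

Lemma vnormZ (a : R[i]) u : vnorm (a *: u) = complex.Re `|a| * vnorm u.
Proof.
rewrite /vnorm.
under eq_bigr => k _ do rewrite mxE normrM cReM normc_def [X in _ * complex.Re X]normc_def /= mul0r subr0 exprMn.
rewrite -mulr_sumr sqrtrM ?sqr_ge0// sqrtr_sqr normc_def /= ger0_norm ?sqrtr_ge0//.
by under eq_bigr => k _ do rewrite -[Num.sqrt _]/(complex.Re (_ %:C)) -normc_def.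
Qed.

Lemma vnormN u : vnorm (- u) = vnorm u.
Proof. by rewrite -scaleN1r vnormZ normrN1 mul1r. Qed.

Lemma Re_le_norm (a : R[i]) : `|complex.Re a| <= complex.Re `|a|.
Proof. by rewrite -lecR (le_trans (normc_ge_Re a))// normc_def. Qed.

Lemma Im_le_norm (a : R[i]) : `|complex.Im a| <= complex.Re `|a|.
Proof.
rewrite normc_def /= -sqrtr_sqr ler_wsqrtr// lerDr sqr_ge0 //.
Qed.

Lemma norm_le_ReIm (a : R[i]) :
  complex.Re `|a| <= `|complex.Re a| + `|complex.Im a|.
Proof.
rewrite normc_def /= -[leRHS]ger0_norm ?addr_ge0// -sqrtr_sqr ler_wsqrtr//.
rewrite sqrrD !real_normK ?num_real// lerD2r lerDl mulrn_wge0// mulr_ge0//.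
Qed.

Lemma coord_le_vnorm u k : complex.Re `|u k 0| <= vnorm u.
Proof.
rewrite -[leLHS]ger0_norm; last by rewrite normc_def /= sqrtr_ge0.
rewrite -sqrtr_sqr /vnorm ler_wsqrtr// (bigD1 k)//= lerDl.
by apply: sumr_ge0 => i _; rewrite sqr_ge0.
Qed.

Lemma vnorm_le_coord u : vnorm u <= \sum_k complex.Re `|u k 0|.
Proof.
have nn k : 0 <= complex.Re `|u k 0| by rewrite normc_def /= sqrtr_ge0.
rewrite -[leRHS]ger0_norm ?sumr_ge0// -sqrtr_sqr /vnorm ler_wsqrtr//.
rewrite expr2 mulr_suml ler_sum// => k _; rewrite expr2 ler_wpM2l//.
rewrite (bigD1 k)//= lerDl; apply: sumr_ge0 => i _; exact: nn.
Qed.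

Lemma Re_normE (a : R[i]) : (complex.Re `|a|)%:C = `|a|.
Proof. by rewrite normc_def. Qed.

(** A crude majorant of [opnorm]: it makes the defining supremum finite and, with [entry_le_opnorm],
    identifies convergence in [opnorm] with entrywise convergence. *)
Definition entry_sum A : R := \sum_k \sum_l complex.Re `|A k l|.

Lemma vnorm_mul_entry A v : vnorm (A *m v) <= entry_sum A * vnorm v.
Proof.
rewrite (le_trans (vnorm_le_coord _))// mulr_suml ler_sum// => k _.
rewrite mxE mulr_suml -lecR Re_normE.
rewrite (le_trans (ler_norm_sum _ _ _))// rmorph_sum /= ler_sum// => l _.
by rewrite normrM rmorphM /= Re_normE ler_wpM2l// -Re_normE lecR coord_le_vnorm.
Qed.

Lemma entry_sum_ge0 A : 0 <= entry_sum A.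
Proof. by do 2!apply: sumr_ge0 => ? _; rewrite normc_def /= sqrtr_ge0. Qed.

Let opset A := [set vnorm (A *m v) | v in [set v | vnorm v <= 1]].

Let opset_sup A : has_sup (opset A).
Proof.
split; first by exists (vnorm (A *m 0)), 0 => //=; rewrite vnorm0 ler01.
exists (entry_sum A) => _ [v /= v1 <-].
by rewrite (le_trans (vnorm_mul_entry _ _))// ler_piMr// entry_sum_ge0.
Qed.

Lemma vnorm_mul A v : vnorm (A *m v) <= opnorm A * vnorm v.
Proof.
have [v0|v0] := eqVneq (vnorm v) 0.
  by rewrite (le_trans (vnorm_mul_entry _ _))// v0 !mulr0.
have v1 : 0 < vnorm v by rewrite lt_def v0 vnorm_ge0.
rewrite -ler_pdivrMr//.
apply: sup_ubound; first by case: (opset_sup A).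
exists ((vnorm v)^-1%:C *: v) => /=.
  by rewrite vnormZ normc_def /= expr0n addr0 sqrtr_sqr ger0_norm ?mulVf// invr_ge0 ltW.
by rewrite -scalemxAr vnormZ normc_def /= expr0n addr0 sqrtr_sqr ger0_norm ?invr_ge0 1?ltW// mulrC.
Qed.

Lemma opnorm_le A (c : R) : 0 <= c ->
  (forall v, vnorm (A *m v) <= c * vnorm v) -> opnorm A <= c.
Proof.
move=> c0 H; apply: sup_le_ub; first by case: (opset_sup A).
by move=> _ [v /= v1 <-]; rewrite (le_trans (H v))// ler_piMr.
Qed.

Lemma opnorm_ge0 A : 0 <= opnorm A.
Proof.
apply: sup_ubound; first by case: (opset_sup A).
by exists 0 => /=; rewrite ?mulmx0 vnorm0.
Qed.

Lemma opnorm_entry_sum A : opnorm A <= entry_sum A.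
Proof. by apply: opnorm_le (vnorm_mul_entry A); exact: entry_sum_ge0. Qed.

Lemma entry_le_opnorm A k l : complex.Re `|A k l| <= opnorm A.
Proof.
have := vnorm_mul A (delta_mx l 0).
have -> : vnorm (delta_mx l 0 : 'cV[R[i]]_n) = 1.
  rewrite /vnorm (bigD1 l)// big1 => [|i /negPf il].
    by rewrite (_ : delta_mx l 0 l 0 = 1) ?mxE ?eqxx// normr1 /= expr1n addr0 sqrtr1.
  by rewrite (_ : delta_mx l 0 i 0 = 0) ?mxE ?il// normr0 expr0n.
rewrite mulr1; apply: le_trans.
by rewrite (le_trans _ (coord_le_vnorm _ k))// -colE mxE.
Qed.

Lemma opnormD A B : opnorm (A + B) <= opnorm A + opnorm B.
Proof.
apply: opnorm_le => [|v]; first by rewrite addr_ge0 ?opnorm_ge0.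
by rewrite mulmxDl (le_trans (vnormD _ _))// mulrDl lerD ?vnorm_mul.
Qed.

Lemma opnormM A B : opnorm (A *m B) <= opnorm A * opnorm B.
Proof.
apply: opnorm_le => [|v]; first by rewrite mulr_ge0 ?opnorm_ge0.
rewrite -mulmxA (le_trans (vnorm_mul _ _))// -mulrA ler_wpM2l ?opnorm_ge0//.
exact: vnorm_mul.
Qed.

Lemma opnorm0 : opnorm (0 : 'M[R[i]]_n) = 0.
Proof.
apply/eqP; rewrite eq_le opnorm_ge0 andbT.
by apply: opnorm_le => // v; rewrite mul0mx vnorm0 mul0r.
Qed.

Lemma opnorm_eq0 A : opnorm A = 0 -> A = 0.
Proof.
move=> A0; apply/matrixP => k l; rewrite mxE; apply/eqP; rewrite -normr_eq0.
have := entry_le_opnorm A k l; rewrite A0 normc_def /= => h.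
by rewrite eq_complex /= eqxx andbT eq_le h sqrtr_ge0.
Qed.

Lemma opnormZ_le (a : R[i]) A : opnorm (a *: A) <= complex.Re `|a| * opnorm A.
Proof.
have a0 : 0 <= complex.Re `|a| by rewrite normc_def /= sqrtr_ge0.
apply: opnorm_le => [|v]; first by rewrite mulr_ge0 ?opnorm_ge0.
by rewrite -scalemxAl vnormZ -mulrA ler_wpM2l ?vnorm_mul.
Qed.

Local Opaque opnorm vnorm.

Lemma opnormN A : opnorm (- A) = opnorm A.
Proof.
have H B : opnorm (- B) <= opnorm B.
  by rewrite -scaleN1r (le_trans (opnormZ_le _ _))// normrN1 mul1r.
apply: le_anti; apply/andP; split; first exact: H.
by rewrite -{1}(opprK A); exact: H.
Qed.

Lemma opnormZ (a : R) A : 0 <= a -> opnorm (a%:C *: A) = a * opnorm A.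
Proof.
move=> a0; apply/eqP; rewrite eq_le; apply/andP; split.
  by rewrite (le_trans (opnormZ_le _ _))// normc_def /= expr0n addr0 sqrtr_sqr ger0_norm.
have [->|an0] := eqVneq a 0; first by rewrite mul0r opnorm_ge0.
have a1 : 0 < a by rewrite lt_def an0.
rewrite -ler_pdivlMl//.
have {1}-> : A = a^-1%:C *: (a%:C *: A).
  by rewrite scalerA -rmorphM /= mulVf// scale1r.
by rewrite (le_trans (opnormZ_le _ _))// normc_def /= expr0n addr0 sqrtr_sqr ger0_norm// invr_ge0.
Qed.

Lemma rdot_adj A u v : rdot (A ^t* *m u) v = rdot u (A *m v).
Proof.
rewrite /rdot.
transitivity (\sum_k \sum_l complex.Re ((u l 0)^* * A l k * v k 0)%C).
  apply: eq_bigr => k _; rewrite -[in RHS]cRe_sum -mulr_suml cReM.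
  have -> : \sum_i (u i 0)^*%C * A i k = ((A ^t* *m u) k 0)^*%C.
    rewrite mxE rmorph_sum; apply: eq_bigr => l _.
    rewrite !mxE rmorphM /= mulrC; congr (_ * _).
    by rewrite -[RHS]/((A l k)^*%C^*%C) conjcK.
  by case: ((A ^t* *m u) k 0) => a b /=; rewrite mulNr opprK.
rewrite exchange_big; apply: eq_bigr => l _ /=.
rewrite -cRe_sum; under eq_bigr do rewrite -mulrA.
rewrite -mulr_sumr mxE cReM; case: (u l 0) => a b /=.
by rewrite mulNr opprK.
Qed.

(** One inequality suffices, the adjoint being an involution. With [w] the adjoint of [B] applied to
    [v], [|w|^2 = <v, B w>] is at most [|v| |B| |w|], and one factor [|w|] cancels. *)
Lemma opnorm_adj A : opnorm (A ^t*) = opnorm A.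
Proof.
have H B : opnorm (B ^t*) <= opnorm B.
  apply: opnorm_le => [|v]; first exact: opnorm_ge0.
  set w := B ^t* *m v.
  have [->|w0] := eqVneq (vnorm w) 0; first by rewrite mulr_ge0 ?opnorm_ge0 ?vnorm_ge0.
  have w1 : 0 < vnorm w by rewrite lt_def w0 vnorm_ge0.
  rewrite -(ler_pM2r w1) -expr2 sqr_vnorm {1}/w rdot_adj.
  rewrite (le_trans (rdot_le _ _))//.
  by rewrite [opnorm B * _]mulrC -mulrA ler_wpM2l ?vnorm_ge0// vnorm_mul.
apply: le_anti; apply/andP; split; first exact: H.
by rewrite -{1}(trmxCK A); exact: H.
Qed.

Lemma opnorm_unitary A : A \is unitarymx -> opnorm A <= 1.
Proof.
move=> UA; apply: opnorm_le => // v; rewrite mul1r.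
suff : vnorm (A *m v) ^+ 2 <= vnorm v ^+ 2 by rewrite ler_sqr ?nnegrE ?vnorm_ge0.
rewrite !sqr_vnorm -rdot_adj mulmxA.
have -> : A ^t* *m A = 1%:M.
  by rewrite -(invmx_unitary UA) mulVmx// unitarymx_unit.
by rewrite mul1mx.
Qed.

Lemma opnorm_unitary_le A B C : A \is unitarymx -> C \is unitarymx ->
  opnorm (A *m B *m C) <= opnorm B.
Proof.
move=> UA UC; apply: le_trans (opnormM _ _) _; rewrite -[leRHS]mulr1.
apply: ler_pM; [exact: opnorm_ge0|exact: opnorm_ge0| |exact: opnorm_unitary].
apply: le_trans (opnormM _ _) _; rewrite -[leRHS]mul1r.
by apply: ler_wpM2r; [exact: opnorm_ge0|exact: opnorm_unitary].
Qed.

Lemma opnorm_unitary_mul A B C : A \is unitarymx -> C \is unitarymx ->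
  opnorm (A *m B *m C) = opnorm B.
Proof.
move=> UA UC; apply: le_anti; apply/andP; split; first exact: opnorm_unitary_le.
have {1}-> : B = A ^t* *m (A *m B *m C) *m C ^t*.
  have uA := unitarymx_unit UA; have uC := unitarymx_unit UC.
  rewrite -(invmx_unitary UA) -(invmx_unitary UC) !mulmxA (mulVmx uA) mul1mx.
  by rewrite -mulmxA (mulmxV uC) mulmx1.
have UA' : A ^t* \is unitarymx by rewrite trmxC_unitary.
have UC' : C ^t* \is unitarymx by rewrite trmxC_unitary.
exact: opnorm_unitary_le UA' UC'.
Qed.

(* It suffices to test the bound on vectors with rational coordinates, which
   makes [opnorm] measurable. *)
Definition rat_vector (q : 'cV[rat * rat]_n) : 'cV[R[i]]_n :=
  \col_k Complex (ratr (q k 0).1) (ratr (q k 0).2).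

Lemma rat_vector_dense v (e : R) : 0 < e -> exists q, vnorm (v - rat_vector q) < e.
Proof.
(* The real and imaginary errors of [n] coordinates add up to at most [2 n d]; [n + 1] keeps the
   final bound strict and the denominator positive when [n = 0]. *)
move=> e0; pose d := e / (2 * (n%:R + 1)).
have n1 : 0 < n%:R + 1 :> R by rewrite ltr_wpDl.
have d0 : 0 < d by rewrite divr_gt0// mulr_gt0.
have approx (x : R) : exists q : rat, `|x - ratr q| < d.
  have [|q] := @rat_in_itvoo R (x - d) (x + d); first lra.
  by rewrite in_itv /= => /andP[h1 h2]; exists q; rewrite ltr_norml; apply/andP; split; lra.
pose q := \col_k (sval (cid (approx (complex.Re (v k 0)))),
                  sval (cid (approx (complex.Im (v k 0))))).
exists q; rewrite (le_lt_trans (vnorm_le_coord _))//.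
apply: (@le_lt_trans _ _ (\sum_(k < n) (2 * d))); last first.
  rewrite sumr_const card_ord -[_ *+ n]mulr_natl.
  have -> : n%:R * (2 * d) = e * (n%:R / (n%:R + 1)).
    by rewrite /d; field; rewrite gt_eqF.
  by rewrite gtr_pMr// ltr_pdivrMr// mul1r ltrDl.
apply: ler_sum => k _; rewrite !mxE (le_trans (norm_le_ReIm _))//.
rewrite mulr_natl mulr2n cReD cImD /=; apply/ltW/ltrD.
- by case: cid => x /=; case: (v k 0).
- by case: cid => x /=; case: (v k 0) => a b /=; rewrite /= .
Qed.

Lemma opnorm_leP A (c : R) : 0 <= c ->
  (opnorm A <= c) <-> (forall q, vnorm (A *m rat_vector q) <= c * vnorm (rat_vector q)).
Proof.
move=> c0; split=> [Ac q|H].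
  by rewrite (le_trans (vnorm_mul _ _))// ler_wpM2r ?vnorm_ge0.
apply: opnorm_le => // v; apply/ler_addgt0Pr => e e0.
(* Replacing [v] by a rational vector costs [entry_sum A] times the distance on the left and [c]
   times the distance on the right; [+ 1] keeps the denominator positive. *)
pose d := e / (entry_sum A + c + 1).
have D0 : 0 < entry_sum A + c + 1 by rewrite ltr_wpDl// addr_ge0// entry_sum_ge0.
have [|q vq] := rat_vector_dense v (e := d); first by rewrite divr_gt0.
have {1}-> : v = rat_vector q + (v - rat_vector q) by rewrite addrC subrK.
rewrite mulmxDr (le_trans (vnormD _ _))//.
have h1 := H q; have h2 := vnorm_mul_entry A (v - rat_vector q).
have h3 : vnorm (rat_vector q) <= vnorm v + vnorm (v - rat_vector q).
  rewrite -[vnorm (v - _)]vnormN (le_trans _ (vnormD _ _))//.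
  by rewrite opprB addrC subrK.
have h4 : (entry_sum A + c) * vnorm (v - rat_vector q) <= e.
  have : (entry_sum A + c + 1) * vnorm (v - rat_vector q) <= e.
    by rewrite mulrC -ler_pdivlMr// ltW.
  by apply: le_trans; rewrite ler_wpM2r ?vnorm_ge0// lerDl.
have h5 := ler_wpM2l c0 h3.
apply: le_trans (lerD h1 h2) _; apply: le_trans (lerD h5 (lexx _)) _.
by rewrite mulrDr -addrA lerD2l -mulrDl addrC.
Qed.

End ComplexVectors.

Local Opaque opnorm vnorm.

(** * Cosets and topological groups *)

Section Cosets.
Variable G : groupType.
Implicit Types (A B C : set G) (x y : G).

Lemma ltransE x A : ltrans x A = [set y | A (x^-1 * y)%g].
Proof.
apply/seteqP; split=> [_ [a Aa <-]|y Ay] /=; first by rewrite mulKg.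
by exists (x^-1 * y)%g => //; rewrite mulVKg.
Qed.

Lemma rtransE x A : rtrans A x = [set y | A (y * x^-1)%g].
Proof.
apply/seteqP; split=> [_ [a Aa <-]|y Ay] /=; first by rewrite mulgK.
by exists (y * x^-1)%g => //; rewrite mulgVK.
Qed.

Lemma conjsetE x A : conjset x A = [set y | A (x^-1 * y * x)%g].
Proof.
apply/seteqP; split=> [_ [a Aa <-]|y Ay] /=; first by rewrite !mulgA mulVg mul1g mulgVK.
by exists (x^-1 * y * x)%g => //; rewrite !mulgA mulgV mul1g mulgK.
Qed.

Lemma subgroup1 A : subgroup A -> A 1%g.
Proof. by case. Qed.

Lemma subgroupV A x : subgroup A -> A x -> A x^-1%g.
Proof. by case=> A1 AM Ax; rewrite -(mul1g x^-1%g); exact: AM. Qed.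

Lemma subgroupM A x y : subgroup A -> A x -> A y -> A (x * y)%g.
Proof.
move=> sA Ax Ay; rewrite -(invgK y); apply: sA.2 => //; exact: subgroupV.
Qed.

Lemma subgroupMl A x y : subgroup A -> A x -> A (x * y)%g = A y.
Proof.
move=> sA Ax; apply/propext; split=> [Axy|]; last exact: subgroupM.
by rewrite -(mulKg x y); apply: subgroupM => //; exact: subgroupV.
Qed.

Lemma subgroupMr A x y : subgroup A -> A y -> A (x * y)%g = A x.
Proof.
move=> sA Ay; apply/propext; split=> [Axy|Ax]; last exact: subgroupM.
by rewrite -(mulgK y x); apply: subgroupM => //; exact: subgroupV.
Qed.

Lemma subgroup_invE A x : subgroup A -> A x^-1%g = A x.
Proof.
move=> sA; apply/propext; split=> [/(subgroupV sA)|]; first by rewrite invgK.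
exact: subgroupV.
Qed.

Lemma subgroupI A B : subgroup A -> subgroup B -> subgroup (A `&` B).
Proof.
move=> sA sB; split; first by split; exact: subgroup1.
by move=> x y [Ax Bx] [Ay By]; split; [exact: sA.2|exact: sB.2].
Qed.

Lemma subgroup_conjset x A : subgroup A -> subgroup (conjset x A).
Proof.
move=> sA; rewrite conjsetE; split=> /=; first by rewrite mulg1 mulVg; exact: subgroup1.
move=> y z Ay Az; have := sA.2 _ _ Ay Az.
by rewrite !invgM invgK !mulgA mulgK.
Qed.

Lemma subgroup_bigcap (I : Type) (D : set I) (F : I -> set G) :
  (forall i, D i -> subgroup (F i)) -> subgroup (\bigcap_(i in D) F i).
Proof.
move=> sF; split=> [i Di|x y Fx Fy i Di]; first by apply: subgroup1; exact: sF.
by apply: (sF i Di).2; [exact: Fx|exact: Fy].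
Qed.

Lemma lcoset_eqP B x y : subgroup B -> ltrans x B = ltrans y B <-> B (x^-1 * y)%g.
Proof.
move=> sB; rewrite !ltransE; split=> [/seteqP[_ /(_ y)]/=|Bxy].
  by rewrite mulVg; apply; exact: subgroup1.
apply/seteqP; split=> z /= Bz.
  rewrite -(subgroupMl _ sB Bxy); by rewrite mulgA mulgK.
by rewrite -(mulgK y x^-1%g) -mulgA subgroupMl.
Qed.

Lemma coset_repr_in A : A !=set0 -> A (coset_repr A).
Proof. by move=> A0; exact: xgetPex. Qed.

Lemma lcoset_repr A B C : subgroup B -> left_cosets C B A ->
  A = ltrans (coset_repr A) B /\ A (coset_repr A).
Proof.
move=> sB [x Cx <-].
have H : ltrans x B (coset_repr (ltrans x B)).
  by apply: coset_repr_in; exists x; rewrite ltransE /= mulVg; exact: subgroup1.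
by split => //; apply/lcoset_eqP => //; move: H; rewrite ltransE.
Qed.

Lemma lcoset_repr_prop B x : subgroup B ->
  B (x^-1 * coset_repr (ltrans x B))%g.
Proof.
move=> sB; have [|e _] := @lcoset_repr (ltrans x B) B setT sB; first by exists x.
exact/lcoset_eqP.
Qed.

Lemma lcoset_triv (B : set G) : subgroup B -> trivIset (left_cosets setT B) id.
Proof.
move=> sB; apply/trivIsetP => _ _ [x _ <-] [y _ <-] xy.
rewrite -subset0 => z /=; rewrite !ltransE /= => -[Bx By].
case/eqP: xy; apply/lcoset_eqP => //.
rewrite -(mulgK z x^-1%g) -mulgA; apply: subgroupM => //.
by rewrite -(subgroup_invE _ sB) invgM invgK.
Qed.

(** Finite index in a relative form: the translating elements need not lie in [A], nor [B] inside
    [A], which makes the relation transitive and stable under conjugation and intersection. *)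
Definition fincov A B := exists s : seq G, forall a, A a -> exists2 c, c \in s & B (c^-1 * a)%g.

Lemma fincovS A A' B : A' `<=` A -> fincov A B -> fincov A' B.
Proof. by move=> AA [s H]; exists s => a /AA; exact: H. Qed.

Lemma fincov_trans A B C : fincov A B -> fincov B C -> fincov A C.
Proof.
move=> [s Hs] [t Ht]; exists [seq (c * d)%g | c <- s, d <- t] => a /Hs[c cs /Ht[d dt Cd]].
by exists (c * d)%g; [apply/allpairsP; exists (c, d)|rewrite invgM -mulgA].
Qed.

Lemma fincov_conj x A B : fincov A B -> fincov (conjset x A) (conjset x B).
Proof.
move=> [s Hs]; exists [seq (x * c * x^-1)%g | c <- s] => a.
rewrite !conjsetE => /= /Hs[c cs Bc]; exists (x * c * x^-1)%g; first exact: map_f.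
rewrite !invgM invgK; move: Bc; rewrite !mulgA.
by rewrite mulVg mul1g.
Qed.

(** A nonempty intersection of a left coset of [B] with one of [B'] is a left coset of the
    intersection, so one representative per pair suffices. Disjoint pairs contribute the default
    [1], which does no harm in a cover. *)
Lemma fincovI A B B' : subgroup B -> subgroup B' ->
  fincov A B -> fincov A B' -> fincov A (B `&` B').
Proof.
move=> sB sB' [s Hs] [t Ht].
exists [seq coset_repr (ltrans c B `&` ltrans d B') | c <- s, d <- t] => a Aa.
have [c cs Bc] := Hs _ Aa; have [d dt Bd] := Ht _ Aa.
exists (coset_repr (ltrans c B `&` ltrans d B')).
  by apply/allpairsP; exists (c, d).
have : (ltrans c B `&` ltrans d B') (coset_repr (ltrans c B `&` ltrans d B')).
  by apply: coset_repr_in; exists a; rewrite !ltransE.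
set r := coset_repr _; rewrite !ltransE /= => -[Br Br'].
split; [rewrite -(mulgK c r^-1%g)|rewrite -(mulgK d r^-1%g)]; rewrite -mulgA.
  by apply: subgroupM; rewrite // -(subgroup_invE _ sB) invgM invgK.
by apply: subgroupM; rewrite // -(subgroup_invE _ sB') invgM invgK.
Qed.

Lemma fincov_bigcap A (s : seq G) (F : G -> set G) :
  (forall x, subgroup (F x)) -> (forall x, fincov A (F x)) ->
  fincov A (\bigcap_(x in [set` s]) F x).
Proof.
move=> sF fF; elim: s => [|x s IHs].
  by exists [:: 1%g] => a Aa; exists 1%g; rewrite ?mem_head// => y.
rewrite (_ : \bigcap_(_ in _) _ = F x `&` \bigcap_(x in [set` s]) F x).
  by apply: fincovI => //; apply: subgroup_bigcap.
apply/seteqP; split=> [y Fy|y [Fy1 Fy2] z /=].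
  split; first by apply: Fy; rewrite /= mem_head.
  by move=> z zs; apply: Fy; rewrite /= inE [_ \in s]zs orbT.
by rewrite inE => /predU1P[->//|]; exact: Fy2.
Qed.

Lemma fincov_left_cosets A B : subgroup B ->
  (fincov A B <-> finite_set (left_cosets A B)).
Proof.
move=> sB; split=> [[s Hs]|fin].
  apply: (@sub_finite_set _ _ [set` [seq ltrans c B | c <- s]]) => //.
  move=> _ [a Aa <-] /=; have [c cs Bc] := Hs a Aa.
  by apply/mapP; exists c => //; apply/esym/lcoset_eqP.
exists [seq coset_repr C | C <- finmap.enum_fset (fset_set (left_cosets A B))] => a Aa.
exists (coset_repr (ltrans a B)).
  by apply: map_f; rewrite in_fset_set// inE; exists a.
have := lcoset_repr_prop a sB.
by rewrite -(subgroup_invE _ sB) invgM invgK.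
Qed.

End Cosets.
Section HeckeOpen.
Variables (G : groupType) (K : set G).

Lemma hecke_open_subgroup (A : set G) (s : seq G) : subgroup A ->
  \bigcap_(x in [set` s]) conjset x K `<=` A -> hecke_open K A.
Proof.
move=> sA KA a Aa; exists s => _ [b Kb <-].
by apply: subgroupM => //; exact: KA.
Qed.

Lemma conjset1 (A : set G) : conjset 1%g A = A.
Proof. by rewrite conjsetE; apply/seteqP; split=> y /=; rewrite invg1 mul1g mulg1. Qed.

Lemma hecke_open_super (A : set G) : subgroup A -> K `<=` A -> hecke_open K A.
Proof.
move=> sA KA; apply: (@hecke_open_subgroup _ [:: 1%g]) => //.
by move=> y /(_ 1%g); rewrite /= mem_head conjset1 => /(_ isT); exact: KA.
Qed.

End HeckeOpen.

(** * Open subgroups, closures and compact sets in topological groups *)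

Section TopologicalGroups.
Variable Gs : topGroupType.
Implicit Types (A L U : set Gs) (x y : Gs).

Lemma mulgl_continuous x : continuous (fun y : Gs => (x * y)%g).
Proof.
move=> y; apply: (@continuous_comp _ _ _ (fun y : Gs => (x, y)) (fun p : Gs * Gs => (p.1 * p.2)%g)).
  by apply: cvg_pair; [exact: cvg_cst|exact: cvg_id].
exact: mulg_continuous.
Qed.

Lemma mulgr_continuous x : continuous (fun y : Gs => (y * x)%g).
Proof.
move=> y; apply: (@continuous_comp _ _ _ (fun y : Gs => (y, x)) (fun p : Gs * Gs => (p.1 * p.2)%g)).
  by apply: cvg_pair; [exact: cvg_id|exact: cvg_cst].
exact: mulg_continuous.
Qed.

Lemma divg_continuous : continuous (fun p : Gs * Gs => (p.1 * p.2^-1)%g).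
Proof.
move=> [x y]; apply: (@continuous_comp _ _ _ (fun p : Gs * Gs => (p.1, p.2^-1)%g) (fun p : Gs * Gs => (p.1 * p.2)%g)); last exact: mulg_continuous.
apply: cvg_pair; first exact: cvg_fst.
apply: (@continuous_comp _ _ _ snd (fun x : Gs => x^-1%g)); first exact: cvg_snd.
exact: invg_continuous.
Qed.

Lemma divg_nbhs x y U : nbhs (x * y^-1)%g U -> exists P Q : set Gs,
  [/\ nbhs x P, nbhs y Q & forall a b, P a -> Q b -> U (a * b^-1)%g].
Proof.
move=> /(@divg_continuous (x, y)) [[P Q] /= [Px Qy] PQ].
by exists P, Q; split=> // a b Pa Qb; exact: (PQ (a, b)).
Qed.

Lemma open_ltrans x U : open U -> open (ltrans x U).
Proof.
by move=> oU; rewrite ltransE; apply: open_comp => // y _; exact: mulgl_continuous.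
Qed.

Lemma open_rtrans x U : open U -> open (rtrans U x).
Proof.
by move=> oU; rewrite rtransE; apply: open_comp => // y _; exact: mulgr_continuous.
Qed.

Lemma open_invg U : open U -> open [set x : Gs | U x^-1%g].
Proof. by move=> oU; apply: open_comp => // y _; exact: invg_continuous. Qed.

Lemma open_conjset x U : open U -> open (conjset x U).
Proof.
move=> oU; rewrite conjsetE; apply: open_comp => // y _.
apply: (@continuous_comp _ _ _ (fun y : Gs => (x^-1 * y)%g) (fun y : Gs => (y * x)%g)).
  exact: mulgl_continuous.
exact: mulgr_continuous.
Qed.

Lemma ltrans_nbhs x L : open L -> L 1%g -> nbhs x (ltrans x L).
Proof.
move=> oL L1; apply: open_nbhs_nbhs; split; first exact: open_ltrans.
by rewrite ltransE /= mulVg.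
Qed.

Lemma subgroup_open L : subgroup L -> nbhs 1%g L -> open L.
Proof.
move=> sL L1; rewrite openE => x Lx.
have : nbhs x [set y | L (x^-1 * y)%g].
  by apply: (@mulgl_continuous x^-1%g x); rewrite mulVg.
by apply: filterS => y /=; rewrite subgroupMl//; exact: subgroupV.
Qed.

Lemma subgroup_closed L : subgroup L -> open L -> closed L.
Proof.
move=> sL oL x /(_ (ltrans x L)) H; have [|y [Ly]] := H.
  by apply: ltrans_nbhs => //; exact: subgroup1.
by rewrite ltransE /= subgroupMr// subgroup_invE.
Qed.

Lemma subgroup_closure A : subgroup A -> subgroup (closure A).
Proof.
move=> sA; split; first by apply: subset_closure; exact: subgroup1.
move=> x y Ax Ay U /divg_nbhs[P [Q [Px Qy PQ]]].
have [a [Aa Pa]] := Ax _ Px; have [b [Ab Qb]] := Ay _ Qy.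
by exists (a * b^-1)%g; split; [exact: sA.2|exact: PQ].
Qed.

(** An open subgroup absorbs the difference between a limit point and a nearby point of [A]. This is
    how statements on the completion are reduced to elements of the original group. *)
Lemma closure_decomp A L x : subgroup L -> open L -> closure A x ->
  exists2 a, A a & L (a^-1 * x)%g.
Proof.
move=> sL oL /(_ (ltrans x L)) []; first by apply: ltrans_nbhs => //; exact: subgroup1.
move=> a [Aa]; rewrite ltransE /= => La; exists a => //.
by rewrite -(subgroup_invE _ sL) invgM invgK.
Qed.

Lemma compact_fincov (C L : set Gs) : compact C -> subgroup L -> open L -> fincov C L.
Proof.
rewrite compact_cover => cC sL oL.
have [x _|x Cx|D _ CD] := cC _ C (fun x => ltrans x L).
- exact: open_ltrans.
- by exists x => //; rewrite ltransE /= mulVg; exact: subgroup1.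
exists (finmap.enum_fset D) => a /CD[c cD]; rewrite ltransE => La.
by exists c.
Qed.

(** Pigeonhole for an ultrafilter; in [completion_compact] it selects the coset on which the filter
    concentrates. *)
Lemma ultra_seq_cover (T : Type) (I : eqType) (F : set_system T) (s : seq I) (B : I -> set T) :
  UltraFilter F -> F [set x | exists2 c, c \in s & B c x] ->
  exists2 c, c \in s & F (B c).
Proof.
move=> FU; elim: s => [|c s IHs] Fs.
  by have /filter_ex[x [c]] := Fs.
have [FB|FB] := in_ultra_setVsetC (B c) FU; first by exists c => //; exact: mem_head.
have [|d ds FBd] := IHs; last by exists d => //; rewrite inE ds orbT.
apply: filterS (filterI Fs FB) => x [[d]].
by rewrite inE => /predU1P[->//|ds Bd] _; exists d.
Qed.

End TopologicalGroups.

(** * Subgroups of the completion and their compactness *)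

Section Completion.
Variables (G : groupType) (K : set G) (Gs : topGroupType) (iota : G -> Gs).
Hypotheses (sK : subgroup K) (cG : is_completion (hecke_open K) iota).
Implicit Types (A : set G).

Let iotaM := completion_morph cG.

Lemma iota1 : iota 1%g = 1%g.
Proof. by apply: (@mulgI _ (iota 1%g)); rewrite -iotaM !mulg1. Qed.

Lemma iotaV x : iota x^-1%g = (iota x)^-1%g.
Proof. by apply: (@mulgI _ (iota x)); rewrite -iotaM !mulgV iota1. Qed.

Lemma iota_dense (U : set Gs) (x : Gs) : nbhs x U -> exists g, U (iota g).
Proof.
rewrite nbhsE => -[V [oV Vx] VU].
have [y [Vy [g _ gy]]] := completion_dense cG (ex_intro _ x Vx) oV.
by exists g; apply: VU; rewrite gy.
Qed.

Lemma iota_open_sub A (U : set Gs) : open U -> A = iota @^-1` U ->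
  U `<=` closure (iota @` A).
Proof.
move=> oU AU u Uu W Wu.
have [|g [Wg Ug]] := @iota_dense (W `&` U) u.
  by apply: filterI => //; apply: open_nbhs_nbhs.
by exists (iota g); split=> //; exists g => //; rewrite AU.
Qed.

Lemma subgroup_iota A : subgroup A -> subgroup (iota @` A).
Proof.
move=> sA; split; first by exists 1%g; [exact: subgroup1|exact: iota1].
move=> _ _ [x Ax <-] [y Ay <-]; exists (x * y^-1)%g; first exact: sA.2.
by rewrite iotaM iotaV.
Qed.

Lemma iota_closure_open A : subgroup A -> hecke_open K A -> open (closure (iota @` A)).
Proof.
move=> sA oA; apply: subgroup_open; first exact/subgroup_closure/subgroup_iota.
have [U oU AU] := (completion_induced cG A).1 oA.
apply: filterS (iota_open_sub oU AU) _; apply: open_nbhs_nbhs; split=> //.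
have : A 1%g by exact: subgroup1.
by rewrite {1}AU /= iota1.
Qed.

(** An open subgroup is also closed and the topology of [G] is induced from [Gs], so the closure
    acquires no new elements of [G]. *)
Lemma iota_closureK A : subgroup A -> hecke_open K A ->
  iota @^-1` closure (iota @` A) = A.
Proof.
move=> sA oA; apply/seteqP; split=> [x /= clx|x Ax]; last by apply: subset_closure; exists x.
have [U oU AU] := (completion_induced cG A).1 oA.
have U1 : U 1%g by have := subgroup1 sA; rewrite {1}AU /= iota1.
have [_ [[a Aa <-]]] := clx _ (ltrans_nbhs (iota x) oU U1).
rewrite ltransE /= -iotaV -iotaM => Ua.
have : A (x^-1 * a)%g by rewrite AU.
by rewrite subgroupMr// subgroup_invE.
Qed.

(** Regularity of the group topology lets the closure, and not only the image, fit inside [U]. With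
    [iota_closure_open] this provides a basis at [1] of open subgroups. *)
Lemma completion_nbhs (U : set Gs) : nbhs 1%g U -> exists s : seq G,
  closure (iota @` (\bigcap_(x in [set` s]) conjset x K)) `<=` U.
Proof.
have -> : nbhs (1%g : Gs) = nbhs (1 * 1^-1)%g by rewrite invg1 mulg1.
move=> /divg_nbhs[P [Q [P1 Q1 PQ]]].
have oV : open (interior (P `&` Q)) by exact: open_interior.
have [||s] := (completion_induced cG (iota @^-1` interior (P `&` Q))).2 _ 1%g.
- by exists (interior (P `&` Q)).
- by rewrite /= iota1; apply: filterI.
move=> sub; exists s => y cly.
have sub' l : (\bigcap_(x in [set` s]) conjset x K) l -> (P `&` Q) (iota l).
  move=> Kl; apply: interior_subset; apply: sub; rewrite ltransE /= invg1 mul1g//.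
(* A point [iota l] near [y] has [y^-1 * iota l] in [Q], and [y = iota l * (y^-1 * iota l)^-1] then
   lies in [U] by the choice of [P] and [Q]. *)
have := @mulgl_continuous _ y^-1%g y; rewrite /continuous_at mulVg => /(_ _ Q1).
rewrite nbhs_simpl => /cly[_ [[l Kl <-] Ql]].
have [Pl _] := sub' _ Kl.
by have := PQ _ _ Pl Ql; rewrite invgM invgK mulgA mulgV mul1g.
Qed.

(** Completeness plus total boundedness: an ultrafilter on the closure concentrates on one coset of
    every basic open subgroup, hence is Cauchy. *)
Lemma completion_compact (H : set G) : subgroup H ->
  (forall x, fincov H (conjset x K)) -> compact (closure (iota @` H)).
Proof.
move=> sH fH; set Hs := closure _.
have sHs : subgroup Hs by exact/subgroup_closure/subgroup_iota.
rewrite compact_ultra => F FU FH.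
suff [x Fx] : exists x : Gs, F --> x.
  exists x; split=> //; suff : closure Hs x by rewrite -(closure_id _).1//; exact: closed_closure.
  move=> U /Fx FU'; have [y ?] : Hs `&` U !=set0.
    by apply: (@filter_ex _ F); exact: filterI.
  by exists y.
apply: (completion_complete cG) => U /completion_nbhs[s sU].
set L := \bigcap_(x in _) _ in sU.
have sL : subgroup L by apply: subgroup_bigcap => x _; exact: subgroup_conjset.
have oL : open (closure (iota @` L)).
  by apply: iota_closure_open => //; apply: (@hecke_open_subgroup _ _ _ s).
have sLs : subgroup (closure (iota @` L)) by exact/subgroup_closure/subgroup_iota.
have [t Ht] : fincov H L.
  by apply: fincov_bigcap => // x; exact: subgroup_conjset.
have cov y : Hs y -> exists2 c, c \in t & closure (iota @` L) ((iota c)^-1 * y)%g.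
  move=> /(closure_decomp sLs oL)[_ [h Hh <-] Ly].
  have [c ct Lc] := Ht _ Hh; exists c => //.
  rewrite -(mulgK (iota h) (iota c)^-1%g) -mulgA; apply: (subgroupM sLs) => //.
  by apply: subset_closure; exists (c^-1 * h)%g => //; rewrite iotaM iotaV.
have [c _ Fc] : exists2 c, c \in t & F [set y | closure (iota @` L) ((iota c)^-1 * y)%g].
  by apply: ultra_seq_cover; apply: filterS FH => y /cov.
(* The uniformity is two-sided, so the inverses must concentrate on one left coset as well. *)
have [d _ Fd] : exists2 c, c \in t & F [set y | closure (iota @` L) ((iota c)^-1 * y^-1)%g].
  apply: ultra_seq_cover; apply: filterS FH => y Hy.
  by apply: cov; exact: (subgroupV sHs).
exists [set y | closure (iota @` L) ((iota c)^-1 * y)%g /\ closure (iota @` L) ((iota d)^-1 * y^-1)%g].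
  exact: filterI.
move=> x y /= [xc xd] [yc yd]; split; apply: sU.
  rewrite -(mulgK (iota c) x^-1%g) -mulgA; apply: (subgroupM sLs) => //.
  by rewrite -(subgroup_invE _ sLs) invgM invgK.
rewrite -(mulgK (iota d) x) -mulgA; apply: (subgroupM sLs) => //.
by rewrite -(subgroup_invE _ sLs) invgM.
Qed.

End Completion.

(** * Hecke triples and Schlichting completions *)

Section HeckeTripleFacts.
Variables (R : realType) (n : nat) (G : groupType) (H : set G).
Variable sigma : G -> 'M[R[i]]_n.
Hypothesis tH : hecke_triple H sigma.

Lemma triple_subgroup : subgroup H.
Proof. by case: (triple_pair tH). Qed.

Let sH := triple_subgroup.

Lemma triple_unit h : H h -> sigma h \in unitmx.
Proof. by move=> Hh; apply/unitarymx_unit/(triple_unitary tH). Qed.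

Lemma triple_sigma1 : sigma 1%g = 1%:M.
Proof.
have H1 := subgroup1 sH.
have := triple_morph tH H1 H1; rewrite mulg1 => /(congr1 (mulmx (invmx (sigma 1%g)))).
by rewrite mulmxA mulVmx ?triple_unit// mul1mx => <-.
Qed.

Lemma triple_sigmaV h : H h -> sigma h^-1%g = (sigma h)^t*.
Proof.
move=> Hh; have HV := subgroupV sH Hh.
rewrite -(invmx_unitary (triple_unitary tH Hh)).
have := triple_morph tH HV Hh; rewrite mulVg triple_sigma1 => e.
by rewrite -[RHS]mul1mx e mulmxK// triple_unit.
Qed.

Lemma rep_ker_sub : rep_ker H sigma `<=` H.
Proof. by move=> h []. Qed.

Lemma rep_kerP h k : H h -> H k -> (sigma h = sigma k) <-> rep_ker H sigma (h^-1 * k)%g.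
Proof.
move=> Hh Hk; have HV := subgroupV sH Hh; rewrite /rep_ker /=.
rewrite (triple_morph tH)//; split=> [e|[_ e]].
  split; first exact: subgroupM.
  by rewrite -e -(triple_morph tH)// mulVg triple_sigma1.
rewrite -[LHS]mulmx1 -e mulmxA -(triple_morph tH)// mulgV triple_sigma1.
by rewrite mul1mx.
Qed.

Lemma rep_ker_subgroup : subgroup (rep_ker H sigma).
Proof.
split; first by split; [exact: subgroup1|exact: triple_sigma1].
move=> x y [Hx x1] [Hy y1]; split; first exact: sH.2.
rewrite (triple_morph tH)//; last exact: subgroupV.
rewrite x1 mul1mx -[LHS]mul1mx -{1}y1 -(triple_morph tH) ?mulgV ?triple_sigma1//.
exact: subgroupV.
Qed.

Lemma rep_ker_normal h k : H h -> rep_ker H sigma k -> rep_ker H sigma (h^-1 * k * h)%g.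
Proof.
move=> Hh [Hk k1]; rewrite -mulgA; apply/rep_kerP => //; first exact: subgroupM.
by rewrite (triple_morph tH)// k1 mul1mx.
Qed.

Lemma fincov_rep_ker : fincov H (rep_ker H sigma).
Proof.
pose r (A : 'M[R[i]]_n) := xget 1%g [set h | H h /\ sigma h = A].
exists [seq r A | A <- finmap.enum_fset (fset_set (sigma @` H))] => a Ha.
exists (r (sigma a)).
  by apply: map_f; rewrite in_fset_set ?inE; [exists a|exact: (triple_finite tH)].
have [Hr ra] : [set h | H h /\ sigma h = sigma a] (r (sigma a)).
  by apply: xgetPex; exists a.
exact/rep_kerP.
Qed.

(** Finitely many translates of [conjset x H] cover [H] by the Hecke condition, and finitely many of
    [conjset x K] cover [conjset x H] because [sigma] has finite range. This is the total
    boundedness behind the compactness of [Hs]. *)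
Lemma fincov_conj_rep_ker x : fincov H (conjset x (rep_ker H sigma)).
Proof.
apply: (@fincov_trans _ _ (conjset x H)); last exact/fincov_conj/fincov_rep_ker.
have sHx := subgroup_conjset x sH.
have /(fincov_left_cosets _ (subgroupI sH sHx))[s Hs] := (triple_pair tH).2 x.
by exists s => a /Hs[c cs [_ Hc]]; exists c.
Qed.

End HeckeTripleFacts.

(* All that the analysis on Gs needs to know about a Schlichting completion. *)
Record compact_open_triple (R : realType) (n : nat) (Gs : topGroupType)
    (Hs : set Gs) (sigmas : Gs -> 'M[R[i]]_n) : Prop := {
  cot_hausdorff : hausdorff_space Gs;
  cot_basis : forall U, nbhs (1%g : Gs) U ->
    exists L, [/\ subgroup L, open L & L `<=` U];
  cot_open : open Hs;
  cot_compact : compact Hs;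
  cot_triple : hecke_triple Hs sigmas;
  cot_ker_open : open (rep_ker Hs sigmas) }.

Section Schlichting.
Variables (R : realType) (n : nat) (G : groupType) (H : set G).
Variable sigma : G -> 'M[R[i]]_n.
Variables (Gs : topGroupType) (iota : G -> Gs) (Hs : set Gs).
Variable sigmas : Gs -> 'M[R[i]]_n.
Hypothesis tH : hecke_triple H sigma.
Hypothesis sc : schlichting_completion H sigma iota Hs sigmas.

Let K := rep_ker H sigma.
Let Ks := closure (iota @` K).
Let sH := triple_subgroup tH.
Let sK : subgroup K := rep_ker_subgroup tH.
Let cG := schlichting_group sc.
Let oH : hecke_open K H := hecke_open_super sH (@rep_ker_sub _ _ _ H sigma).
Let oK : hecke_open K K := hecke_open_super sK (fun _ => id).

Lemma schlichting_subgroup : subgroup Hs.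
Proof. by rewrite (schlichting_closure sc); apply/subgroup_closure/(subgroup_iota cG). Qed.

Lemma schlichting_open : open Hs.
Proof. by rewrite (schlichting_closure sc); exact: (iota_closure_open cG). Qed.

Lemma schlichting_compact : compact Hs.
Proof.
rewrite (schlichting_closure sc); apply: (completion_compact sK cG) => // x.
exact: fincov_conj_rep_ker.
Qed.

Lemma schlichting_iotaE : iota @^-1` Hs = H.
Proof. by rewrite (schlichting_closure sc); exact: (iota_closureK cG). Qed.

Lemma schlichting_iota h : H h -> Hs (iota h).
Proof. by move=> Hh; have := schlichting_iotaE; rewrite -{1}/(preimage _ _) => e; rewrite -[Hs _]/((iota @^-1` Hs) h) e. Qed.

Lemma schlichting_decomp L y : subgroup L -> open L -> Hs y ->
  exists2 h, H h & L ((iota h)^-1 * y)%g.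
Proof.
move=> sL oL; rewrite (schlichting_closure sc) => /(closure_decomp sL oL).
by move=> [_ [h Hh <-] Lh]; exists h.
Qed.

Let sKs : subgroup Ks.
Proof. exact/subgroup_closure/(subgroup_iota cG). Qed.

Let oKs : open Ks.
Proof. exact: (iota_closure_open cG). Qed.

Let KsHs : Ks `<=` Hs.
Proof.
rewrite (schlichting_closure sc); apply: closureS => _ [k Kk <-].
by exists k => //; exact: (rep_ker_sub Kk).
Qed.

Let sHs := schlichting_subgroup.

(** On the coset of [iota h] modulo [Ks] the continuous map [sigmas] takes the value [sigma h] on
    the dense image of [h K]. Hence the extension is locally constant. *)
Lemma schlichting_sigmas h k : H h -> Ks k -> sigmas (iota h * k)%g = sigma h.
Proof.
move=> Hh Kk; set x := (iota h * k)%g.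
have Hx : Hs x by apply: subgroupM => //; [exact: schlichting_iota|exact: KsHs].
have cx := (subspace_continuousP _ _).1 (schlichting_continuous sc) x Hx.
apply/matrixP => i j; apply/eqP; apply: contraT => neq.
(* The radius is the supposed discrepancy itself: a point of [iota (h K)] in this ball gives
   [e < e]. *)
pose e := `|sigmas x i j - sigma h i j|.
have e0 : 0 < e by rewrite normr_gt0 subr_eq0.
have W := cx _ (nbhsx_ballx (sigmas x) e e0).
have {}W : nbhs x [set y | Hs y -> ball (sigmas x) e (sigmas y)] by [].
have : nbhs k [set y | Hs (iota h * y)%g -> ball (sigmas x) e (sigmas (iota h * y)%g)].
  exact: (@mulgl_continuous _ (iota h) k _ W).
move=> /Kk[_ [[k' Kk' <-]]] /=.
rewrite -(completion_morph cG); have Hhk : H (h * k')%g by apply: subgroupM => //; exact: (rep_ker_sub Kk').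
move=> /(_ (schlichting_iota Hhk)); rewrite (schlichting_extends sc)// => B.
have := B.2 i j; rewrite (triple_morph tH)//; last exact: (rep_ker_sub Kk').
case: Kk' => _ ->; rewrite mulmx1 /ball /= -/e => lt.
by have := lt; rewrite ltxx.
Qed.

Let decompK y : Hs y -> exists2 h, H h & Ks ((iota h)^-1 * y)%g.
Proof. exact: schlichting_decomp. Qed.

Let sigmas_decomp h y : H h -> Ks ((iota h)^-1 * y)%g -> sigmas y = sigma h.
Proof. by move=> Hh /(schlichting_sigmas Hh); rewrite mulVKg. Qed.

Let Ks_normal h k : H h -> Ks k -> Ks ((iota h)^-1 * k * iota h)%g.
Proof.
move=> Hh Kk U.
move=> /(@mulgr_continuous _ (iota h) _)/(@mulgl_continuous _ (iota h)^-1%g _)/Kk.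
move=> [_ [[k' Kk' <-]]] /= Uk; exists ((iota h)^-1 * iota k' * iota h)%g; split=> //.
exists (h^-1 * k' * h)%g; first exact: rep_ker_normal.
by rewrite !(completion_morph cG) (iotaV cG).
Qed.

(** Every [y] in [Hs] is some [iota h] modulo [Ks], with [sigmas y = sigma h]. It follows that the
    kernel of the extension is open, and that the indices in the two modular functions can be
    compared. *)
Lemma schlichting_rep_ker : rep_ker Hs sigmas = Ks.
Proof.
apply/seteqP; split=> [y [Hy y1]|y Ky].
  have [h Hh Kh] := decompK Hy.
  rewrite -(mulVKg (iota h) y); apply: (subgroupM sKs) => //.
  apply: subset_closure; exists h => //; split=> //.
  by rewrite -(sigmas_decomp Hh Kh).
split; first exact: KsHs.
rewrite (sigmas_decomp (subgroup1 sH)); first exact: (triple_sigma1 tH).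
by rewrite (iota1 cG) invg1 mul1g.
Qed.

Lemma schlichting_triple : hecke_triple Hs sigmas.
Proof.
split.
- split=> // x; apply/fincov_left_cosets.
    by apply: subgroupI => //; exact: subgroup_conjset.
  (* A compact set meets only finitely many cosets of an open subgroup, which gives the Hecke
     condition for [Hs]. *)
  apply: compact_fincov; first exact: schlichting_compact.
    by apply: subgroupI => //; exact: subgroup_conjset.
  by apply: openI; [|apply: open_conjset]; exact: schlichting_open.
- move=> x y Hx Hy; have [h Hh Kh] := decompK Hx; have [k Hk Kk] := decompK Hy.
  rewrite (sigmas_decomp Hh Kh) (sigmas_decomp Hk Kk) -(triple_morph tH)//.
  apply: sigmas_decomp; first exact: subgroupM.
  rewrite (completion_morph cG) invgM.
  have -> : ((iota k)^-1 * (iota h)^-1 * (x * y) =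
    ((iota k)^-1 * ((iota h)^-1 * x) * iota k) * ((iota k)^-1 * y))%g.
    by rewrite !mulgA mulgK.
  by apply: (subgroupM sKs) => //; exact: Ks_normal.
- move=> x Hx; have [h Hh Kh] := decompK Hx.
  by rewrite (sigmas_decomp Hh Kh); exact: (triple_unitary tH).
- apply: sub_finite_set (triple_finite tH) => _ [x Hx <-].
  by have [h Hh Kh] := decompK Hx; exists h => //; rewrite (sigmas_decomp Hh Kh).
Qed.

Lemma schlichting_cot : compact_open_triple Hs sigmas.
Proof.
split.
- exact: (completion_hausdorff cG).
- move=> U /(completion_nbhs cG)[s sU]; eexists; split; last exact: sU.
    apply/subgroup_closure/(subgroup_iota cG)/subgroup_bigcap => x _.
    exact: subgroup_conjset.
  apply: (iota_closure_open cG).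
    by apply: subgroup_bigcap => x _; exact: subgroup_conjset.
  apply: (@hecke_open_subgroup _ _ _ s) => //.
  by apply: subgroup_bigcap => x _; exact: subgroup_conjset.
- exact: schlichting_open.
- exact: schlichting_compact.
- exact: schlichting_triple.
- by rewrite schlichting_rep_ker.
Qed.

End Schlichting.

(** * Haar measure *)

Section CountableSums.

(** Each level set [a >= 1/(k+1)] is finite when the sum is. The lemma reduces sums over a possibly
    uncountable [Gs/Hs] to the reach of countable additivity. *)
Lemma esum_countable (R : realType) (T : choiceType) (S : set T) (a : T -> \bar R) :
  (forall x, S x -> (0 <= a x)%E) -> (\esum_(x in S) a x < +oo)%E ->
  countable [set x | S x /\ a x != 0%E].
Proof.
move=> a0 fin.
pose D k := [set x | S x /\ (k.+1%:R^-1%:E <= a x)%E].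
apply: (@sub_countable _ _ _ (\bigcup_k D k)).
  apply: subset_card_le => x [Sx ax0].
  have ax : (0 < a x)%E by rewrite lt_def ax0 a0.
  case ea : (a x) => [r| |].
  - have r0 : 0 < r by rewrite ea lte_fin in ax.
    exists (Num.truncn r^-1) => //; split=> //; rewrite ea lee_fin.
    rewrite -[leRHS]invrK lef_pV2 ?posrE ?invr_gt0 ?ltr0n//.
    by apply/ltW; have := truncnS_gt r^-1.
  - by exists 0%N => //; split=> //; rewrite ea leey.
  - by rewrite ea in ax.
apply: bigcup_countable => // k _; apply: finite_set_countable.
apply: contrapT => infD.
have F0 : (0 <= \esum_(x in S) a x)%E by exact: esum_ge0.
have Ffin : (\esum_(x in S) a x)%E \is a fin_num by rewrite ge0_fin_numE.
pose M := fine (\esum_(x in S) a x).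
(* More than [M * (k + 1)] terms, each at least [1/(k + 1)], would exceed the total [M]. *)
have [B BD cB] := infinite_set_fset (Num.truncn (M * k.+1%:R)).+1 infD.
have : ((\sum_(x \in [set` B]) (k.+1%:R^-1 : R)%:E)%R <= \esum_(x in S) a x)%E.
  apply: esum_ge; exists [set` B]; first by split=> // x /BD[].
  by apply: lee_fsum => // x /BD[].
rewrite fsbig_finite//= set_fsetK -(fineK Ffin) -/M sumEFin lee_fin.
rewrite big_const_seq count_predT iter_addr_0 -[_ *+ _]mulr_natr mulrC ler_pdivrMr ?ltr0n//.
rewrite leNgt => /negP; apply; apply: lt_le_trans (truncnS_gt _) _.
by rewrite ler_nat.
Qed.

Lemma integral_countable_bigcup d (T : measurableType d) (R : realType)
    (mu : {measure set T -> \bar R}) (I : choiceType) (D : set I) (F : I -> set T)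
    (f : T -> \bar R) :
  countable D -> trivIset D F -> (forall i, D i -> measurable (F i)) ->
  measurable_fun [set: T] f -> (forall x, (0 <= f x)%E) ->
  measurable (\bigcup_(i in D) F i) /\
  (\int[mu]_(x in \bigcup_(i in D) F i) f x = \esum_(i in D) \int[mu]_(x in F i) f x)%E.
Proof.
move=> /countable_injP[e einj] tF mF mf f0.
(* The family is re-indexed by [nat] along the injection [e]; an integer that is not attained gives
   the empty set. *)
pose G k := \bigcup_(i in [set i | D i /\ e i = k]) F i.
have GE i : D i -> G (e i) = F i.
  move=> Di; apply/seteqP; split=> [x [j [Dj eji]]|x Fx]; last by exists i.
  by rewrite (einj j i)// inE.
have G0 k : ~ (e @` D) k -> G k = set0.
  by move=> Dk; rewrite -subset0 => x [i [Di eik]]; exfalso; apply: Dk; exists i.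
have UG : \bigcup_(i in D) F i = \bigcup_k G k.
  apply/seteqP; split=> [x [i Di Fx]|x [k _ [i [Di _] Fx]]]; last by exists i.
  by exists (e i) => //; rewrite GE.
have mG k : measurable (G k).
  by have [[i Di <-]|/G0 ->//] := pselect ((e @` D) k); rewrite GE//; exact: mF.
have tG : trivIset [set: nat] G.
  apply/trivIsetP => k l _ _ kl; rewrite -subset0 => x [[i [Di eik] Fi] [j [Dj ejl] Fj]].
  have ij : i != j by apply: contra kl => /eqP ij; rewrite -eik -ejl ij.
  by have /trivIsetP/(_ i j Di Dj ij) := tF; rewrite -subset0; apply.
rewrite UG; split; first exact: bigcup_measurable.
rewrite ge0_integral_bigcup//; last exact: measurable_funTS.
rewrite nneseries_esumT; last by move=> k; exact: integral_ge0.
rewrite [LHS](_ : _ = \esum_(k in e @` D) \int[mu]_(x in G k) f x)%E.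
  rewrite (reindex_esum _ _ _ _ (inj_bij einj)); apply: eq_esum => i Di.
  by rewrite GE.
rewrite [RHS]esum_mkcond; apply: eq_esum => k _; case: ifPn => //.
by rewrite notin_setE => /G0 ->; rewrite integral_set0.
Qed.

End CountableSums.

(** * Borel sets and locally constant functions *)

Section ContinuousMeasurable.
Variable Gs : topGroupType.

Lemma open_measurable_borel (U : set Gs) : open U -> measurable (U : set (borel Gs)).
Proof. by move=> oU; exact: sub_sigma_algebra. Qed.

Lemma closed_measurable_borel (U : set Gs) : closed U -> measurable (U : set (borel Gs)).
Proof.
move=> cU; rewrite -(setCK U); apply: measurableC; apply: open_measurable_borel.
exact: closed_openC.
Qed.

Lemma continuous_measurable_borel (phi : Gs -> Gs) : continuous phi ->
  measurable_fun [set: borel Gs] (phi : borel Gs -> borel Gs).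
Proof.
move=> cphi; apply: (@measurability _ _ (borel Gs) (borel Gs) setT phi (@open Gs)) => // _ [U oU <-].
rewrite setTI; apply: open_measurable_borel.
by apply: open_comp => // x _; exact: cphi.
Qed.

Lemma measurable_ltrans x (E : set (borel Gs)) : measurable E -> measurable (ltrans x E : set (borel Gs)).
Proof.
move=> mE; rewrite ltransE.
have := continuous_measurable_borel (@mulgl_continuous Gs x^-1%g).
by move=> /(_ measurableT E mE); rewrite setTI.
Qed.

Lemma measurable_rtrans x (E : set (borel Gs)) : measurable E -> measurable (rtrans E x : set (borel Gs)).
Proof.
move=> mE; rewrite rtransE.
have := continuous_measurable_borel (@mulgr_continuous Gs x^-1%g).
by move=> /(_ measurableT E mE); rewrite setTI.
Qed.

Definition invset (E : set Gs) : set Gs := [set x | E x^-1%g].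

Lemma invsetK E : invset (invset E) = E.
Proof. by apply/seteqP; split=> x; rewrite /invset /= invgK. Qed.

Lemma invset_sub A B : A `<=` B -> invset A `<=` invset B.
Proof. by move=> AB x; exact: AB. Qed.

Lemma invset_subgroup A : subgroup A -> invset A = A.
Proof. by move=> sA; apply/seteqP; split=> x; rewrite /invset /= subgroup_invE. Qed.

Lemma invset_ltrans x E : invset (ltrans x E) = rtrans (invset E) x^-1%g.
Proof. by rewrite ltransE rtransE; apply/seteqP; split=> y; rewrite /invset /= invgK invgM. Qed.

Lemma measurable_invset (E : set (borel Gs)) : measurable E -> measurable (invset E : set (borel Gs)).
Proof.
move=> mE; have := continuous_measurable_borel (@invg_continuous Gs).
by move=> /(_ measurableT E mE); rewrite setTI.
Qed.

(* Functions invariant under an open subgroup on one side are locally constant. *)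
Lemma rinv_open (X : Type) (L : set Gs) (f : Gs -> X) (B : set X) :
  subgroup L -> open L -> (forall x l, L l -> f (x * l)%g = f x) -> open (f @^-1` B).
Proof.
move=> sL oL fL; rewrite openE => x /= Bx.
apply: filterS (ltrans_nbhs x oL (subgroup1 sL)) => _ [l Ll <-].
by rewrite /= fL.
Qed.

Lemma linv_open (X : Type) (L : set Gs) (f : Gs -> X) (B : set X) :
  subgroup L -> open L -> (forall x l, L l -> f (l * x)%g = f x) -> open (f @^-1` B).
Proof.
move=> sL oL fL; rewrite openE => x /= Bx.
apply: (@filterS _ (nbhs x) _ (rtrans L x)).
  by move=> _ [l Ll <-]; rewrite /= fL.
apply: open_nbhs_nbhs; split; first exact: open_rtrans.
by rewrite rtransE /= mulgV; exact: subgroup1.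
Qed.

Lemma open_fibers_measurable d (X : measurableType d) (f : Gs -> X) :
  (forall B, open (f @^-1` B)) -> measurable_fun [set: borel Gs] (f : borel Gs -> X).
Proof. by move=> fO _ B mB; rewrite setTI; exact: open_measurable_borel. Qed.

Lemma open_fibers_continuous (X : topologicalType) (f : Gs -> X) :
  (forall B, open (f @^-1` B)) -> continuous f.
Proof. by move=> fO; apply/continuousP => B _; exact: fO. Qed.

End ContinuousMeasurable.

(** * Modular function and invariance under inversion inside [Hs] *)

Section Haar.
Variables (R : realType) (n : nat) (Gs : topGroupType) (Hs : set Gs).
Variable sigmas : Gs -> 'M[R[i]]_n.
Variables (mu : {measure set (borel Gs) -> \bar R}) (Delta : Gs -> R).
Hypothesis cot : compact_open_triple Hs sigmas.
Hypothesis haar : haar_measure mu.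
Hypothesis muH : mu Hs = 1%E.
Hypothesis modD : modular_function mu Delta.
Implicit Types (E N U V L : set Gs).

Let tS := cot_triple cot.
Let sHs := triple_subgroup tS.
Let oHs := cot_open cot.
Let mO := @open_measurable_borel Gs.

Lemma haar_le E U : measurable (E : set (borel Gs)) -> measurable (U : set (borel Gs)) ->
  E `<=` U -> (mu E <= mu U)%E.
Proof. by move=> mE mU EU; apply: le_measure => //; rewrite inE. Qed.

Lemma haar_rtrans x E : measurable (E : set (borel Gs)) -> mu (rtrans E x) = ((Delta x)%:E * mu E)%E.
Proof. by move=> mE; exact: (modD x).2. Qed.

Lemma Delta_gt0 x : 0 < Delta x.
Proof. exact: (modD x).1. Qed.

(** The normalisation of [mu] makes [Delta x] itself a measure, so multiplicativity and triviality
    on [Hs] become identities between sets. *)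
Lemma DeltaE x : mu (rtrans Hs x) = (Delta x)%:E.
Proof. by rewrite haar_rtrans ?muH ?mule1//; exact: mO. Qed.

Lemma rtransM (A : set Gs) x y : rtrans A (x * y)%g = rtrans (rtrans A x) y.
Proof. by rewrite !rtransE; apply/seteqP; split=> z; rewrite /= invgM mulgA. Qed.

Lemma DeltaM x y : Delta (x * y)%g = Delta x * Delta y.
Proof.
apply: EFin_inj; rewrite -DeltaE rtransM haar_rtrans ?DeltaE -?EFinM 1?mulrC//.
by apply: measurable_rtrans; exact: mO.
Qed.

Lemma Delta1 : Delta 1%g = 1.
Proof.
apply: EFin_inj; rewrite -DeltaE rtransE invg1 -muH; congr (mu _).
by apply/seteqP; split=> x; rewrite /= mulg1.
Qed.

Lemma DeltaV x : Delta x^-1%g = (Delta x)^-1.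
Proof.
have Dx := lt0r_neq0 (Delta_gt0 x).
by apply: (mulfI Dx); rewrite -DeltaM mulgV Delta1 divff.
Qed.

Lemma DeltaH h : Hs h -> Delta h = 1.
Proof.
move=> Hh; apply: EFin_inj; rewrite -DeltaE -muH rtransE; congr (mu _).
by apply/seteqP; split=> x; rewrite /= subgroupMr//; exact: subgroupV.
Qed.

Lemma lcosets_bigcup (L A : set Gs) : subgroup L -> (forall x l, A x -> L l -> A (x * l)%g) ->
  A = \bigcup_(B in left_cosets A L) B.
Proof.
move=> sL AL; apply/seteqP; split=> [x Ax|x [_ [a Aa <-]]].
  by exists (ltrans x L); [exists x|rewrite ltransE /= mulVg; exact: subgroup1].
by move=> [l Ll <-]; exact: AL.
Qed.

Lemma lcosets_triv (L A : set Gs) : subgroup L -> trivIset (left_cosets A L) id.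
Proof.
move=> sL; apply: sub_trivIset (lcoset_triv sL) => _ [a _ <-]; by exists a.
Qed.

Lemma haar_finite_lcosets (L A : set Gs) : subgroup L -> open L -> fincov A L ->
  (forall x l, A x -> L l -> A (x * l)%g) ->
  mu A = (\sum_(B \in left_cosets A L) mu L)%E.
Proof.
move=> sL oL /(fincov_left_cosets _ sL) fA AL.
rewrite {1}(lcosets_bigcup sL AL) measure_fin_bigcup//.
- apply: eq_fsbigr => B; rewrite inE => -[a Aa <-].
  exact: (haar_invariant haar a (mO oL)).
- exact: lcosets_triv.
- by move=> _ [a Aa <-]; apply: mO; exact: open_ltrans.
Qed.

(** The inverse of [a L] is [L a^-1], which has measure [mu L] because [Delta] is trivial on [Hs].
    The value is that of [haar_finite_lcosets], so inversion preserves the measure of such sets. *)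
Lemma haar_finite_rcosets (L A : set Gs) : subgroup L -> open L -> fincov A L ->
  A `<=` Hs -> (forall x l, A x -> L l -> A (x * l)%g) ->
  mu (invset A) = (\sum_(B \in left_cosets A L) mu L)%E.
Proof.
move=> sL oL /(fincov_left_cosets _ sL) fA AHs AL.
have -> : invset A = \bigcup_(B in left_cosets A L) invset B.
  by rewrite {1}(lcosets_bigcup sL AL); apply/seteqP; split.
rewrite measure_fin_bigcup//.
- apply: eq_fsbigr => B; rewrite inE => -[a Aa <-].
  rewrite invset_ltrans invset_subgroup//; apply: etrans (haar_rtrans _ (mO oL)) _.
  by rewrite DeltaV DeltaH ?invr1 ?mul1e//; exact: AHs.
- apply/trivIsetP => B C BA CA BC; have /trivIsetP/(_ _ _ BA CA BC) := @lcosets_triv L A sL.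
  by rewrite -!subset0 => D x; exact: (D x^-1%g).
- by move=> _ [a Aa <-]; apply: measurable_invset; apply: mO; exact: open_ltrans.
Qed.

(** Otherwise the compact [Hs], covered by finitely many cosets of its intersection with [L], would
    be null although it has measure 1. *)
Lemma haar_open_subgroup_gt0 L : subgroup L -> open L -> (0 < mu L)%E.
Proof.
move=> sL oL; rewrite lt_def measure_ge0 andbT; apply/eqP => L0.
have sI := subgroupI sHs sL.
have oI : open (Hs `&` L) by exact: openI.
have I0 : mu (Hs `&` L) = 0%E.
  by apply/eqP; rewrite eq_le measure_ge0 andbT -L0; apply: haar_le; [exact: mO|exact: mO|move=> x []].
have HI x l : Hs x -> (Hs `&` L) l -> Hs (x * l)%g.
  by move=> Hx [Hl _]; exact: subgroupM.
have := haar_finite_lcosets sI oI (compact_fincov (cot_compact cot) sI oI) HI.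
by rewrite muH I0 fsbig1// => /eqP; rewrite onee_eq0.
Qed.

Lemma haar_open_gt0 U : open U -> U !=set0 -> (0 < mu U)%E.
Proof.
move=> oU [x Ux].
have [L [sL oL LU]] : exists L, [/\ subgroup L, open L & L `<=` ltrans x^-1%g U].
  apply: (cot_basis cot); apply: open_nbhs_nbhs; split; first exact: open_ltrans.
  by rewrite ltransE /= invgK mulg1.
apply: lt_le_trans (haar_open_subgroup_gt0 sL oL) _.
rewrite -(haar_invariant haar x^-1%g (mO oU)); apply: haar_le => //; apply: mO => //.
exact: open_ltrans.
Qed.

(** A uniform choice of neighbourhood: finitely many cosets [c L_c] inside [U] cover [C], and the
    intersection of these [L_c] works because each [c L_c] is stable under right translation by
    [L_c]. *)
Lemma compact_open_saturation (C U : set Gs) : compact C -> open U -> C `<=` U ->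
  exists L, [/\ subgroup L, open L & forall c l, C c -> L l -> U (c * l)%g].
Proof.
move=> cC oU CU.
have /choice[Lf LfP] : forall c, exists L, C c -> [/\ subgroup L, open L & L `<=` ltrans c^-1%g U].
  move=> c; have [Cc|nCc] := pselect (C c); last by exists setT.
  have [|L HL] := cot_basis cot (U := ltrans c^-1%g U); last by exists L.
  apply: open_nbhs_nbhs; split; first exact: open_ltrans.
  by rewrite ltransE /= invgK mulg1; exact: CU.
move: (cC); rewrite compact_cover => /(_ _ C (fun c => ltrans c (Lf c))) [||D DC CD].
- by move=> c Cc; apply: open_ltrans; case: (LfP c Cc).
- move=> c Cc; exists c => //; rewrite ltransE /= mulVg; apply: subgroup1.
  by case: (LfP c Cc).
have CDc c : c \in D -> C c by move=> /DC; rewrite inE.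
have sL : subgroup (\bigcap_(c in [set` D]) Lf c).
  by apply: subgroup_bigcap => c /= /CDc /LfP[].
exists (\bigcap_(c in [set` D]) Lf c); split=> //.
  apply: subgroup_open => //; apply: filter_bigI => c /CDc /LfP[sc oc _].
  by apply: open_nbhs_nbhs; split=> //; exact: subgroup1.
move=> c l /CD[d /= dD]; rewrite ltransE /= => Ld Ll.
have [sd od dU] := LfP d (CDc _ dD).
have : Lf d (d^-1 * c * l)%g by apply: subgroupM => //; exact: Ll.
by move=> /dU; rewrite ltransE /= invgK !mulgA mulgV mul1g.
Qed.

(** Inner regularity: a compact subset [C] of [U] lies in a finite union [V] of left cosets of an
    open subgroup, still inside [U], and inversion preserves the measure of [V]. *)
Lemma haar_inv_open U : open U -> U `<=` Hs -> (mu U <= mu (invset U))%E.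
Proof.
move=> oU UHs; rewrite (haar_inner haar oU); apply: ge_ereal_sup => _ [C [cC CU] <-].
have [L [sL oL CL]] := compact_open_saturation cC oU CU.
pose V := [set x | exists2 c, C c & L (c^-1 * x)%g].
have VU : V `<=` U by move=> x [c Cc Lx]; rewrite -(mulVKg c x); exact: CL.
have VL x l : V x -> L l -> V (x * l)%g.
  by move=> [c Cc Lx] Ll; exists c => //; rewrite mulgA; exact: subgroupM.
have CV : C `<=` V by move=> c Cc; exists c => //; rewrite mulVg; exact: subgroup1.
have oV : open V.
  rewrite (lcosets_bigcup sL VL); apply: bigcup_open => _ [a _ <-]; exact: open_ltrans.
have fV : fincov V L.
  have [s Hs'] := compact_fincov cC sL oL; exists s => x [c Cc Lx].
  have [d ds Ld] := Hs' c Cc; exists d => //.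
  by rewrite -(mulgK c d^-1%g) -mulgA; exact: subgroupM.
apply: (@le_trans _ _ (mu V)).
  by apply: haar_le => //; [apply: (@closed_measurable_borel Gs); exact: (compact_closed (cot_hausdorff cot))|exact: mO].
rewrite (haar_finite_lcosets sL oL fV VL).
rewrite -(haar_finite_rcosets sL oL fV (subset_trans VU UHs) VL).
by apply: haar_le; [by apply: (@measurable_invset Gs); exact: mO|by apply: measurable_invset; exact: mO|exact: (@invset_sub Gs)].
Qed.

(** Outer regularity replaces [E] by an open set, cut down to [Hs]; the open case is then applied to
    the inverse of that set. *)
Lemma haar_inv_le E : measurable (E : set (borel Gs)) -> E `<=` Hs -> (mu (invset E) <= mu E)%E.
Proof.
move=> mE EHs; rewrite (haar_outer haar mE).
apply: le_ereal_inf_tmp => _ [U [oU EU] <-].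
have oUH : open (U `&` Hs) by exact: openI.
apply: (@le_trans _ _ (mu (invset (U `&` Hs)))).
  apply: haar_le; [exact: measurable_invset|by apply: (@measurable_invset Gs); exact: mO|].
  by apply: invset_sub => x Ex; split; [exact: EU|exact: EHs].
apply: (@le_trans _ _ (mu (U `&` Hs))); last by apply: haar_le; [exact: mO|exact: mO|move=> x[]].
rewrite -{2}(invsetK (U `&` Hs)); apply: haar_inv_open; first exact: open_invg.
by rewrite -[X in _ `<=` X](invset_subgroup sHs); apply: invset_sub => x [].
Qed.

Lemma haar_inv E : measurable (E : set (borel Gs)) -> E `<=` Hs -> mu (invset E) = mu E.
Proof.
move=> mE EHs; apply/eqP; rewrite eq_le haar_inv_le//=.
rewrite -{1}(invsetK E); apply: haar_inv_le; first exact: measurable_invset.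
by rewrite -[X in _ `<=` X](invset_subgroup sHs); exact: invset_sub.
Qed.

End Haar.

(** * Integrals of matrix-valued functions *)

Section MatrixMeasurable.
Variables (d : measure_display) (T : measurableType d) (R : realType) (n : nat).
Implicit Types (F Phi : T -> 'M[R[i]]_n).

Definition mmeasurable F : Prop := forall k l,
  measurable_fun [set: T] (fun x => complex.Re (F x k l)) /\
  measurable_fun [set: T] (fun x => complex.Im (F x k l)).

Lemma mmeasurableM F Phi : mmeasurable F -> mmeasurable Phi ->
  mmeasurable (fun x => F x *m Phi x).
Proof.
move=> mF mP k l; split.
  rewrite (_ : (fun _ => _) = fun x => \sum_j (complex.Re (F x k j) * complex.Re (Phi x j l)
     - complex.Im (F x k j) * complex.Im (Phi x j l))); last first.
    by apply/funext => x; rewrite mxE cRe_sum; apply: eq_bigr => j _; rewrite cReM.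
  apply: measurable_sum => j; apply: measurable_funB; apply: measurable_funM;
    by [case: (mF k j)|case: (mP j l)].
rewrite (_ : (fun _ => _) = fun x => \sum_j (complex.Re (F x k j) * complex.Im (Phi x j l)
     + complex.Im (F x k j) * complex.Re (Phi x j l))); last first.
  by apply/funext => x; rewrite mxE cIm_sum; apply: eq_bigr => j _; rewrite cImM.
apply: measurable_sum => j; apply: measurable_funD; apply: measurable_funM;
  by [case: (mF k j)|case: (mP j l)].
Qed.

Lemma mmeasurableD F Phi : mmeasurable F -> mmeasurable Phi ->
  mmeasurable (fun x => F x + Phi x).
Proof.
move=> mF mP k l; have [mF1 mF2] := mF k l; have [mP1 mP2] := mP k l; split.
  by under eq_fun do rewrite mxE cReD; exact: measurable_funD.
by under eq_fun do rewrite mxE cImD; exact: measurable_funD.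
Qed.

Lemma mmeasurable_cst (A : 'M[R[i]]_n) : mmeasurable (fun=> A).
Proof. by move=> k l; split; exact: measurable_cst. Qed.

Lemma mmeasurableZ a F : mmeasurable F -> mmeasurable (fun x => a *: F x).
Proof.
move=> mF; under eq_fun do rewrite -mul_scalar_mx.
by apply: mmeasurableM => //; exact: mmeasurable_cst.
Qed.

Lemma measurable_opnorm F : mmeasurable F -> measurable_fun [set: T] (fun x => opnorm (F x)).
Proof.
move=> mF; apply: (measurability _ (RGenOInfty.measurableE R)) => // _ [_ [c ->] <-].
rewrite setTI.
have [c0|c0] := ltP c 0.
  rewrite [X in measurable X](_ : _ = setT)//; apply/seteqP; split=> // x _ /=.
  by rewrite in_itv /= andbT (lt_le_trans c0)// opnorm_ge0.
(* Comparing squares of norms makes each condition polynomial in the entries of [F x]. *)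
rewrite [X in measurable X](_ : _ = ~` \bigcap_(q : 'cV[rat * rat]_n)
    [set x | rdot (F x *m rat_vector R q) (F x *m rat_vector R q) <= c ^+ 2 * rdot (rat_vector R q) (rat_vector R q)]); last first.
  have sqE x q : (rdot (F x *m rat_vector R q) (F x *m rat_vector R q) <= c ^+ 2 * rdot (rat_vector R q) (rat_vector R q))
     = (vnorm (F x *m rat_vector R q) <= c * vnorm (rat_vector R q)).
    by rewrite -!sqr_vnorm -exprMn ler_sqr ?nnegrE ?vnorm_ge0// mulr_ge0// vnorm_ge0.
  apply/seteqP; split=> x /=.
    rewrite in_itv /= andbT => cF H; move: cF; rewrite ltNge => /negP; apply.
    by apply/(opnorm_leP _ c0) => q; rewrite -sqE; exact: (H q).
  move=> H; rewrite in_itv /= andbT ltNge; apply/negP => /(opnorm_leP _ c0) H'.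
  by apply: H => q _ /=; rewrite sqE.
apply: measurableC.
rewrite -[X in measurable X]setCK setC_bigcap; apply: measurableC.
apply: countable_bigcupT_measurable => [|q]; first exact: countableP.
apply: measurableC; rewrite -[X in measurable X]setTI.
pose g x := rdot (F x *m rat_vector R q) (F x *m rat_vector R q).
have mg : measurable_fun [set: T] g.
  have mFq k : measurable_fun [set: T] (fun x => complex.Re ((F x *m rat_vector R q) k 0)) /\
       measurable_fun [set: T] (fun x => complex.Im ((F x *m rat_vector R q) k 0)).
    split.
      under eq_fun do rewrite mxE cRe_sum.
      apply: measurable_sum => j; under eq_fun do rewrite cReM.
      by apply: measurable_funB; apply: measurable_funM => //; case: (mF k j).
    under eq_fun do rewrite mxE cIm_sum.
    apply: measurable_sum => j; under eq_fun do rewrite cImM.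
    by apply: measurable_funD; apply: measurable_funM => //; case: (mF k j).
  apply: measurable_sum => k; have [m1 m2] := mFq k.
  by apply: measurable_funD; exact: measurable_funM.
have mle := @measurable_fun_ler _ _ _ setT g (cst (c ^+ 2 * rdot (rat_vector R q) (rat_vector R q))) mg (measurable_cst _).
by apply: (mle measurableT [set true]).
Qed.

End MatrixMeasurable.

Section MatrixIntegral.
Variables (Gs : topGroupType) (R : realType) (n : nat).
Local Notation T := (borel Gs).
Variable mu : {measure set T -> \bar R}.
Implicit Types (F Phi : Gs -> 'M[R[i]]_n) (A B : 'M[R[i]]_n).

Definition mnormint F : \bar R := (\int[mu]_x (opnorm (F x))%:E)%E.

Definition mint F : 'M[R[i]]_n := \matrix_(k, l) cintegral mu (fun x => F x k l).

Definition mintegrable F : Prop := mmeasurable (F : T -> _) /\ (mnormint F < +oo)%E.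

Lemma mnormint_ge0 F : (0 <= mnormint F)%E.
Proof. by apply: integral_ge0 => x _; rewrite lee_fin opnorm_ge0. Qed.

Lemma measurable_opnormE F : mmeasurable (F : T -> _) ->
  measurable_fun [set: T] (fun x => (opnorm (F x))%:E).
Proof. by move=> mF; apply/measurable_EFinP; exact: measurable_opnorm. Qed.

Lemma mintegrable_opnorm F : mintegrable F ->
  mu.-integrable [set: T] (EFin \o (fun x => opnorm (F x))).
Proof.
move=> [mF fF]; apply/integrableP; split; first exact: measurable_opnormE.
by under eq_integral do rewrite /= ger0_norm ?opnorm_ge0//.
Qed.

Lemma mintegrable_entry F k l : mintegrable F ->
  mu.-integrable [set: T] (EFin \o (fun x => complex.Re (F x k l))) /\
  mu.-integrable [set: T] (EFin \o (fun x => complex.Im (F x k l))).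
Proof.
move=> iF; have iN := mintegrable_opnorm iF; have [mR mI] := iF.1 k l; split.
- apply: le_integrable iN => //; first exact/measurable_EFinP.
  move=> x _ /=; rewrite lee_fin [leRHS]ger0_norm ?opnorm_ge0//.
  exact: le_trans (Re_le_norm _) (entry_le_opnorm _ _ _).
- apply: le_integrable iN => //; first exact/measurable_EFinP.
  move=> x _ /=; rewrite lee_fin [leRHS]ger0_norm ?opnorm_ge0//.
  exact: le_trans (Im_le_norm _) (entry_le_opnorm _ _ _).
Qed.

Section RealFunctional.
Variable Lam : 'M[R[i]]_n -> R.
Hypotheses (LamD : forall A B, Lam (A + B) = Lam A + Lam B)
  (LamZ : forall (r : R) A, Lam (r%:C *: A) = r * Lam A).

Let Lam_sum (I : Type) (s : seq I) (f : I -> 'M[R[i]]_n) :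
  Lam (\sum_(i <- s) f i) = \sum_(i <- s) Lam (f i).
Proof.
have L0 : Lam 0 = 0 by rewrite -(scale0r 0) (LamZ 0) mul0r.
exact: (big_morph _ LamD L0).
Qed.

(** Real linearity determines [Lam] by the real and imaginary parts of the entries, which is exactly
    what the entrywise integral controls. The pairing [A -> rdot w (A *m v)] is of this kind. *)
Lemma real_functionalE A : Lam A = \sum_k \sum_l
  (Lam (delta_mx k l) * complex.Re (A k l) + Lam ('i%C *: delta_mx k l) * complex.Im (A k l)).
Proof.
rewrite {1}(matrix_sum_delta A) Lam_sum; apply: eq_bigr => k _.
rewrite Lam_sum; apply: eq_bigr => l _.
have {1}-> : A k l = (complex.Re (A k l))%:C + (complex.Im (A k l))%:C * 'i%C.
  by rewrite {1}[A k l]complexE mulrC.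
by rewrite scalerDl LamD LamZ -scalerA LamZ mulrC [X in _ + X]mulrC.
Qed.

Lemma real_functional_int F : mintegrable F ->
  mu.-integrable [set: T] (EFin \o (fun x => Lam (F x))) /\
  Lam (mint F) = \int[mu]_x Lam (F x).
Proof.
move=> iF.
pose h k l x := Lam (delta_mx k l) * complex.Re (F x k l) + Lam ('i%C *: delta_mx k l) * complex.Im (F x k l).
have ih k l : mu.-integrable [set: T] (EFin \o h k l) /\
    \int[mu]_x h k l x = Lam (delta_mx k l) * complex.Re (mint F k l) + Lam ('i%C *: delta_mx k l) * complex.Im (mint F k l).
  have [iR iI] := mintegrable_entry k l iF.
  have iR' : mu.-integrable [set: T] (EFin \o (fun x => Lam (delta_mx k l) * complex.Re (F x k l))).
    exact: (integrableZl measurableT (Lam (delta_mx k l)) iR).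
  have iI' : mu.-integrable [set: T] (EFin \o (fun x => Lam ('i%C *: delta_mx k l) * complex.Im (F x k l))).
    exact: (integrableZl measurableT (Lam ('i%C *: delta_mx k l)) iI).
  split; first exact: (integrableD measurableT iR' iI').
  by rewrite RintegralD// !RintegralZl// !mxE.
have sumint (I : Type) (s : seq I) (g : I -> T -> R) (c : I -> R) :
    (forall i, mu.-integrable [set: T] (EFin \o g i) /\ \int[mu]_x g i x = c i) ->
    mu.-integrable [set: T] (EFin \o (fun x => \sum_(i <- s) g i x)) /\
    \int[mu]_x (\sum_(i <- s) g i x) = \sum_(i <- s) c i.
  move=> gc; elim: s => [|i s [IH1 IH2]].
    split; last by under eq_Rintegral do rewrite big_nil; rewrite Rintegral_cst// mul0r big_nil.
    by under eq_fun do rewrite /= big_nil; exact: integrable0.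
  have E : (fun x => \sum_(j <- i :: s) g j x) = (fun x => g i x + \sum_(j <- s) g j x).
    by apply/funext => x; rewrite big_cons.
  rewrite E big_cons; split; first exact: (integrableD measurableT (gc i).1 IH1).
  by rewrite RintegralD ?IH2 ?(gc i).2//; case: (gc i).
have LE : (fun x => Lam (F x)) = fun x => \sum_k \sum_l h k l x.
  by apply/funext => x; rewrite real_functionalE.
rewrite LE (real_functionalE (mint F)).
by have [i1 ->] := sumint _ (index_enum 'I_n) (fun k x => \sum_l h k l x) _
  (fun k => sumint _ (index_enum 'I_n) (h k) _ (ih k)).
Qed.

End RealFunctional.

(* Duality: w = mint F *m v is paired with itself, and the pairing with w is a
   real functional that commutes with the integral. *)
Lemma mint_le F : mintegrable F -> ((opnorm (mint F))%:E <= mnormint F)%E.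
Proof.
move=> iF; have iN := mintegrable_opnorm iF.
have ffin : mnormint F \is a fin_num by rewrite ge0_fin_numE ?mnormint_ge0//; exact: iF.2.
rewrite -(fineK ffin) lee_fin.
have nE : fine (mnormint F) = \int[mu]_x opnorm (F x) by [].
have n0 : 0 <= fine (mnormint F) by rewrite fine_ge0// mnormint_ge0.
apply: opnorm_le => // v; set w := mint F *m v.
have [w0|w0] := eqVneq (vnorm w) 0; first by rewrite w0 mulr_ge0// vnorm_ge0.
have w1 : 0 < vnorm w by rewrite lt_def w0 vnorm_ge0.
rewrite -(ler_pM2r w1) -expr2 sqr_vnorm.
have [i1 e1] := @real_functional_int (fun M => rdot w (M *m v))
  (fun A B => etrans (congr1 (rdot w) (mulmxDl A B v)) (rdotDr _ _ _))
  (fun r A => etrans (congr1 (rdot w) (esym (scalemxAl _ A v))) (rdotZr _ _ _)) F iF.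
rewrite {2}/w e1 nE -mulrA mulrC -RintegralZl//.
apply: le_Rintegral => //.
  exact: (integrableZl measurableT (vnorm v * vnorm w) iN).
move=> x _; apply: le_trans (rdot_le _ _) _.
rewrite mulrAC [leRHS]mulrC ler_wpM2l ?vnorm_ge0// mulrC.
exact: vnorm_mul.
Qed.

Lemma ReZC (r : R) (z : R[i]) : complex.Re (r%:C * z) = r * complex.Re z.
Proof. by rewrite cReM /= mul0r subr0. Qed.
Lemma ImZC (r : R) (z : R[i]) : complex.Im (r%:C * z) = r * complex.Im z.
Proof. by rewrite cImM /= mul0r addr0. Qed.

Lemma mint_linear (S : 'M[R[i]]_n -> 'M[R[i]]_n) F :
  (forall A B, S (A + B) = S A + S B) -> (forall (r : R) A, S (r%:C *: A) = r%:C *: S A) ->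
  mintegrable F -> mint (fun x => S (F x)) = S (mint F).
Proof.
move=> SD SZ iF; apply/matrixP => k l; rewrite mxE /cintegral.
have [||_ e1] := @real_functional_int (fun A => complex.Re (S A k l)) _ _ F iF.
- by move=> A B; rewrite SD mxE cReD.
- by move=> r A; rewrite SZ mxE ReZC.
have [||_ e2] := @real_functional_int (fun A => complex.Im (S A k l)) _ _ F iF.
- by move=> A B; rewrite SD mxE cImD.
- by move=> r A; rewrite SZ mxE ImZC.
by rewrite -e1 -e2; case: (S _ _ _).
Qed.

Lemma mint_mull A F : mintegrable F -> mint (fun x => A *m F x) = A *m mint F.
Proof.
by apply: (@mint_linear (mulmx A)) => [B C|r B]; rewrite ?mulmxDr ?scalemxAr.
Qed.

Lemma mint_mulr A F : mintegrable F -> mint (fun x => F x *m A) = mint F *m A.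
Proof.
by apply: (@mint_linear (mulmxr A)) => [B C|r B]; rewrite /= ?mulmxDl ?scalemxAl.
Qed.

Lemma mint_indic (E : set Gs) A (f : Gs -> 'M[R[i]]_n) : measurable (E : set T) ->
  (forall x, E x -> f x = A) -> (forall x, ~ E x -> f x = 0) ->
  mint f = (fine (mu E))%:C *: A.
Proof.
move=> mE fE f0.
have H (g : 'M[R[i]]_n -> R) : g 0 = 0 -> \int[mu]_x g (f x) = g A * fine (mu E).
  move=> g0; rewrite -Rintegral_cst// [RHS]Rintegral_mkcond.
  apply: eq_Rintegral => x _; rewrite patchE; case: ifPn.
    by rewrite inE => /fE ->.
  by rewrite notin_setE => /f0 ->.
apply/matrixP => k l; rewrite !mxE /cintegral.
rewrite (H (fun A => complex.Re (A k l))) ?mxE//.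
rewrite (H (fun A => complex.Im (A k l))) ?mxE//.
by apply/eqP; rewrite eq_complex ReZC ImZC /= mulrC [X in _ && (X == _)]mulrC !eqxx.
Qed.

Lemma mint_ae F Phi : mmeasurable (F : T -> _) -> mmeasurable (Phi : T -> _) ->
  ae_equal mu F Phi -> mint F = mint Phi.
Proof.
move=> mF mP FP; apply/matrixP => k l; rewrite !mxE /cintegral /Rintegral.
have [mF1 mF2] := mF k l; have [mP1 mP2] := mP k l.
congr (Complex (fine _) (fine _)); apply: ae_eq_integral => //.
- exact/measurable_EFinP.
- exact/measurable_EFinP.
- by apply: filterS FP => x /= -> _.
- exact/measurable_EFinP.
- exact/measurable_EFinP.
- by apply: filterS FP => x /= -> _.
Qed.

Lemma mnormint_ae F Phi : mmeasurable (F : T -> _) -> mmeasurable (Phi : T -> _) ->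
  ae_equal mu F Phi -> mnormint F = mnormint Phi.
Proof.
move=> mF mP FP; apply: ge0_ae_eq_integral => //.
- exact: measurable_opnormE.
- exact: measurable_opnormE.
- by move=> x _; rewrite lee_fin opnorm_ge0.
- by move=> x _; rewrite lee_fin opnorm_ge0.
- by apply: filterS FP => x /= -> _.
Qed.

Lemma ae_equal_sym F Phi : ae_equal mu F Phi -> ae_equal mu Phi F.
Proof. by apply: filterS => x /= ->. Qed.

Lemma ae_equal_trans F G' Phi : ae_equal mu F G' -> ae_equal mu G' Phi -> ae_equal mu F Phi.
Proof. by apply: filterS2 => x /= -> ->. Qed.

End MatrixIntegral.

(** * Integration over cosets *)

Section HaarIntegrals.
Variables (R : realType) (n : nat) (Gs : topGroupType) (Hs : set Gs).
Variable sigmas : Gs -> 'M[R[i]]_n.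
Variables (mu : {measure set (borel Gs) -> \bar R}) (Delta : Gs -> R).
Hypothesis cot : compact_open_triple Hs sigmas.
Hypothesis haar : haar_measure mu.
Hypothesis muH : mu Hs = 1%E.
Hypothesis modD : modular_function mu Delta.
Implicit Types (E N U V L : set Gs).
Local Notation T := (borel Gs).

Let tS := cot_triple cot.
Let sHs := triple_subgroup tS.
Let oHs := cot_open cot.
Let mO := @open_measurable_borel Gs.
Let C := left_cosets [set: Gs] Hs.

Lemma haar_coset A : C A -> mu A = 1%E.
Proof. by move=> [a _ <-]; rewrite -muH; exact: (haar_invariant haar a (mO oHs)). Qed.

Lemma coset_open A : C A -> open A.
Proof. by move=> [a _ <-]; exact: open_ltrans. Qed.

(* By outer regularity a null set meets only countably many cosets of Hs, and on
   a single coset inversion scales null sets by a value of Delta. *)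
Lemma haar_inv_null N : measurable (N : set T) -> mu N = 0%E -> mu (invset N) = 0%E.
Proof.
move=> mN N0.
(* Only finiteness of [mu U] matters; the bound 1 is arbitrary. *)
have [U [oU NU] U1] : exists2 U, open U /\ N `<=` U & (mu U < 1)%E.
  have : (ereal_inf [set mu U | U in [set U : set Gs | open U /\ N `<=` U]] < 1)%E.
    by rewrite -(haar_outer haar mN) N0 lte01.
  by move=> /ereal_inf_lt[_ [U [oU NU] <-] U1]; exists U.
have mAU A : C A -> measurable (A `&` U : set T).
  by move=> CA; apply: mO; apply: openI => //; exact: coset_open.
have sumU : (\esum_(A in C) mu (A `&` U) <= mu U)%E.
  apply: ge_ereal_sup => _ [X [fX XC] <-].
  rewrite -measure_fin_bigcup//.
  - apply: haar_le; [|exact: mO|by move=> x [A _ []]].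
    apply: mO; apply: bigcup_open => A /XC CA.
    by apply: openI => //; exact: coset_open.
  - apply/trivIsetP => A B /XC CA /XC CB AB.
    have /trivIsetP/(_ _ _ CA CB AB) := lcoset_triv sHs.
    by rewrite -!subset0 => D x [[Ax _] [Bx _]]; exact: (D x).
  - by move=> A /XC; exact: mAU.
have cD := esum_countable (fun A _ => measure_ge0 mu (A `&` U)) (le_lt_trans sumU (lt_trans U1 (ltry 1))).
set D := [set _ | _] in cD.
have ND : invset N = \bigcup_(A in D) invset (N `&` A).
  apply/seteqP; split=> [x /= Nx|x [A _ []]//].
  exists (ltrans x^-1%g Hs); last first.
    by split=> //; rewrite ltransE /= mulVg; exact: subgroup1.
  have CA : C (ltrans x^-1%g Hs) by exists x^-1%g.
  (* A coset that meets [N] meets [U] in a nonempty open set, which has positive measure; so [D]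
     misses no such coset. *)
  split=> //; rewrite gt_eqF//; apply: (haar_open_gt0 cot haar muH).
    by apply: openI => //; exact: coset_open.
  exists x^-1%g; split; last exact: NU.
  by rewrite ltransE /= mulVg; exact: subgroup1.
have mNA A : D A -> measurable (invset (N `&` A) : set T).
  move=> [CA _]; apply: (@measurable_invset Gs); apply: measurableI => //.
  by apply: mO; exact: coset_open.
have tD : trivIset D (fun A => invset (N `&` A)).
  apply/trivIsetP => A B [CA _] [CB _] AB.
  have /trivIsetP/(_ _ _ CA CB AB) := lcoset_triv sHs.
  by rewrite -!subset0 => E x [[_ Ax] [_ Bx]]; exact: (E x^-1%g).
(* With the constant integrand 1 this is additivity of [mu] over the countable set [D]. *)
have [mND eND] := integral_countable_bigcup mu cD tD mNA (@measurable_cst _ _ T _ setT 1%E) (fun _ => lee01).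
move: eND; rewrite -ND integral_cst ?mul1e//; last by rewrite ND.
move=> ->; apply: esum1 => A DA; rewrite integral_cst ?mul1e//; last exact: mNA.
have [[a _ aA] _] := DA; set M := ltrans a^-1%g (N `&` A).
have mNA' : measurable (N `&` A : set T).
  by apply: measurableI => //; apply: mO; apply: coset_open; case: DA.
have MHs : M `<=` Hs.
  by move=> y; rewrite /M -aA !ltransE /= invgK mulKg => -[].
have NM : N `&` A = ltrans a M.
  by rewrite /M !ltransE; apply/seteqP; split=> y /=; rewrite invgK mulVKg.
have M0 : mu M = 0%E.
  have -> : mu M = mu (N `&` A) by exact: (haar_invariant haar a^-1%g mNA').
  by apply/eqP; rewrite eq_le measure_ge0 andbT -N0; apply: haar_le => // x [].
have mM : measurable (M : set T) by exact: measurable_ltrans.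
rewrite NM invset_ltrans.
apply: etrans (haar_rtrans modD _ (measurable_invset mM)) _.
by rewrite (haar_inv cot haar muH modD mM MHs) M0 mule0.
Qed.

(* Gs/Hs may be uncountable, hence the comparison on countable sets of cosets. *)
Lemma integral_lcosets (u : Gs -> \bar R) : (forall x, (0 <= u x)%E) ->
  (forall x h, Hs h -> u (x * h)%g = u x) ->
  (\int[mu]_x u x = \esum_(A in C) u (coset_repr A))%E.
Proof.
move=> u0 uH.
have mu' : measurable_fun [set: T] (u : T -> _).
  by apply: open_fibers_measurable => B; exact: (@rinv_open Gs _ Hs u B sHs oHs uH).
have uA A x : C A -> A x -> u x = u (coset_repr A).
  move=> CA Ax; have [eA _] := lcoset_repr sHs CA.
  by move: Ax; rewrite eA => -[h Hh <-]; rewrite -eA uH.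
have iA A : C A -> (\int[mu]_(x in A) u x = u (coset_repr A))%E.
  move=> CA; have mA : measurable (A : set T) by apply: mO; exact: coset_open.
  transitivity (\int[mu]_(x in A) cst (u (coset_repr A)) x)%E.
    by apply: eq_integral => x; rewrite inE => /(uA _ _ CA).
  by apply: etrans (integral_cst mu mA _) _; rewrite haar_coset// mule1.
have sub (D : set (set Gs)) : countable D -> D `<=` C ->
    measurable (\bigcup_(A in D) A : set T) /\
    (\int[mu]_(x in \bigcup_(A in D) A) u x = \esum_(A in D) u (coset_repr A))%E.
  move=> cD DC; have tD : trivIset D id by exact: sub_trivIset DC (lcoset_triv sHs).
  have mD (A : set Gs) : D A -> measurable (id A : set T).
    by move=> DA; apply: mO; apply: coset_open; exact: DC.
  have [mUD ->] := integral_countable_bigcup mu cD tD mD mu' u0.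
  by split=> //; apply: eq_esum => A DA; exact: iA (DC _ DA).
apply/eqP; rewrite eq_le; apply/andP; split; last first.
  apply: ge_ereal_sup => _ [X [fX XC] <-].
  have [mX eX] := sub X (finite_set_countable fX) XC.
  rewrite -(@esum_fset _ _ _ (fun A => u (coset_repr A)))// -eX.
  exact: ge0_subset_integral.
have [->|fin] := eqVneq (\esum_(A in C) u (coset_repr A))%E +oo%E; first exact: leey.
have cD := esum_countable (fun A _ => u0 (coset_repr A)) (_ : (\esum_(A in C) u (coset_repr A) < +oo)%E).
have {}cD := cD ltac:(by rewrite lt_neqAle fin leey).
set D := [set _ | _] in cD.
have [mD eD] := sub D cD (fun A DA => DA.1).
(* Being constant on cosets, [u] vanishes outside the union of those in [D]. *)
have -> : (\int[mu]_x u x = \int[mu]_(x in \bigcup_(A in D) A) u x)%E.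
  rewrite [RHS]integral_mkcond; apply: eq_integral => x _.
  rewrite patchE; case: ifPn => //; rewrite notin_setE => xD.
  apply: contrapT => ux; apply: xD.
  have CA : C (ltrans x Hs) by exists x.
  have Ax : ltrans x Hs x by rewrite ltransE /= mulVg; exact: subgroup1.
  exists (ltrans x Hs) => //; split=> //; rewrite -(uA _ _ CA Ax).
  exact/eqP.
rewrite eD [leRHS]esum_mkcond [leLHS]esum_mkcond.
apply: le_esum => A _; case: ifPn; case: ifPn => //; rewrite ?notin_setE ?inE.
  by move=> nCA [].
Qed.

Lemma haar_int_ltrans (f : Gs -> \bar R) a : measurable_fun [set: T] (f : T -> _) ->
  (\int[mu]_x f (a * x)%g = \int[mu]_x f x)%E.
Proof.
move=> mf.
have ma := continuous_measurable_borel (@mulgl_continuous Gs a).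
have ge0 (g : Gs -> \bar R) : measurable_fun [set: T] (g : T -> _) ->
    (forall x, (0 <= g x)%E) -> (\int[mu]_x g (a * x)%g = \int[mu]_x g x)%E.
  move=> mg g0.
  have := ge0_integral_pushforward ma mu measurableT mg (fun x _ => g0 x).
  rewrite preimage_setT => <-; apply: eq_measure_integral => A mA _.
  rewrite /pushforward -(haar_invariant haar a^-1%g mA) ltransE; congr (mu _).
  by apply/seteqP; split=> x /=; rewrite invgK.
rewrite integralE [RHS]integralE; congr (_ - _)%E.
- rewrite -(ge0 (f^\+)%E)//; last exact: measurable_funepos.
  by apply: eq_integral => x _; rewrite !funeposE.
- rewrite -(ge0 (f^\-)%E)//; last exact: measurable_funeneg.
  by apply: eq_integral => x _; rewrite !funenegE.
Qed.

(** The preimage of [A] under [x -> x * a] is [A a^-1], so the pushforward of [mu] is [Delta a^-1]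
    times [mu]. *)
Lemma haar_int_rtrans (f : Gs -> \bar R) a : measurable_fun [set: T] (f : T -> _) ->
  (forall x, (0 <= f x)%E) ->
  (\int[mu]_x f (x * a)%g = (Delta a^-1%g)%:E * \int[mu]_x f x)%E.
Proof.
move=> mf f0.
have ma := continuous_measurable_borel (@mulgr_continuous Gs a).
have := ge0_integral_pushforward ma mu measurableT mf (fun x _ => f0 x).
rewrite preimage_setT => <-.
have D0 : 0 <= Delta a^-1%g by exact/ltW/(Delta_gt0 modD).
have := ge0_integral_mscale mu measurableT (NngNum D0) mf (fun x _ => f0 x).
move=> /= <-; apply: eq_measure_integral => A mA _.
transitivity (mu (rtrans A a^-1%g)); last exact: haar_rtrans.
rewrite rtransE; congr (mu _); by apply/seteqP; split=> x /=; rewrite invgK.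
Qed.

Lemma haar_int_inv (f : Gs -> \bar R) : measurable_fun [set: T] (f : T -> _) ->
  (forall x, (0 <= f x)%E) ->
  (\int[mu]_(x in Hs) f x^-1%g = \int[mu]_(x in Hs) f x)%E.
Proof.
move=> mf f0; have mH : measurable (Hs : set T) by exact: mO.
have mi := continuous_measurable_borel (@invg_continuous Gs).
have := ge0_integral_pushforward mi mu mH (measurable_funTS mf) (fun x _ => f0 x).
rewrite -[X in (\int[mu]_(x in X) _)%E]/(invset Hs) invset_subgroup// => <-.
apply: eq_measure_integral => A mA AH.
rewrite /pushforward -(haar_inv cot haar muH modD mA AH)//.
Qed.

Section MatrixFunctions.
Implicit Types (f g F : Gs -> 'M[R[i]]_n).

Lemma mmeasurable_comp f (phi : Gs -> Gs) : continuous phi ->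
  mmeasurable (f : T -> _) -> mmeasurable ((fun x => f (phi x)) : T -> _).
Proof.
move=> cphi mf k l; have mphi := continuous_measurable_borel cphi.
by have [m1 m2] := mf k l; split; [apply: (measurableT_comp m1 mphi)|apply: (measurableT_comp m2 mphi)].
Qed.

Lemma divl_continuous x : continuous (fun y : Gs => (y^-1 * x)%g).
Proof.
move=> y; apply: (@continuous_comp _ _ _ (fun y : Gs => y^-1%g) (fun y : Gs => (y * x)%g)).
  exact: invg_continuous.
exact: mulgr_continuous.
Qed.

Lemma mmeasurable_open_fibers f : (forall B, open (f @^-1` B)) -> mmeasurable (f : T -> _).
Proof.
move=> fO k l; split; apply: open_fibers_measurable => B.
  by have := fO [set M | B (complex.Re (M k l))].
by have := fO [set M | B (complex.Im (M k l))].
Qed.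

Lemma mint_ltrans f a : mmeasurable (f : T -> _) ->
  mint mu (fun y => f (a * y)%g) = mint mu f.
Proof.
move=> mf; apply/matrixP => k l; rewrite !mxE /cintegral /Rintegral.
have [m1 m2] := mf k l.
congr (Complex (fine _) (fine _)).
  apply: (haar_int_ltrans (f := fun x => (complex.Re (f x k l))%:E)).
  exact/measurable_EFinP.
apply: (haar_int_ltrans (f := fun x => (complex.Im (f x k l))%:E)).
exact/measurable_EFinP.
Qed.

Lemma mnormint_ltrans f a : mmeasurable (f : T -> _) ->
  mnormint mu (fun y => f (a * y)%g) = mnormint mu f.
Proof.
by move=> mf; apply: (haar_int_ltrans (f := fun x => (opnorm (f x))%:E)); exact: measurable_opnormE.
Qed.

(** The substitution [y -> y^-1 * x] is the one in the second factor of a convolution; its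
    compatibility with null sets makes convolution well defined on classes. *)
Lemma ae_equal_inv f g x : ae_equal mu f g ->
  ae_equal mu (fun y => f (y^-1 * x)%g) (fun y => g (y^-1 * x)%g).
Proof.
move=> [N [mN N0 fgN]]; exists (ltrans x (invset N)); split.
- by apply: measurable_ltrans; exact: measurable_invset.
- apply: etrans (haar_invariant haar x (measurable_invset mN)) _.
  exact: haar_inv_null.
- move=> y /= fy; rewrite ltransE /invset /= invgM invgK.
  exact: fgN.
Qed.

Lemma ae_equal_div f g : ae_equal mu f g ->
  ae_equal mu (fun y => f (y^-1)%g) (fun y => g (y^-1)%g).
Proof. by move=> /(ae_equal_inv 1%g); under eq_fun do rewrite mulg1; under [X in ae_equal _ _ X]eq_fun do rewrite mulg1. Qed.

End MatrixFunctions.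

End HaarIntegrals.

(** * Biequivariant functions and the corner of p *)

Section HeckeAlgebra.
Variables (R : realType) (n : nat) (G : groupType) (H : set G).
Variable sigma : G -> 'M[R[i]]_n.
Hypothesis tH : hecke_triple H sigma.
Implicit Types f g : G -> 'M[R[i]]_n.
Let sH := triple_subgroup tH.

(** The equivariance clause of [hecke_alg] without the condition on the support, shared by the Hecke
    algebra and its completion. *)
Definition biequivariant f : Prop :=
  forall h x k, H h -> H k -> f (h * x * k)%g = sigma h *m f x *m sigma k.

Lemma biequivariantl f h x : biequivariant f -> H h -> f (h * x)%g = sigma h *m f x.
Proof.
move=> bf Hh; have := bf h x 1%g Hh (subgroup1 sH).
by rewrite mulg1 (triple_sigma1 tH) mulmx1.
Qed.

Lemma biequivariantr f x k : biequivariant f -> H k -> f (x * k)%g = f x *m sigma k.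
Proof.
move=> bf Hk; have := bf 1%g x k (subgroup1 sH) Hk.
by rewrite mul1g (triple_sigma1 tH) mul1mx.
Qed.

Lemma biequivariantP f : (forall h x, H h -> f (h * x)%g = sigma h *m f x) ->
  (forall x k, H k -> f (x * k)%g = f x *m sigma k) -> biequivariant f.
Proof. by move=> fl fr h x k Hh Hk; rewrite fr// fl. Qed.

Lemma sigma_unitl h (M : 'M[R[i]]_n) : H h -> sigma h *m M = 0 -> M = 0.
Proof.
move=> Hh e; rewrite -[M]mul1mx -(mulVmx (triple_unit tH Hh)) -mulmxA e mulmx0//.
Qed.

Lemma biequivariant_opnorm f x h : biequivariant f -> H h ->
  opnorm (f (x * h)%g) = opnorm (f x).
Proof.
move=> bf Hh; have U1 := triple_unitary tH (subgroup1 sH).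
have := opnorm_unitary_mul (f x) U1 (triple_unitary tH Hh).
by rewrite (biequivariantr _ bf Hh) (triple_sigma1 tH) mul1mx.
Qed.

(** The left cosets inside [H x H] correspond to those of the intersection of [H] and [conjset x H]
    in [H]. *)
Lemma fincov_dcoset x : fincov (dcoset H x H) H.
Proof.
have sHx := subgroup_conjset x sH.
have /(fincov_left_cosets _ (subgroupI sH sHx))[s Hs] := (triple_pair tH).2 x.
exists [seq (c * x)%g | c <- s] => _ [a [b [Ha Hb ->]]].
have [c cs [_]] := Hs a Ha; rewrite conjsetE /= => Hc.
exists (c * x)%g; first exact: map_f.
rewrite (_ : _ * _ = x^-1 * (c^-1 * a) * x * b)%g; last by rewrite invgM !mulgA.
exact: subgroupM.
Qed.

Lemma fincov_bigcup (I : eqType) (s : seq I) (F : I -> set G) :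
  (forall i, i \in s -> fincov (F i) H) -> fincov [set x | exists2 i, i \in s & F i x] H.
Proof.
elim: s => [|i s IH] fF; first by exists [::] => x [].
have [|t Ht] := IH; first by move=> j js; apply: fF; rewrite inE js orbT.
have [u Hu] := fF i (mem_head _ _).
exists (t ++ u) => x [j]; rewrite inE => /predU1P[->|js] Fx.
  by have [c cu Hc] := Hu _ Fx; exists c => //; rewrite mem_cat cu orbT.
by have [|c ct Hc] := Ht x; [exists j|exists c => //; rewrite mem_cat ct].
Qed.

Lemma dcoset_in x : dcoset H x H x.
Proof. by exists 1%g, 1%g; split; rewrite ?mul1g ?mulg1//; exact: subgroup1. Qed.

Lemma dcoset_eq x y : dcoset H x H y -> dcoset H y H = dcoset H x H.
Proof.
move=> [a [b [Ha Hb ->]]]; apply/seteqP; split=> _ [c [d [Hc Hd ->]]].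
  exists (c * a)%g, (b * d)%g; split; rewrite ?mulgA//; exact: subgroupM.
exists (c * a^-1)%g, (b^-1 * d)%g; split; first exact: sH.2.
  by apply: subgroupM => //; exact: subgroupV.
by rewrite !mulgA mulgVK mulgK.
Qed.

(** A double coset is a finite union of left cosets, so finite support may be counted in [G/H],
    which is where the sums and integrals live. *)
Lemma hecke_algP f : hecke_alg H sigma f <->
  biequivariant f /\ fincov [set x | f x != 0] H.
Proof.
split=> [[fin bf]|[bf [s Hs]]]; split=> //.
  set S := [set _ | _ in _] in fin.
  apply: (@fincovS _ [set x | exists2 A, A \in finmap.enum_fset (fset_set S) & A x]).
    move=> x fx; exists (dcoset H x H); last exact: dcoset_in.
    by rewrite in_fset_set// inE; exists x.
  apply: fincov_bigcup => A; rewrite in_fset_set// inE => -[x _ <-].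
  exact: fincov_dcoset.
apply: (@sub_finite_set _ _ [set` [seq dcoset H c H | c <- s]]) => //.
move=> _ [x fx <-] /=; have [c cs Hc] := Hs x fx.
apply/mapP; exists c => //; apply: dcoset_eq.
by exists 1%g, (c^-1 * x)%g; split; rewrite ?mul1g ?mulVKg//; exact: subgroup1.
Qed.

Lemma lcosets_support_finite (X : zmodType) (f : G -> X) :
  fincov [set x | f x != 0] H ->
  finite_set (left_cosets setT H `&` [set A | f (coset_repr A) != 0]).
Proof.
move=> [s Hs]; apply: (@sub_finite_set _ _ [set` [seq ltrans c H | c <- s]]) => //.
move=> A [CA fA] /=; have [eA _] := lcoset_repr sH CA.
have [c cs Hc] := Hs _ fA; apply/mapP; exists c => //.
by rewrite eA; apply/esym/lcoset_eqP.
Qed.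

End HeckeAlgebra.

(** * Convolution with [p] *)

Section CornerAlgebra.
Variables (R : realType) (n : nat) (Gs : topGroupType) (Hs : set Gs).
Variable sigmas : Gs -> 'M[R[i]]_n.
Variables (mu : {measure set (borel Gs) -> \bar R}) (Delta : Gs -> R).
Hypothesis cot : compact_open_triple Hs sigmas.
Hypothesis haar : haar_measure mu.
Hypothesis muH : mu Hs = 1%E.
Hypothesis modD : modular_function mu Delta.
Local Notation T := (borel Gs).
Implicit Types (f g F : Gs -> 'M[R[i]]_n).

Let tS := cot_triple cot.
Let sHs := triple_subgroup tS.
Let oHs := cot_open cot.
Let mO := @open_measurable_borel Gs.
Let Ks := rep_ker Hs sigmas.
Let sKs : subgroup Ks := rep_ker_subgroup tS.
Let oKs : open Ks := cot_ker_open cot.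
Let p := proj_fun Hs sigmas.
Local Notation biequiv := (biequivariant Hs sigmas).

(** This half of biequivariance is what [p * g] has before multiplication by [p] on the right. It
    gives left invariance under the open subgroup [Ks], hence local constancy. *)
Definition lequivariant f : Prop := forall h x, Hs h -> f (h * x)%g = sigmas h *m f x.

Lemma biequiv_l f : biequiv f -> lequivariant f.
Proof. by move=> bf h x Hh; exact: (biequivariantl tS). Qed.

Lemma lequivariant_open_fibers f B : lequivariant f -> open (f @^-1` B).
Proof.
move=> fl; apply: (linv_open _ sKs oKs) => x l [Hl l1].
by rewrite fl// l1 mul1mx.
Qed.

Lemma lequivariant_mmeasurable f : lequivariant f -> mmeasurable (f : T -> _).
Proof. by move=> fl; apply: mmeasurable_open_fibers => B; exact: lequivariant_open_fibers. Qed.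

Lemma lequivariant_continuous f : lequivariant f -> continuous f.
Proof. by move=> fl; apply: open_fibers_continuous => B; exact: lequivariant_open_fibers. Qed.

Lemma p_in x : Hs x -> p x = sigmas x.
Proof. by move=> Hx; rewrite /p /proj_fun ifT// inE. Qed.

Lemma p_out x : ~ Hs x -> p x = 0.
Proof. by move=> Hx; rewrite /p /proj_fun ifF//; apply: negbTE; rewrite notin_setE. Qed.

Lemma biequiv_p : biequiv p.
Proof.
apply: biequivariantP => //.
  move=> h x Hh; have [Hx|Hx] := pselect (Hs x).
    by rewrite !p_in//; [exact: (triple_morph tS)|exact: subgroupM].
  by rewrite !p_out ?mulmx0// subgroupMl.
move=> x k Hk; have [Hx|Hx] := pselect (Hs x).
  by rewrite !p_in//; [exact: (triple_morph tS)|exact: subgroupM].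
by rewrite !p_out ?mul0mx// subgroupMr.
Qed.

Lemma convolE f g x : convol mu f g x = mint mu (fun y => f y *m g (y^-1 * x)%g).
Proof. by []. Qed.

(** Integrability is asked at every point [x], since convolutions are handled as functions and the
    algebraic rules for [mint] require it. *)
Definition convolvable f g : Prop :=
  forall x, mintegrable mu (fun y => f y *m g (y^-1 * x)%g).

Lemma convol_l f g : convolvable f g -> lequivariant f -> lequivariant (convol mu f g).
Proof.
move=> cfg fl h x Hh; rewrite !convolE -mint_mull; last exact: cfg.
rewrite -(mint_ltrans haar h); last exact: (cfg _).1.
congr mint; apply/funext => y; rewrite fl// invgM.
by rewrite mulmxA mulgA mulgVK.
Qed.

Lemma convol_r f g : convolvable f g ->
  (forall x k, Hs k -> g (x * k)%g = g x *m sigmas k) ->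
  forall x k, Hs k -> convol mu f g (x * k)%g = convol mu f g x *m sigmas k.
Proof.
move=> cfg gr x k Hk; rewrite !convolE -mint_mulr; last exact: cfg.
by congr mint; apply/funext => y; rewrite mulgA gr// mulmxA.
Qed.

Lemma convol_biequiv f g : convolvable f g -> lequivariant f ->
  (forall x k, Hs k -> g (x * k)%g = g x *m sigmas k) -> biequiv (convol mu f g).
Proof.
by move=> cfg fl gr; apply: biequivariantP => //; [exact: convol_l|exact: convol_r].
Qed.

Lemma le_opnorm_convol f g x (u : Gs -> \bar R) :
  mmeasurable (f : T -> _) -> mmeasurable (g : T -> _) ->
  measurable_fun [set: T] (u : T -> _) -> (\int[mu]_y u y < +oo)%E ->
  (forall y, ((opnorm (f y *m g (y^-1 * x)%g))%:E <= u y)%E) ->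
  mintegrable mu (fun y => f y *m g (y^-1 * x)%g).
Proof.
move=> mf mg m_u ufin fgu.
have mP : mmeasurable ((fun y => f y *m g (y^-1 * x)%g) : T -> _).
  apply: mmeasurableM => //; apply: (mmeasurable_comp (phi := fun y => (y^-1 * x)%g)) => //.
  exact: divl_continuous.
split=> //; apply: le_lt_trans ufin; apply: ge0_le_integral => //.
- by move=> y _; rewrite lee_fin opnorm_ge0.
- exact: measurable_opnormE.
Qed.

Lemma opnorm_sigma_mul h (A : 'M[R[i]]_n) : Hs h -> opnorm (sigmas h *m A) <= opnorm A.
Proof.
move=> Hh; apply: le_trans (opnormM _ _) _; rewrite -[leRHS]mul1r.
by apply: ler_wpM2r; [exact: opnorm_ge0|apply: opnorm_unitary; exact: (triple_unitary tS)].
Qed.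

Lemma opnorm_mul_sigma h (A : 'M[R[i]]_n) : Hs h -> opnorm (A *m sigmas h) <= opnorm A.
Proof.
move=> Hh; apply: le_trans (opnormM _ _) _; rewrite -[leRHS]mulr1.
by apply: ler_wpM2l; [exact: opnorm_ge0|apply: opnorm_unitary; exact: (triple_unitary tS)].
Qed.

(** The integrand lives on [Hs] and is dominated there by [opnorm (g (y^-1 * x))]; inversion on [Hs]
    and right translation bound the integral by [Delta x^-1] times the norm of [g]. *)
Lemma convolvable_pl g : mintegrable mu g -> convolvable p g.
Proof.
move=> ig x.
pose N y := (opnorm (g y))%:E.
have N0 y : (0 <= N y)%E by rewrite lee_fin opnorm_ge0.
have mN : measurable_fun [set: T] (N : T -> _) by apply: measurable_opnormE; exact: ig.1.
have mNx : measurable_fun [set: T] ((fun y => N (y * x)%g) : T -> _).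
  exact: (measurableT_comp mN (continuous_measurable_borel (@mulgr_continuous Gs x))).
have mNi : measurable_fun [set: T] ((fun y => N (y^-1 * x)%g) : T -> _).
  exact: (measurableT_comp mN (continuous_measurable_borel (@divl_continuous Gs x))).
have mH : measurable (Hs : set T) by exact: mO.
apply: (@le_opnorm_convol _ _ _ ((fun y => N (y^-1 * x)%g) \_ Hs)).
- exact: (lequivariant_mmeasurable (biequiv_l biequiv_p)).
- exact: ig.1.
- by apply/(measurable_restrictT _ mH); exact: measurable_funTS.
- rewrite -integral_mkcond.
  have := haar_int_inv cot haar muH modD mNx (fun y => N0 _) => ->.
  apply: (@le_lt_trans _ _ (\int[mu]_y N (y * x)%g)%E).
    apply: (ge0_subset_integral mu mH measurableT mNx) => [y _|]; [exact: N0|exact: subsetT].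
  rewrite (haar_int_rtrans modD x mN N0); apply: lte_mul_pinfty => //; last exact: ig.2.
  by rewrite lee_fin; exact/ltW/(Delta_gt0 modD).
- move=> y; rewrite patchE; case: ifPn => [|].
    rewrite inE => Hy; rewrite (p_in Hy) lee_fin; exact: opnorm_sigma_mul.
  by rewrite notin_setE => Hy; rewrite p_out// mul0mx opnorm0.
Qed.

(** The integrand lives on the compact set [x Hs], where [f] takes only finitely many values because
    it is left invariant under the open subgroup [Ks]. *)
Lemma convolvable_pr f : lequivariant f -> convolvable f p.
Proof.
(* When [y^-1 * x], which runs through [Hs], lies in [c L], one has [y = k * (x * c^-1)] with [k] in
   [Ks], hence [f y = f (x * c^-1)]. *)
move=> fl x; pose L := conjset x^-1%g Ks.
have sL : subgroup L by exact: subgroup_conjset.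
have oL : open L by exact: open_conjset.
have [s HsL] := compact_fincov (cot_compact cot) sL oL.
pose M := \sum_(c <- s) opnorm (f (x * c^-1)%g).
have M0 : 0 <= M by apply: sumr_ge0 => c _; exact: opnorm_ge0.
have fM y : Hs (y^-1 * x)%g -> opnorm (f y) <= M.
  move=> Hy; have [c cs] := HsL _ Hy.
  rewrite /L conjsetE /= invgK => Kc.
  have -> : f y = f (x * c^-1)%g.
    have -> : y = ((x * (c^-1 * (y^-1 * x)) * x^-1)^-1 * (x * c^-1))%g.
      by rewrite !invgM !invgK !mulgA mulgV mul1g mulgVK mulgK.
    have [HK K1] := subgroupV sKs Kc.
    by rewrite fl// K1 mul1mx.
  rewrite /M; elim: s cs {HsL M M0} => // d s IH; rewrite inE big_cons => /predU1P[->|cs].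
    by rewrite lerDl sumr_ge0// => e _; exact: opnorm_ge0.
  by apply: le_trans (IH cs) _; rewrite lerDr opnorm_ge0.
pose E := ltrans x Hs.
have mE : measurable (E : set T) by apply: mO; exact: open_ltrans.
apply: (@le_opnorm_convol _ _ _ ((cst M%:E) \_ E)).
- exact: lequivariant_mmeasurable.
- exact: (lequivariant_mmeasurable (biequiv_l biequiv_p)).
- by apply/(measurable_restrictT _ mE); exact: measurable_cst.
- rewrite -integral_mkcond; rewrite (integral_cst mu mE).
  by rewrite (haar_coset cot haar muH) ?mule1 ?ltry//; exists x.
- move=> y; rewrite patchE /E ltransE; case: ifPn => [|].
    rewrite inE /= -(subgroup_invE _ sHs) invgM invgK => Hy; rewrite p_in// lee_fin.
    by apply: le_trans (fM _ Hy); exact: opnorm_mul_sigma.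
  rewrite notin_setE /= -(subgroup_invE _ sHs) invgM invgK => Hy.
  by rewrite p_out// mulmx0 opnorm0.
Qed.

Lemma pcorner_biequiv g : mintegrable mu g -> biequiv (convol mu (convol mu p g) p).
Proof.
move=> ig; have lpg : lequivariant (convol mu p g).
  by apply: convol_l; [exact: convolvable_pl|exact: (biequiv_l biequiv_p)].
apply: convol_biequiv; [exact: convolvable_pr|exact: lpg|].
by move=> x k Hk; exact: (biequivariantr tS _ biequiv_p Hk).
Qed.

(** On [Hs] the integrand [sigmas y *m F (y^-1 * x)] is the constant [F x], elsewhere it is zero.
    Applied to [p] itself this gives idempotence. *)
Lemma convol_pl F : lequivariant F -> convol mu p F = F.
Proof.
move=> Fl; apply/funext => x; rewrite convolE.
rewrite (@mint_indic _ _ _ mu Hs (F x)).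
- by rewrite muH scale1r.
- exact: mO.
- by move=> y Hy; rewrite p_in// -Fl// mulVKg.
- by move=> y Hy; rewrite p_out// mul0mx.
Qed.

Lemma convol_pr F : (forall x k, Hs k -> F (x * k)%g = F x *m sigmas k) ->
  convol mu F p = F.
Proof.
move=> Fr; apply/funext => x; rewrite convolE.
have E y : ltrans x Hs y = Hs (y^-1 * x)%g.
  by rewrite ltransE /= -(subgroup_invE _ sHs) invgM invgK.
rewrite (@mint_indic _ _ _ mu (ltrans x Hs) (F x)).
- by rewrite (haar_coset cot haar muH) ?scale1r//; exists x.
- by apply: mO; exact: open_ltrans.
- by move=> y; rewrite E => Hy; rewrite p_in// -Fr// mulVKg.
- by move=> y; rewrite E => Hy; rewrite p_out// mulmx0.
Qed.

Lemma pcornerK F : biequiv F -> convol mu (convol mu p F) p = F.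
Proof.
move=> bF; rewrite convol_pl; last exact: biequiv_l.
by apply: convol_pr => x k Hk; exact: (biequivariantr tS _ bF Hk).
Qed.

End CornerAlgebra.

Section IntegralLinear.
Variables (Gs : topGroupType) (R : realType) (n : nat).
Local Notation T := (borel Gs).
Variable mu : {measure set T -> \bar R}.
Implicit Types (F Phi : Gs -> 'M[R[i]]_n).

Lemma mintegrableD F Phi : mintegrable mu F -> mintegrable mu Phi ->
  mintegrable mu (fun x => F x + Phi x) /\
  (mnormint mu (fun x => F x + Phi x)%R <= mnormint mu F + mnormint mu Phi)%E.
Proof.
move=> [mF fF] [mP fP].
have mFP := mmeasurableD mF mP.
have le : (mnormint mu (fun x => F x + Phi x)%R <= mnormint mu F + mnormint mu Phi)%E.
  have nn (g : Gs -> 'M[R[i]]_n) x : [set: T] x -> (0 <= (opnorm (g x))%:E)%E.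
    by move=> _; rewrite lee_fin opnorm_ge0.
  have mOF := measurable_opnormE mF; have mOP := measurable_opnormE mP.
  rewrite /mnormint -(ge0_integralD mu measurableT (nn F) mOF (nn Phi) mOP).
  apply: (ge0_le_integral mu measurableT (nn _) (measurable_opnormE mFP)).
    exact: (emeasurable_funD mOF mOP).
  by move=> x _; rewrite /= lee_fin; exact: opnormD.
split; last exact: le.
by split; [exact: mFP|exact: le_lt_trans le (lte_add_pinfty fF fP)].
Qed.

Lemma mintegrableZ (a : R[i]) F : mintegrable mu F ->
  mintegrable mu (fun x => a *: F x) /\
  (mnormint mu (fun x => a *: F x)%R <= (complex.Re `|a|)%:E * mnormint mu F)%E.
Proof.
move=> [mF fF]; have maF := mmeasurableZ a mF.
have a0 : (0 <= (complex.Re `|a|)%:E)%E by rewrite lee_fin normc_def sqrtr_ge0.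
have nn (g : Gs -> 'M[R[i]]_n) x : [set: T] x -> (0 <= (opnorm (g x))%:E)%E.
  by move=> _; rewrite lee_fin opnorm_ge0.
have mOF := measurable_opnormE mF.
have le : (mnormint mu (fun x => a *: F x)%R <= (complex.Re `|a|)%:E * mnormint mu F)%E.
  rewrite /mnormint -(ge0_integralZl mu measurableT mOF (nn F) a0).
  apply: (ge0_le_integral mu measurableT (nn _) (measurable_opnormE maF)).
    exact: (measurable_funeM _ mOF).
  by move=> x _; rewrite /= lee_fin; exact: opnormZ_le.
split; last exact: le.
split; first exact: maF.
by apply: le_lt_trans le _; apply: lte_mul_pinfty => //; exact: fF.
Qed.

Lemma mintD F Phi : mintegrable mu F -> mintegrable mu Phi ->
  mint mu (fun x => F x + Phi x) = mint mu F + mint mu Phi.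
Proof.
move=> iF iP; apply/matrixP => k l; rewrite !mxE /cintegral.
have [iF1 iF2] := mintegrable_entry k l iF; have [iP1 iP2] := mintegrable_entry k l iP.
have -> : (fun x => complex.Re ((F x + Phi x) k l)) =
    (fun x => complex.Re (F x k l) + complex.Re (Phi x k l)).
  by apply/funext => x; rewrite mxE cReD.
have -> : (fun x => complex.Im ((F x + Phi x) k l)) =
    (fun x => complex.Im (F x k l) + complex.Im (Phi x k l)).
  by apply/funext => x; rewrite mxE cImD.
by rewrite !RintegralD.
Qed.

Lemma mintZ (a : R[i]) F : mintegrable mu F ->
  mint mu (fun x => a *: F x) = a *: mint mu F.
Proof.
by apply: (@mint_linear _ _ _ mu ( *:%R a)) => [A B|r A]; rewrite ?scalerDr// !scalerA mulrC.
Qed.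

Lemma mint0 : mint mu (fun _ => 0 : 'M[R[i]]_n) = 0.
Proof. by rewrite (@mint_indic _ _ _ mu setT 0) ?scaler0. Qed.

Lemma convol_linl (a : R[i]) f f' g : convolvable mu f g -> convolvable mu f' g ->
  convol mu (a *: f + f') g = a *: convol mu f g + convol mu f' g :> (Gs -> 'M[R[i]]_n).
Proof.
move=> c c'; apply/funext => x; rewrite convolE.
have -> : (fun y => (a *: f + f') y *m g (y^-1 * x)%g) =
   (fun y => a *: (f y *m g (y^-1 * x)%g) + f' y *m g (y^-1 * x)%g).
  by apply/funext => y; rewrite mulmxDl scalemxAl.
by rewrite mintD; [rewrite mintZ//; exact: c|apply: (mintegrableZ a _).1; exact: c|exact: c'].
Qed.

Lemma convol_linr (a : R[i]) f g g' : convolvable mu f g -> convolvable mu f g' ->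
  convol mu f (a *: g + g') = a *: convol mu f g + convol mu f g' :> (Gs -> 'M[R[i]]_n).
Proof.
move=> c c'; apply/funext => x; rewrite convolE.
have -> : (fun y => f y *m (a *: g + g') (y^-1 * x)%g) =
   (fun y => a *: (f y *m g (y^-1 * x)%g) + f y *m g' (y^-1 * x)%g).
  by apply/funext => y; rewrite mulmxDr scalemxAr.
by rewrite mintD; [rewrite mintZ//; exact: c|apply: (mintegrableZ a _).1; exact: c|exact: c'].
Qed.

End IntegralLinear.

Section Adjoint.
Variables (R : realType) (n : nat).
Implicit Types A B : 'M[R[i]]_n.

Lemma adjmxM A B : (A *m B)^t* = B ^t* *m A ^t*.
Proof. by rewrite trmx_mul map_mxM. Qed.

Lemma adjmxZ (a : R[i]) A : (a *: A)^t* = a^*%C *: A ^t*.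
Proof. by apply/matrixP => i j; rewrite !mxE rmorphM. Qed.

Lemma adjmxD A B : (A + B)^t* = A ^t* + B ^t*.
Proof. by apply/matrixP => i j; rewrite !mxE rmorphD. Qed.

End Adjoint.

(** * Integrable biequivariant functions *)

Section Ell1.
Variables (R : realType) (n : nat) (Gs : topGroupType) (Hs : set Gs).
Variable sigmas : Gs -> 'M[R[i]]_n.
Variables (mu : {measure set (borel Gs) -> \bar R}) (Delta : Gs -> R).
Hypothesis cot : compact_open_triple Hs sigmas.
Hypothesis haar : haar_measure mu.
Hypothesis muH : mu Hs = 1%E.
Hypothesis modD : modular_function mu Delta.
Local Notation T := (borel Gs).
Implicit Types (f g F : Gs -> 'M[R[i]]_n).

Let tS := cot_triple cot.
Let sHs := triple_subgroup tS.
Let oHs := cot_open cot.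
Let mO := @open_measurable_borel Gs.
Let C := left_cosets [set: Gs] Hs.
Local Notation biequiv := (biequivariant Hs sigmas).
Local Notation N := (mnormint mu).

(** Genuine functions that represent the classes of [p L^1 p], exactly one in each. *)
Definition ell1 F : Prop := biequiv F /\ (N F < +oo)%E.

Lemma biequiv_mmeasurable F : biequiv F -> mmeasurable (F : T -> _).
Proof. by move=> bF; apply: (lequivariant_mmeasurable cot); exact: (biequiv_l cot). Qed.

Lemma ell1_mintegrable F : ell1 F -> mintegrable mu F.
Proof. by move=> [bF fF]; split=> //; exact: biequiv_mmeasurable. Qed.

Lemma biequiv_lin (a : R[i]) f g : biequiv f -> biequiv g -> biequiv (a *: f + g).
Proof.
move=> bf bg h x k Hh Hk.
have -> : (a *: f + g) (h * x * k)%g = a *: f (h * x * k)%g + g (h * x * k)%g by [].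
by rewrite bf// bg// mulmxDr mulmxDl -scalemxAr -scalemxAl.
Qed.

Lemma biequiv_normint F : biequiv F ->
  N F = (\esum_(A in C) (opnorm (F (coset_repr A)))%:E)%E.
Proof.
move=> bF; apply: (integral_lcosets cot haar muH (u := fun x => (opnorm (F x))%:E)).
  by move=> x; rewrite lee_fin opnorm_ge0.
by move=> x h Hh; rewrite (biequivariant_opnorm tS).
Qed.

Lemma opnorm_coset_repr F x : biequiv F ->
  opnorm (F (coset_repr (ltrans x Hs))) = opnorm (F x).
Proof.
move=> bF; have Hx := lcoset_repr_prop x sHs.
by rewrite -(mulVKg x (coset_repr _)) (biequivariant_opnorm tS).
Qed.

(** The coset of [x] has measure 1, so the L^1 norm dominates the supremum norm. Uniqueness of
    representatives, convergence of convolutions and pointwise limits all rest on this. *)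
Lemma opnorm_le_normint F x : biequiv F -> ((opnorm (F x))%:E <= N F)%E.
Proof.
move=> bF; rewrite biequiv_normint//; apply: esum_ge.
exists [set ltrans x Hs]; first by split=> // _ ->; exists x.
by rewrite fsbig_set1 opnorm_coset_repr.
Qed.

Lemma normint_eq0 F : biequiv F -> N F = 0%E -> F = 0.
Proof.
move=> bF NF; apply/funext => x; apply: opnorm_eq0.
have := opnorm_le_normint x bF; rewrite NF lee_fin => Fx0.
by apply: le_anti; rewrite Fx0 opnorm_ge0.
Qed.

Lemma normint0 : N (0 : Gs -> 'M[R[i]]_n) = 0%E.
Proof.
rewrite /mnormint; under eq_integral do rewrite /= opnorm0.
exact: integral0.
Qed.

Lemma biequiv_ae_eq F g : biequiv F -> biequiv g -> ae_equal mu F g -> F = g.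
Proof.
move=> bF bg ae; have bd : biequiv ((-1) *: g + F) by exact: biequiv_lin.
have mdf := biequiv_mmeasurable bd.
suff d0 : (-1) *: g + F = 0.
  by move: d0; rewrite scaleN1r addrC => /eqP; rewrite subr_eq0 => /eqP.
apply: normint_eq0 => //; rewrite -normint0; apply: mnormint_ae => //.
move: ae; apply: filterS => x /= e.
by rewrite -[LHS]/((-1) *: g x + F x) e scaleN1r addNr.
Qed.

Lemma normint_fin F : ell1 F -> N F \is a fin_num.
Proof. by move=> [_ fF]; rewrite ge0_fin_numE ?mnormint_ge0. Qed.

Lemma ell1_lin (a : R[i]) f g : ell1 f -> ell1 g -> ell1 (a *: f + g).
Proof.
move=> ef eg; split; first exact: (biequiv_lin _ ef.1 eg.1).
have iaf := (mintegrableZ a (ell1_mintegrable ef)).1.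
exact: (mintegrableD iaf (ell1_mintegrable eg)).1.2.
Qed.

Lemma normint_lin (a : R[i]) f g : ell1 f -> ell1 g ->
  (N (a *: f + g)%R <= (complex.Re `|a|)%:E * N f + N g)%E.
Proof.
move=> ef eg; have [iaf laf] := mintegrableZ a (ell1_mintegrable ef).
have [_ le] := mintegrableD iaf (ell1_mintegrable eg).
by apply: le_trans le _; rewrite leeD2r.
Qed.

(** Since [g] is bounded by its L^1 norm, the integral converges at every point, not merely almost
    everywhere. *)
Lemma ell1_convolvable F g : ell1 F -> ell1 g -> convolvable mu F g.
Proof.
move=> eF eg x.
have gfin := normint_fin eg.
have mOF := measurable_opnormE (biequiv_mmeasurable eF.1).
apply: (le_opnorm_convol (u := fun y => (N g * (opnorm (F y))%:E)%E)).
- exact: biequiv_mmeasurable eF.1.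
- exact: biequiv_mmeasurable eg.1.
- exact: measurable_funeM.
- rewrite (ge0_integralZl mu measurableT mOF) ?mnormint_ge0//.
    by apply: lte_mul_pinfty; [exact: mnormint_ge0|exact: gfin|exact: eF.2].
  by move=> y _; rewrite lee_fin opnorm_ge0.
- move=> y; rewrite -(fineK gfin) -EFinM lee_fin mulrC.
  apply: le_trans (opnormM _ _) _; apply: ler_wpM2l; first exact: opnorm_ge0.
  by rewrite -lee_fin fineK//; apply: opnorm_le_normint; exact: eg.1.
Qed.

Lemma ell1_convol_biequiv F g : ell1 F -> ell1 g -> biequiv (convol mu F g).
Proof.
move=> eF eg; apply: (convol_biequiv haar).
- exact: ell1_convolvable.
- exact: (biequiv_l cot eF.1).
- by move=> x k Hk; exact: (biequivariantr tS _ eg.1 Hk).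
Qed.

(** The usual computation with the integrals over [Gs] turned into sums over [Gs/Hs], whose order
    can be exchanged without sigma-finiteness. *)
Lemma normint_convol F g : ell1 F -> ell1 g -> (N (convol mu F g) <= N F * N g)%E.
Proof.
move=> eF eg; have bF := eF.1; have bg := eg.1.
have nn (h : Gs -> 'M[R[i]]_n) x : (0 <= (opnorm (h x))%:E)%E by rewrite lee_fin opnorm_ge0.
rewrite biequiv_normint; last exact: ell1_convol_biequiv.
pose a A B := ((opnorm (F (coset_repr B)))%:E * (opnorm (g ((coset_repr B)^-1 * coset_repr A)%g))%:E)%E.
have a0 A B : (0 <= a A B)%E by apply: mule_ge0; [exact: (nn F)|exact: (nn g)].
have step1 A : C A -> ((opnorm (convol mu F g (coset_repr A)))%:E <= \esum_(B in C) a A B)%E.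
  move=> CA; apply: le_trans (mint_le (ell1_convolvable eF eg _)) _.
  set x := coset_repr A.
  rewrite -(integral_lcosets cot haar muH (u := fun y => ((opnorm (F y))%:E * (opnorm (g (y^-1 * x)%g))%:E)%E)).
  - have mL := measurable_opnormE (ell1_convolvable eF eg x).1.
    have mF' := measurable_opnormE (biequiv_mmeasurable bF).
    have mg' := measurable_opnormE (mmeasurable_comp (@divl_continuous Gs x) (biequiv_mmeasurable bg)).
    apply: (ge0_le_integral mu measurableT (fun y _ => nn (fun y => F y *m g (y^-1 * x)%g) y)
      mL (emeasurable_funM mF' mg')) => y _.
    by rewrite /= lee_fin; exact: opnormM.
  - by move=> y; apply: mule_ge0; [exact: (nn F)|exact: (nn g)].
  (* Moving [y] inside its coset multiplies both factors by unitaries, so the product of norms is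
     constant on cosets. *)
  - move=> y h Hh; rewrite (biequivariant_opnorm tS _ bF Hh).
    have -> // : opnorm (g ((y * h)^-1 * x)%g) = opnorm (g (y^-1 * x)%g).
    rewrite invgM -mulgA (biequivariantl tS _ bg); last exact: subgroupV.
    have U1 := triple_unitary tS (subgroup1 sHs).
    have := opnorm_unitary_mul (g (y^-1 * x)%g) (triple_unitary tS (subgroupV sHs Hh)) U1.
    by rewrite (triple_sigma1 tS) mulmx1.
apply: (@le_trans _ _ (\esum_(A in C) \esum_(B in C) a A B)%E).
  by apply: le_esum => A CA; exact: step1.
have swap : (\esum_(A in C) \esum_(B in C) a A B = \esum_(B in C) \esum_(A in C) a A B)%E.
  apply: etrans (@esum_esum R _ _ C (fun=> C) a (fun A B _ _ => a0 A B)) _.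
  apply: etrans (esym (@esum_esum R _ _ C (fun=> C) (fun B A => a A B) (fun B A _ _ => a0 A B))).
  have bij : set_bij (C `*`` (fun=> C)) (C `*`` (fun=> C)) (fun k : set Gs * set Gs => (k.2, k.1)).
    split=> [[A B] [CA CB]|[A B] [A' B'] _ _ [-> ->]|[A B] [CA CB]] //.
    by exists (B, A).
  exact: (@reindex_esum R _ _ _ _ (fun k : set Gs * set Gs => (k.2, k.1)) (fun k => a k.1 k.2) bij).
rewrite swap.
(* The inner sum is converted back into an integral, where left invariance removes the translation
   by the representative of [B]. *)
have inner B : (\esum_(A in C) a A B = (opnorm (F (coset_repr B)))%:E * N g)%E.
  set y := coset_repr B; rewrite /a -/y.
  rewrite -(mnormint_ltrans haar y^-1%g (biequiv_mmeasurable bg)).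
  have mgy := measurable_opnormE (mmeasurable_comp (@mulgl_continuous Gs y^-1%g) (biequiv_mmeasurable bg)).
  have gy0 x : [set: T] x -> (0 <= (opnorm (g (y^-1 * x)%g))%:E)%E by move=> _; exact: (nn g).
  rewrite /mnormint -(ge0_integralZl mu measurableT mgy gy0 (nn F y)).
  rewrite (integral_lcosets cot haar muH (u := fun x => ((opnorm (F y))%:E * (opnorm (g (y^-1 * x)%g))%:E)%E)).
  - by [].
  - by move=> x; apply: mule_ge0; [exact: (nn F)|exact: (nn g)].
  - by move=> x h Hh; rewrite mulgA (biequivariant_opnorm tS _ bg Hh).
rewrite (eq_esum (fun B _ => inner B)).
rewrite -(integral_lcosets cot haar muH (u := fun y => ((opnorm (F y))%:E * N g)%E)).
- under eq_integral do rewrite muleC.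
  rewrite (ge0_integralZl mu measurableT (measurable_opnormE (biequiv_mmeasurable bF))
    (fun x _ => nn F x) (mnormint_ge0 mu g)).
  rewrite [leRHS]muleC; exact: lexx.
- by move=> y; apply: mule_ge0; [exact: (nn F)|exact: mnormint_ge0].
- by move=> y h Hh; rewrite (biequivariant_opnorm tS _ bF Hh).
Qed.

Lemma ell1_convol F g : ell1 F -> ell1 g -> ell1 (convol mu F g).
Proof.
move=> eF eg; split; first exact: ell1_convol_biequiv.
apply: le_lt_trans (normint_convol eF eg) _.
exact: (lte_mul_pinfty (mnormint_ge0 mu F) (normint_fin eF) eg.2).
Qed.

Lemma biequiv_star F : biequiv F -> biequiv (grp_inv Delta F).
Proof.
move=> bF h x k Hh Hk; rewrite /grp_inv !invgM.
have HV := subgroupV sHs Hh; have KV := subgroupV sHs Hk.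
rewrite mulgA bF// !(DeltaM cot muH modD) (DeltaH cot muH modD HV) (DeltaH cot muH modD KV).
rewrite mul1r mulr1 !(triple_sigmaV tS)// !adjmxM !trmxCK.
by rewrite -scalemxAr -scalemxAl mulmxA.
Qed.

Lemma starK F : grp_inv Delta (grp_inv Delta F) = F.
Proof.
apply/funext => x; rewrite /grp_inv invgK adjmxZ trmxCK scalerA (DeltaV cot muH modD).
rewrite conjc_real.
by rewrite -rmorphM /= mulVf ?scale1r// gt_eqF// (Delta_gt0 modD).
Qed.

Lemma opnorm_star F x : opnorm (grp_inv Delta F x) = Delta x^-1%g * opnorm (F x^-1%g).
Proof. by rewrite /grp_inv opnormZ ?opnorm_adj//; exact/ltW/(Delta_gt0 modD). Qed.

(** Inversion carries the coset [a Hs] to [Hs a^-1], of measure [(Delta a)^-1], on which the norm of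
    the star is constantly [Delta a * opnorm (F a)]; the two factors cancel. Only the countably many
    cosets where [F] is nonzero are needed. *)
Lemma normint_star_le F : ell1 F -> (N (grp_inv Delta F) <= N F)%E.
Proof.
move=> eF; have bF := eF.1.
have fin := eF.2; rewrite biequiv_normint// in fin.
have nn A : C A -> (0 <= (opnorm (F (coset_repr A)))%:E)%E by rewrite lee_fin opnorm_ge0.
have cD := esum_countable nn fin; set D := [set _ | _] in cD.
pose v x := (opnorm (grp_inv Delta F x))%:E.
have v0 x : (0 <= v x)%E by rewrite lee_fin opnorm_ge0.
have mv : measurable_fun [set: T] (v : T -> _).
  by apply: measurable_opnormE; apply: biequiv_mmeasurable; exact: biequiv_star.
have mA A : D A -> measurable (invset A : set T).
  by move=> [CA _]; apply: (@measurable_invset Gs); apply: mO; exact: (coset_open cot CA).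
have tA : trivIset D (@invset Gs).
  apply/trivIsetP => A B [CA _] [CB _] AB.
  have /trivIsetP/(_ _ _ CA CB AB) := lcoset_triv sHs.
  by rewrite -!subset0 => E x [Ax Bx]; exact: (E x^-1%g).
have [mU eU] := integral_countable_bigcup mu cD tA mA mv v0.
have -> : N (grp_inv Delta F) = (\int[mu]_(x in \bigcup_(A in D) invset A) v x)%E.
  rewrite [RHS]integral_mkcond; apply: eq_integral => x _.
  rewrite patchE; case: ifPn => //; rewrite notin_setE => xD.
  rewrite /v opnorm_star; suff -> : opnorm (F x^-1%g) = 0 by rewrite mulr0.
  apply: contrapT => Fx; apply: xD; exists (ltrans x^-1%g Hs).
    split; first by exists x^-1%g.
    by rewrite opnorm_coset_repr//; apply/eqP => -[].
  by rewrite /invset ltransE /= mulVg; exact: subgroup1.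
rewrite eU biequiv_normint// [leRHS]esum_mkcond [leLHS]esum_mkcond.
apply: le_esum => A _; case: ifPn; case: ifPn; rewrite ?notin_setE ?inE//; last first.
- by move=> _ _; exact: opnorm_ge0.
- by move=> nCA [].
move=> CA DA; have [eA _] := lcoset_repr sHs CA; set a := coset_repr A.
have iE : invset A = rtrans Hs a^-1%g by rewrite eA invset_ltrans invset_subgroup.
have -> : (\int[mu]_(x in invset A) v x = \int[mu]_(x in invset A) cst (Delta a * opnorm (F a))%:E x)%E.
  apply: eq_integral => x; rewrite inE iE rtransE /= invgK => Hx.
  rewrite /v opnorm_star.
  have -> : x^-1%g = (a * (x * a)^-1)%g by rewrite invgM mulVKg.
  have HV := subgroupV sHs Hx.
  by rewrite (DeltaM cot muH modD) (DeltaH cot muH modD HV) mulr1 (biequivariant_opnorm tS).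
rewrite (integral_cst mu (mA A DA)) iE (DeltaE cot muH modD) (DeltaV cot muH modD) -EFinM lee_fin.
by rewrite mulrAC divff ?mul1r// gt_eqF// (Delta_gt0 modD).
Qed.

Lemma ell1_star F : ell1 F -> ell1 (grp_inv Delta F).
Proof.
move=> eF; split; first by apply: biequiv_star; exact: eF.1.
exact: le_lt_trans (normint_star_le eF) eF.2.
Qed.

Lemma normint_star F : ell1 F -> N (grp_inv Delta F) = N F.
Proof.
move=> eF; apply: le_anti; apply/andP; split; first exact: normint_star_le.
by have := normint_star_le (ell1_star eF); rewrite starK.
Qed.

End Ell1.

Section FiniteSums.

Lemma esum_finite_support (R : realType) (I : choiceType) (D : set I) (a : I -> R) :
  (forall i, 0 <= a i) -> finite_set (D `&` [set i | a i != 0]) ->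
  (\esum_(i in D) (a i)%:E = (\sum_(i \in D) a i)%:E)%E.
Proof.
move=> a0 fin; set S := D `&` _ in fin.
transitivity (\esum_(i in S) (a i)%:E)%E.
  rewrite esum_mkcond [RHS]esum_mkcond; apply: eq_esum => i _.
  case: ifPn; case: ifPn; rewrite ?notin_setE ?inE//.
    move=> nS Di; congr EFin; apply: contrapT => ai; apply: nS; split=> //.
    by apply/eqP.
  by move=> [Di _] nD.
rewrite esum_fset//; last by move=> i _; rewrite lee_fin.
rewrite fsumEFin//; congr EFin; apply: fsbig_widen; first by move=> i [].
move=> i [Di nS] /=; apply: contrapT => ai; apply: nS; split=> //.
by apply/eqP.
Qed.

End FiniteSums.

(** * The Hecke algebra of [(Gs, Hs)] among functions on [Gs] *)

Section Corner.
Variables (R : realType) (n : nat) (Gs : topGroupType) (Hs : set Gs).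
Variable sigmas : Gs -> 'M[R[i]]_n.
Variables (mu : {measure set (borel Gs) -> \bar R}) (Delta : Gs -> R).
Hypothesis cot : compact_open_triple Hs sigmas.
Hypothesis haar : haar_measure mu.
Hypothesis muH : mu Hs = 1%E.
Hypothesis modD : modular_function mu Delta.
Local Notation T := (borel Gs).
Implicit Types (f g F : Gs -> 'M[R[i]]_n).

Let tS := cot_triple cot.
Let sHs := triple_subgroup tS.
Let oHs := cot_open cot.
Let mO := @open_measurable_borel Gs.
Let C := left_cosets [set: Gs] Hs.
Let p := proj_fun Hs sigmas.
Local Notation biequiv := (biequivariant Hs sigmas).
Local Notation N := (mnormint mu).
Local Notation hecke := (hecke_alg Hs sigmas).

Lemma hecke_biequiv F : hecke F -> biequiv F.
Proof. by move=> [_ bF]. Qed.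

Lemma coset_support_finite (X : zmodType) (f : Gs -> X) :
  fincov [set x | f x != 0] Hs -> finite_set (C `&` [set A | f (coset_repr A) != 0]).
Proof. exact: (lcosets_support_finite tS). Qed.

Lemma hecke_normint F : hecke F -> N F = (hecke_norm1 Hs F)%:E.
Proof.
move=> hF; have bF := hecke_biequiv hF; rewrite (biequiv_normint cot haar muH bF).
apply: (@esum_finite_support R _ C (fun A => opnorm (F (coset_repr A)))) => [A|]; first exact: opnorm_ge0.
apply: (coset_support_finite (f := fun x => opnorm (F x))).
apply: fincovS (((hecke_algP tS F).1 hF).2) => x /=.
by apply: contra => /eqP ->; rewrite opnorm0.
Qed.

Lemma hecke_ell1 F : hecke F -> ell1 Hs sigmas mu F.
Proof. by move=> hF; split; [exact: hecke_biequiv|rewrite hecke_normint// ltry]. Qed.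

(** [Phi] is a finite sum of functions each constant on one coset of measure 1 and zero
    elsewhere. *)
Lemma mint_lcosets (Phi : Gs -> 'M[R[i]]_n) :
  (forall x h, Hs h -> Phi (x * h)%g = Phi x) -> fincov [set x | Phi x != 0] Hs ->
  mint mu Phi = \sum_(A \in C) Phi (coset_repr A).
Proof.
move=> PH fP; have fin := coset_support_finite fP; set S := C `&` _ in fin.
pose ind (A : set Gs) (M : 'M[R[i]]_n) (x : Gs) : 'M[R[i]]_n := if x \in A then M else 0.
have indP A M : C A -> mintegrable mu (ind A M) /\ mint mu (ind A M) = M.
  move=> CA; have mA : measurable (A : set T) by apply: mO; exact: (coset_open cot CA).
  have iE x : A x -> ind A M x = M by move=> Ax; rewrite /ind ifT// inE.
  have iN x : ~ A x -> ind A M x = 0.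
    by move=> Ax; rewrite /ind ifF//; apply: negbTE; rewrite notin_setE.
  split; last by rewrite (mint_indic mu mA iE iN) (haar_coset cot haar muH CA) scale1r.
  split.
    apply: mmeasurable_open_fibers => B; apply: (rinv_open _ sHs oHs) => x h Hh.
    have [eA _] := lcoset_repr sHs CA.
    have E : A (x * h)%g = A x by rewrite eA ltransE /= mulgA subgroupMr.
    by have [Ax|Ax] := pselect (A x); [rewrite !iE// E|rewrite !iN// E].
  rewrite /mnormint (_ : (\int[mu]_x _ = \int[mu]_(x in A) cst (opnorm M)%:E x)%E).
    by rewrite (integral_cst mu mA) (haar_coset cot haar muH CA) mule1 ltry.
  rewrite [RHS]integral_mkcond; apply: eq_integral => x _; rewrite patchE.
  by case: ifPn => [|]; rewrite ?inE ?notin_setE => Ax; [rewrite iE|rewrite iN// opnorm0].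
have sumP (s : seq (set Gs)) : (forall A, A \in s -> C A) ->
    mintegrable mu (fun x => \sum_(A <- s) ind A (Phi (coset_repr A)) x) /\
    mint mu (fun x => \sum_(A <- s) ind A (Phi (coset_repr A)) x) = \sum_(A <- s) Phi (coset_repr A).
  elim: s => [_|A s IH sC].
    under eq_fun do rewrite big_nil; rewrite big_nil mint0; split=> //.
    split; first exact: mmeasurable_cst.
    rewrite /mnormint (_ : (\int[mu]_x _ = 0)%E) ?ltry//.
    by apply: integral0_eq => x _; rewrite opnorm0.
  have [|IH1 IH2] := IH; first by move=> B Bs; apply: sC; rewrite inE Bs orbT.
  have [i1 e1] := indP A (Phi (coset_repr A)) (sC A (mem_head _ _)).
  under eq_fun do rewrite big_cons; rewrite big_cons; split.
    exact: (mintegrableD i1 IH1).1.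
  by rewrite (mintD i1 IH1) e1 IH2.
have PhiE : Phi = fun x => \sum_(A <- finmap.enum_fset (fset_set S)) ind A (Phi (coset_repr A)) x.
  apply/funext => x; set A := ltrans x Hs.
  have CA : C A by exists x.
  have Ax : A x by rewrite /A ltransE /= mulVg; exact: subgroup1.
  have PA : Phi (coset_repr A) = Phi x.
    by rewrite -(mulVKg x (coset_repr A)) PH//; exact: lcoset_repr_prop.
  have other B : C B -> B != A -> ind B (Phi (coset_repr B)) x = 0.
    move=> CB BA; rewrite /ind ifF//; apply: negbTE; rewrite notin_setE => Bx.
    have /trivIsetP/(_ _ _ CB CA BA) := lcoset_triv sHs.
    by rewrite -subset0 => /(_ x); apply.
  have indA : ind A (Phi (coset_repr A)) x = Phi x by rewrite /ind ifT ?inE.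
  have [Px|Px] := eqVneq (Phi x) 0.
    rewrite Px big_seq big1// => B; rewrite in_fset_set// inE => -[CB PB].
    by apply: other => //; apply: contraNneq PB => ->; rewrite PA Px.
  have SA : A \in finmap.enum_fset (fset_set S).
    by rewrite in_fset_set// inE; split=> //=; rewrite PA.
  rewrite (big_rem A)//= indA [X in _ + X]big_seq big1 ?addr0// => B.
  rewrite mem_rem_uniq ?finmap.fset_uniq// inE in_fset_set// => /andP[BA].
  by rewrite inE => -[CB _]; exact: other.
rewrite {1}PhiE; have [|_ ->] := sumP (finmap.enum_fset (fset_set S)).
  by move=> A; rewrite in_fset_set// inE => -[].
rewrite -fsbig_finite// (fsbig_widen S C)//; first by move=> A [].
move=> A [CA nS] /=; apply: contrapT => PA; apply: nS; split=> //.
by apply/eqP.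
Qed.

Lemma biequiv_div F x y h : biequiv F -> Hs h ->
  F ((y * h)^-1 * x)%g = (sigmas h)^t* *m F (y^-1 * x)%g.
Proof.
move=> bF Hh; rewrite invgM -mulgA (biequivariantl tS _ bF); last exact: subgroupV.
by rewrite (triple_sigmaV tS).
Qed.

(** In the integrand the factor [sigmas h] from [F] meets its adjoint from [g] and cancels, so the
    integrand is constant on cosets. *)
Lemma hecke_convE F g : hecke F -> hecke g -> convol mu F g = hecke_conv Hs F g.
Proof.
move=> hF hg; have bF := hecke_biequiv hF; have bg := hecke_biequiv hg.
apply/funext => x; rewrite convolE /hecke_conv; apply: mint_lcosets.
  move=> y h Hh; rewrite (biequivariantr tS _ bF Hh) (biequiv_div _ _ bg Hh).
  rewrite -mulmxA [sigmas h *m _]mulmxA -(invmx_unitary (triple_unitary tS Hh)).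
  by rewrite mulmxV ?mul1mx//; exact: (triple_unit tS).
apply: fincovS (((hecke_algP tS F).1 hF).2) => y /=.
by apply: contra => /eqP ->; rewrite mul0mx.
Qed.

(** The index of [M y] in [Ks] is [mu Ks / mu (M y)], so [hecke_modular] is the ratio of
    [mu (M x^-1)] to [mu (M x)]. *)
Lemma Delta_hecke_modular x : Delta x = hecke_modular Hs sigmas x.
Proof.
pose Ks := rep_ker Hs sigmas; pose M y := Ks `&` conjset y Ks.
have sKs : subgroup Ks := rep_ker_subgroup tS.
have oKs : open Ks := cot_ker_open cot.
have sM y : subgroup (M y) by apply: subgroupI => //; exact: subgroup_conjset.
have oM y : open (M y) by apply: openI => //; exact: open_conjset.
have cKs : compact Ks.
  apply: (subclosed_compact _ (cot_compact cot)); last exact: rep_ker_sub.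
  exact: subgroup_closed.
have fM y : fincov Ks (M y) by exact: compact_fincov.
have muM_fin y : mu (M y) \is a fin_num.
  rewrite ge0_fin_numE ?measure_ge0//; apply: (@le_lt_trans _ _ (mu Hs)); last by rewrite muH ltry.
  by apply: haar_le; [exact: mO|exact: mO|move=> z [[Hz _] _]].
have muM_gt0 y : 0 < fine (mu (M y)).
  by rewrite -lte_fin fineK//; exact: (haar_open_subgroup_gt0 cot haar muH).
have idx y : fine (mu Ks) = (subgroup_index Ks (M y))%:R * fine (mu (M y)).
  have KM z l : Ks z -> M y l -> Ks (z * l)%g by move=> Kz [Kl _]; exact: subgroupM.
  rewrite (haar_finite_lcosets haar (sM y) (oM y) (fM y) KM).
  rewrite fsbig_finite; last exact/fincov_left_cosets.
  rewrite -(fineK (muM_fin y)) sumEFin /= big_const_seq count_predT iter_addr_0.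
  by rewrite mulr_natl.
have muKs : 0 < fine (mu Ks).
  have := idx 1%g; set i := subgroup_index _ _ => e.
  (* The cosets counted by this index have measures adding up to [mu Ks], which is positive. *)
  have i0 : i != 0%N.
    apply/eqP => i0; have : (0 < mu Ks)%E by exact: (haar_open_subgroup_gt0 cot haar muH).
    suff -> : mu Ks = 0%E by rewrite ltxx.
    have KM z l : Ks z -> M 1%g l -> Ks (z * l)%g by move=> Kz [Kl _]; exact: subgroupM.
    rewrite (haar_finite_lcosets haar (sM _) (oM _) (fM _) KM).
    rewrite fsbig_finite; last exact/fincov_left_cosets.
    have /finmap.cardfs0_eq -> : #|` fset_set (left_cosets Ks (M 1%g))|%fset = 0%N by exact: i0.
    by rewrite big_nil.
  by rewrite e mulr_gt0// ltr0n lt0n.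
have iE y : (subgroup_index Ks (M y))%:R = fine (mu Ks) / fine (mu (M y)).
  by rewrite (idx y) mulfK// gt_eqF.
(* [M x^-1] is the conjugate [x^-1 (M x) x]; the left translation preserves the measure, the right
   one contributes [Delta x]. *)
have muMx : fine (mu (M x^-1%g)) = Delta x * fine (mu (M x)).
  rewrite -[Delta x * _]/(fine (Delta x)%:E * _) -fineM// -(haar_rtrans modD x (mO (oM x))).
  congr fine; have := haar_invariant haar x^-1%g (mO (open_rtrans x (oM x))) => <-; congr (mu _).
  rewrite ltransE rtransE /M !conjsetE; apply/seteqP; split=> z /=; rewrite invgK.
    move=> [Kz Kz']; split; first exact: Kz'.
    by rewrite !mulgA mulVg mul1g mulgVK.
  by rewrite !mulgA mulVg mul1g mulgVK => -[Kz Kz'].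
rewrite /hecke_modular -/Ks -/(M x) -/(M x^-1%g) !iE muMx.
have m0 := muM_gt0 x; have D0 := Delta_gt0 modD x.
by field; rewrite !gt_eqF.
Qed.

Lemma hecke_invE F : grp_inv Delta F = hecke_inv Hs sigmas F.
Proof. by apply/funext => x; rewrite /grp_inv /hecke_inv Delta_hecke_modular. Qed.

Lemma compact_lcoset x : compact (ltrans x Hs).
Proof.
rewrite /ltrans; apply: continuous_compact; last exact: (cot_compact cot).
by apply: continuous_subspaceT => y; exact: mulgl_continuous.
Qed.

Lemma compact_sub_fincov (A : set Gs) : fincov A Hs -> closed A -> compact A.
Proof.
move=> [s HA] cA.
apply: (@subclosed_compact _ _ (\big[setU/set0]_(c <- s) ltrans c Hs)) => //.
  elim: (s) => [|c t IH]; first by rewrite big_nil; exact: compact0.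
  rewrite big_cons; exact: (compactU (@compact_lcoset c) IH).
move=> x Ax; rewrite -bigcup_seq; have [c cs Hc] := HA x Ax.
by exists c => //; rewrite ltransE.
Qed.

(** Local constancy makes the nonvanishing set closed already, so it is its own closure, covered by
    finitely many compact cosets. *)
Lemma hecke_Cc F : hecke F -> Cc F.
Proof.
move=> hF; have bF := hecke_biequiv hF; have lF := biequiv_l cot bF.
split; first exact: (lequivariant_continuous cot lF).
have cS : closed [set x | F x != 0].
  have -> : [set x | F x != 0] = ~` (F @^-1` [set 0]).
    by apply/seteqP; split=> x /= /eqP.
  by apply: open_closedC; exact: (lequivariant_open_fibers cot _ lF).
rewrite -(closure_id _).1//; apply: compact_sub_fincov => //.
exact: (((hecke_algP tS F).1 hF).2).
Qed.

Lemma hecke_p : hecke p.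
Proof.
apply/(hecke_algP tS); split; first exact: (biequiv_p cot).
exists [:: 1%g] => x px; exists 1%g; first exact: mem_head.
rewrite invg1 mul1g; apply: contrapT => nHx.
by move: px; rewrite /= /p p_out// eqxx.
Qed.

Lemma grp_inv_p : grp_inv Delta p = p.
Proof.
apply/funext => x; rewrite /grp_inv; have [Hx|Hx] := pselect (Hs x).
  have HV := subgroupV sHs Hx.
  rewrite (DeltaH cot muH modD HV) scale1r /p !p_in//.
  by rewrite (triple_sigmaV tS)// trmxCK.
rewrite /p !p_out ?subgroup_invE//.
by apply/matrixP => k l; rewrite !mxE conjC0 mulr0.
Qed.

End Corner.

Lemma nbhs_preimage (U V : nbhsType) (g : U -> V) x (B : set V) :
  {for x, continuous g} -> nbhs (g x) B -> nbhs x (g @^-1` B).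
Proof. by move=> cg /cg. Qed.

Lemma continuous_ball (R : realType) (n : nat) (Gs : topGroupType)
    (g : Gs -> 'M[R[i]]_n) x (d : R[i]) :
  0 < d -> continuous g -> nbhs x (g @^-1` ball (g x) d ).
Proof.
move=> d0 cg; have B := nbhsx_ballx (g x) d d0.
exact: (nbhs_preimage (cg x) B).
Qed.

(** * Description of [p C_c p] and [p L^1 p] *)

Section CornerDescription.
Variables (R : realType) (n : nat) (Gs : topGroupType) (Hs : set Gs).
Variable sigmas : Gs -> 'M[R[i]]_n.
Variables (mu : {measure set (borel Gs) -> \bar R}) (Delta : Gs -> R).
Hypothesis cot : compact_open_triple Hs sigmas.
Hypothesis haar : haar_measure mu.
Hypothesis muH : mu Hs = 1%E.
Hypothesis modD : modular_function mu Delta.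
Local Notation T := (borel Gs).
Implicit Types (f g F : Gs -> 'M[R[i]]_n).

Let tS := cot_triple cot.
Let sHs := triple_subgroup tS.
Let oHs := cot_open cot.
Let mO := @open_measurable_borel Gs.
Let C := left_cosets [set: Gs] Hs.
Let p := proj_fun Hs sigmas.
Local Notation biequiv := (biequivariant Hs sigmas).
Local Notation hecke := (hecke_alg Hs sigmas).
Local Notation ell1 := (ell1 Hs sigmas mu).
Local Notation P f := (convol mu (convol mu p f) p).

(** Applied with [u] the real or imaginary part of an entry of [g], whose variation is controlled by
    the entrywise distance. *)
Let open_gt (u : Gs -> R) (g : Gs -> 'M[R[i]]_n) : continuous g ->
  (forall x y (e : R), ball (g x) e%:C (g y) -> `|u x - u y| < e) ->
  measurable_fun [set: T] (u : T -> R).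
Proof.
move=> cg ug; apply: (measurability _ (RGenOInfty.measurableE R)) => // _ [_ [c ->] <-].
rewrite setTI; apply: mO; rewrite openE => x /=; rewrite in_itv /= andbT => cx.
have e0C : 0 < (u x - c)%:C by rewrite ltcR subr_gt0.
have B := continuous_ball x e0C cg.
by apply: filterS B => y /= /ug; rewrite in_itv /= andbT => /(le_lt_trans (ler_norm _)); lra.
Qed.

Lemma ball_entry (A B : 'M[R[i]]_n) (e : R) k l : ball A e%:C B -> complex.Re `|A k l - B k l| < e.
Proof.
move=> [_ /(_ k l)]; rewrite /ball /= => h.
by rewrite -ltcR Re_normE.
Qed.

Lemma Cc_mintegrable g : Cc g -> mintegrable mu g.
Proof.
move=> [cg cS]; set S := closure _ in cS.
have mg : mmeasurable (g : T -> _).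
  move=> k l; split; apply: (open_gt cg) => x y e /(ball_entry k l); apply: le_lt_trans.
    by apply: le_trans (Re_le_norm _); rewrite cReD; case: (g y k l).
  by apply: le_trans (Im_le_norm _); rewrite cImD; case: (g y k l).
split; first exact: mg.
have [M [M0 gM]] : exists M, 0 <= M /\ forall x, S x -> opnorm (g x) <= M.
  pose U c := interior [set x | ball (g c) (1 : R)%:C (g x)].
  move: (cS); rewrite compact_cover => /(_ _ S U) [c _|x Sx|D _ SD].
  - exact: open_interior.
  - have e1 : 0 < (1 : R)%:C by rewrite ltcR.
    exists x; [exact: Sx|exact: (continuous_ball x e1 cg)].
  (* On a unit ball around [g c] every entry moves by less than 1, so the operator norm grows by at
     most [b]; the bound is then summed over a finite cover. *)
  pose b := \sum_(k < n) \sum_(l < n) (1 : R).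
  have b0 : 0 <= b by apply: sumr_ge0 => k _; apply: sumr_ge0.
  exists (\sum_(c <- finmap.enum_fset D) (opnorm (g c) + b)); split.
    by apply: sumr_ge0 => c _; rewrite addr_ge0// opnorm_ge0.
  move=> x /SD[c cD /interior_subset /= gc].
  apply: (@le_trans _ _ (opnorm (g c) + b)).
    have -> : g x = g c + (g x - g c) by rewrite addrC subrK.
    apply: le_trans (opnormD _ _) _; rewrite lerD2l.
    apply: le_trans (opnorm_entry_sum _) _; apply: ler_sum => k _; apply: ler_sum => l _.
    by rewrite !mxE -normrN opprB; exact/ltW/(ball_entry k l gc).
  rewrite (big_rem c)//= lerDl; apply: sumr_ge0 => d _.
  by rewrite addr_ge0// opnorm_ge0.
have mS : measurable (S : set T) by apply: closed_measurable_borel; exact: closed_closure.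
have muS := haar_compact haar cS.
apply: (@le_lt_trans _ _ (\int[mu]_(x in S) cst M%:E x)%E).
  rewrite integral_mkcond [leRHS]integral_mkcond.
  have mcst : measurable_fun [set: T] ((cst M%:E : T -> \bar R) \_ S).
    by apply/(measurable_restrictT _ mS); exact: measurable_cst.
  rewrite patch_setT.
  apply: (ge0_le_integral mu measurableT _ (measurable_opnormE mg) mcst).
    by move=> x _; rewrite lee_fin opnorm_ge0.
  move=> x _; rewrite patchE; case: ifPn => [|].
    by rewrite inE => Sx; rewrite lee_fin; exact: gM.
  rewrite notin_setE => nSx; suff -> : g x = 0 by rewrite opnorm0.
  apply: contrapT => gx; apply: nSx; apply: subset_closure => /=.
  exact/eqP.
by rewrite (integral_cst mu mS); apply: lte_mul_pinfty; rewrite ?lee_fin.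
Qed.

Lemma mint_neq0 (Phi : Gs -> 'M[R[i]]_n) : mint mu Phi != 0 -> exists y, Phi y != 0.
Proof.
move=> P0; apply: contrapT => nP; move/eqP: P0; apply.
rewrite -(mint0 n mu); congr mint; apply/funext => y; apply/eqP.
by apply: contrapT => /negP Py; apply: nP; exists y.
Qed.

(** The point is the support: [p * g * p] can be nonzero only on [Hs S Hs], with [S] the compact
    support of [g], and [S] meets finitely many left cosets of [Hs]. *)
Lemma corner_Cc_hecke : corner_Cc mu p = hecke.
Proof.
apply/seteqP; split=> [f [g Cg ->]|f hf]; last first.
  exists f; first exact: (hecke_Cc cot).
  by rewrite (pcornerK cot haar muH)//; exact: (hecke_biequiv hf).
apply/(hecke_algP tS); split.
  by apply: (pcorner_biequiv cot haar muH modD); exact: Cc_mintegrable.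
case: Cg => cg cS; set S := closure _ in cS.
have [s HsS] := compact_fincov cS sHs oHs.
apply: (@fincovS _ [set x | exists2 c, c \in s & dcoset Hs c Hs x]); last first.
  by apply: fincov_bigcup => c _; exact: (fincov_dcoset tS).
move=> x /= /mint_neq0[y yx].
have [Hyx|Hyx] := pselect (Hs (y^-1 * x)%g); last first.
  by move: yx; rewrite [p (y^-1 * x)%g]p_out// mulmx0 eqxx.
have /mint_neq0[z zy] : convol mu p g y != 0.
  by apply: contra yx => /eqP ->; rewrite mul0mx.
have [Hz|Hz] := pselect (Hs z); last first.
  by move: zy; rewrite [p z]p_out// mul0mx eqxx.
have Sw : S (z^-1 * y)%g.
  by apply: subset_closure; apply: contra zy => /eqP ->; rewrite mulmx0.
have [c cs Hc] := HsS _ Sw; exists c => //.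
exists z, (c^-1 * (z^-1 * y) * (y^-1 * x))%g; split=> //.
  by apply: subgroupM.
by rewrite !mulgA !(mulgK, mulgV, mul1g, mulgVK).
Qed.

(** This replaces the unspecified [g] in [corner_L1] by the [ell1] function almost everywhere equal
    to [f], which is its own preimage since [p * F * p = F]. *)
Lemma corner_L1P f : corner_L1 mu p f <->
  mintegrable mu f /\ exists2 F, ell1 F & ae_equal mu f F.
Proof.
split=> [[fL [g gL fg]]|[fi [F eF fF]]].
  have bP : biequiv (P g) by exact: (pcorner_biequiv cot haar muH modD).
  split; first exact: fL.
  exists (P g); last exact: fg.
  split; first exact: bP.
  rewrite -(mnormint_ae fL.1 (biequiv_mmeasurable cot bP) fg).
  exact: fL.2.
split; first exact: fi.
exists F; first exact: (ell1_mintegrable cot eF).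
by rewrite (pcornerK cot haar muH eF.1).
Qed.

(** For every [x] the integrands agree almost everywhere, so the convolutions agree at every
    point. *)
Lemma convol_ae f f' g g' : mmeasurable (f : T -> _) -> mmeasurable (f' : T -> _) ->
  mmeasurable (g : T -> _) -> mmeasurable (g' : T -> _) ->
  ae_equal mu f f' -> ae_equal mu g g' -> convol mu f g = convol mu f' g'.
Proof.
move=> mf mf' mg mg' ff' gg'; apply/funext => x; rewrite !convolE.
have cx := @divl_continuous Gs x.
apply: mint_ae; [exact: (mmeasurableM mf (mmeasurable_comp cx mg))|
  exact: (mmeasurableM mf' (mmeasurable_comp cx mg'))|].
have gx := ae_equal_inv cot haar muH modD x gg'.
by apply: (filterS2 _ _ ff' gx) => y /= -> ->.
Qed.

Lemma ae_equal_refl f : ae_equal mu f f.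
Proof. exact: nearW. Qed.

(** Compression by [p] recovers the biequivariant representative exactly, which makes it a canonical
    selection. *)
Lemma pcorner_ae f F : mintegrable mu f -> ell1 F -> ae_equal mu f F -> P f = F.
Proof.
move=> fi eF fF; have mp := biequiv_mmeasurable cot (biequiv_p cot).
rewrite (convol_ae mp mp fi.1 (biequiv_mmeasurable cot eF.1) (ae_equal_refl _) fF).
exact: (pcornerK cot haar muH eF.1).
Qed.

Lemma grp_inv_ae f g : ae_equal mu f g -> ae_equal mu (grp_inv Delta f) (grp_inv Delta g).
Proof.
move=> /(ae_equal_div cot haar muH modD); apply: filterS => x /= e.
by rewrite /grp_inv e.
Qed.

Lemma mmeasurable_grp_inv f : mmeasurable (f : T -> _) -> mmeasurable (grp_inv Delta f : T -> _).
Proof.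
move=> mf.
(* Triviality of [Delta] on the open subgroup [Hs] makes it locally constant, hence measurable. *)
have mD : measurable_fun [set: T] ((fun x => Delta x^-1%g) : T -> R).
  apply: open_fibers_measurable => B.
  apply: (@linv_open Gs _ Hs (fun x => Delta x^-1%g) B sHs oHs) => x h Hh.
  have HV := subgroupV sHs Hh.
  by rewrite invgM (DeltaM cot muH modD) (DeltaH cot muH modD HV) mulr1.
have mfV := mmeasurable_comp (@invg_continuous Gs) mf.
move=> k l; have [m1 m2] := mfV l k; split.
  rewrite (_ : (fun _ => _) = fun x => Delta x^-1%g * complex.Re (f x^-1%g l k)).
    exact: (measurable_funM mD m1).
  by apply/funext => x; rewrite !mxE ReZC; case: (f x^-1%g l k).
rewrite (_ : (fun _ => _) = fun x => Delta x^-1%g * - complex.Im (f x^-1%g l k)).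
  by apply: (measurable_funM mD); exact: measurableT_comp.
by apply/funext => x; rewrite !mxE ImZC; case: (f x^-1%g l k).
Qed.

Lemma corner_lin (a : R[i]) f g F G : mintegrable mu f -> mintegrable mu g ->
  ae_equal mu f F -> ae_equal mu g G ->
  mintegrable mu (a *: f + g) /\ ae_equal mu (a *: f + g) (a *: F + G).
Proof.
move=> fi gi fF gG; split.
  have [i1 _] := mintegrableZ a fi; exact: (mintegrableD i1 gi).1.
apply: (filterS2 _ _ fF gG) => x /= e1 e2.
by rewrite -[LHS]/(a *: f x + g x) e1 e2.
Qed.

Lemma corner_L1_star_closed : star_closed (corner_L1 mu p) (convol mu) (grp_inv Delta).
Proof.
split.
- apply/corner_L1P; have e0 : ell1 0.
    split; last by rewrite normint0 ltry.
    by move=> h x k _ _; rewrite -[RHS]/(sigmas h *m 0 *m sigmas k) mulmx0 mul0mx.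
  by split; [exact: (ell1_mintegrable cot e0)|exists 0 => //; exact: ae_equal_refl].
- move=> a f g /corner_L1P[fi [F eF fF]] /corner_L1P[gi [G eG gG]].
  apply/corner_L1P; have [i e] := corner_lin a fi gi fF gG.
  by split; [exact: i|exists (a *: F + G); [exact: (ell1_lin cot a eF eG)|exact: e]].
- move=> f g /corner_L1P[fi [F eF fF]] /corner_L1P[gi [G eG gG]].
  apply/corner_L1P.
  rewrite (convol_ae fi.1 (biequiv_mmeasurable cot eF.1) gi.1 (biequiv_mmeasurable cot eG.1) fF gG).
  have eFG := ell1_convol cot haar muH eF eG.
  by split; [exact: (ell1_mintegrable cot eFG)|exists (convol mu F G); [exact: eFG|exact: ae_equal_refl]].
- move=> f /corner_L1P[fi [F eF fF]]; apply/corner_L1P.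
  have eS := ell1_star cot haar muH modD eF; have ae := grp_inv_ae fF.
  have mS := mmeasurable_grp_inv fi.1.
  split; last by exists (grp_inv Delta F); [exact: eS|exact: ae].
  split; first exact: mS.
  rewrite (mnormint_ae mS (biequiv_mmeasurable cot eS.1) ae); exact: eS.2.
Qed.

End CornerDescription.

(** * Completions of normed *-algebras *)

Section NormedStarAlgebras.
Variable R : realType.

(** A common form for the two complete algebras to be compared: [ell1], a set of functions, and [L],
    a whole type. The norm is real and completeness is stated with sequences. *)
Record normed_star_algebra (V : lmodType R[i]) (E : set V) (mul : V -> V -> V)
    (star : V -> V) (nrm : V -> R) : Prop := {
  nsa_closed : star_closed E mul star;
  nsa_ge0 : forall f, E f -> 0 <= nrm f;
  nsa_norm0 : nrm 0 = 0;
  nsa_norm_lin : forall a f g, E f -> E g ->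
    nrm (a *: f + g) <= complex.Re `|a| * nrm f + nrm g;
  nsa_linl : forall a f g h, E f -> E g -> E h ->
    mul (a *: f + g) h = a *: mul f h + mul g h;
  nsa_linr : forall a f g h, E f -> E g -> E h ->
    mul h (a *: f + g) = a *: mul h f + mul h g;
  nsa_norm_mul : forall f g, E f -> E g -> nrm (mul f g) <= nrm f * nrm g;
  nsa_conj : forall a f g, E f -> E g ->
    star (a *: f + g) = a^*%C *: star f + star g;
  nsa_norm_star : forall f, E f -> nrm (star f) <= nrm f;
  nsa_complete : forall u : nat -> V, (forall m, E (u m)) ->
    (forall e, 0 < e -> exists M, forall m k, (M <= m)%N -> (M <= k)%N ->
       nrm (u m - u k) < e) ->
    exists2 F, E F & forall e, 0 < e -> exists M, forall m, (M <= m)%N ->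
       nrm (F - u m) < e }.

Section Basics.
Variables (V : lmodType R[i]) (E : set V) (mul : V -> V -> V) (star : V -> V).
Variable nrm : V -> R.
Hypothesis nE : normed_star_algebra E mul star nrm.

Lemma nsa_lin a f g : E f -> E g -> E (a *: f + g).
Proof. by move=> Ef Eg; have [_ h _ _] := nsa_closed nE; exact: h. Qed.

Lemma nsa_sub f g : E f -> E g -> E (f - g).
Proof. by move=> Ef Eg; rewrite addrC -scaleN1r; exact: nsa_lin. Qed.

Lemma nsa_norm_add f g : E f -> E g -> nrm (f + g) <= nrm f + nrm g.
Proof.
move=> Ef Eg; rewrite -[f in leLHS]scale1r; apply: le_trans (nsa_norm_lin nE _ Ef Eg) _.
by rewrite normr1 mul1r.
Qed.

Lemma nsa_norm_distC f g : E f -> E g -> nrm (f - g) = nrm (g - f).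
Proof.
have E0 : E 0 by case: (nsa_closed nE).
suff h x y : E x -> E y -> nrm (x - y) <= nrm (y - x).
  by move=> Ef Eg; apply/eqP; rewrite eq_le !h.
move=> Ex Ey; rewrite -[x - y]opprB -[leLHS]/(nrm (- (y - x))) -(scaleN1r (y - x)) -[X in nrm X]addr0.
apply: le_trans (nsa_norm_lin nE _ (nsa_sub Ey Ex) E0) _.
by rewrite normrN1 mul1r (nsa_norm0 nE) addr0.
Qed.

Lemma nsa_norm_dist f g h : E f -> E g -> E h -> nrm (f - h) <= nrm (f - g) + nrm (g - h).
Proof.
move=> Ef Eg Eh; rewrite (_ : f - h = (f - g) + (g - h)); last by rewrite addrA subrK.
by apply: nsa_norm_add; exact: nsa_sub.
Qed.

Lemma nsa_norm_le f g : E f -> E g -> nrm f <= nrm g + nrm (f - g).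
Proof.
move=> Ef Eg; rewrite -{1}[f](subrK g) addrC.
by rewrite [leRHS]addrC; apply: (le_trans (nsa_norm_add _ _)) => //; [exact: nsa_sub|rewrite addrC lexx].
Qed.

Lemma nsa_mul f g : E f -> E g -> E (mul f g).
Proof. by have [_ _ h _] := nsa_closed nE; exact: h. Qed.

Lemma nsa_star f : E f -> E (star f).
Proof. by have [_ _ _ h] := nsa_closed nE; exact: h. Qed.

Lemma nsa_mul_dist f g a b : E f -> E g -> E a -> E b ->
  nrm (mul f g - mul a b) <= nrm (f - a) * nrm g + nrm a * nrm (g - b).
Proof.
move=> Ef Eg Ea Eb.
have e1 : mul f g - mul a g = mul (f - a) g.
  by rewrite addrC -scaleN1r -(nsa_linl nE)// scaleN1r addrC.
have e2 : mul a g - mul a b = mul a (g - b).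
  by rewrite addrC -scaleN1r -(nsa_linr nE)// scaleN1r addrC.
apply: le_trans (nsa_norm_dist (nsa_mul Ef Eg) (nsa_mul Ea Eg) (nsa_mul Ea Eb)) _.
rewrite e1 e2; apply: lerD; apply: (nsa_norm_mul nE) => //; exact: nsa_sub.
Qed.

Lemma nsa_star_dist f g : E f -> E g -> nrm (star f - star g) <= nrm (f - g).
Proof.
move=> Ef Eg; rewrite (_ : star f - star g = star (f - g)).
  by apply: (nsa_norm_star nE); exact: nsa_sub.
rewrite addrC -scaleN1r [f - g]addrC -[- g]scaleN1r (nsa_conj nE)//.
by rewrite rmorphN rmorph1.
Qed.

Lemma nsa_lin_dist c f g a b : E f -> E g -> E a -> E b ->
  nrm ((c *: f + g) - (c *: a + b)) <= complex.Re `|c| * nrm (f - a) + nrm (g - b).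
Proof.
move=> Ef Eg Ea Eb; rewrite opprD addrACA -scalerBr.
by apply: (nsa_norm_lin nE); exact: nsa_sub.
Qed.

End Basics.

Section IsometricExtension.
Variables (V W : lmodType R[i]) (E : set V) (D : set W).
Variables (mulV : V -> V -> V) (starV : V -> V) (nV : V -> R).
Variables (mulW : W -> W -> W) (starW : W -> W) (nW : W -> R).
Hypothesis aE : normed_star_algebra E mulV starV nV.
Hypothesis aD : normed_star_algebra D mulW starW nW.
Hypothesis nW_eq0 : forall w, D w -> nW w = 0 -> w = 0.
Variables (A : set V) (j : V -> W).
Hypothesis AE : A `<=` E.
Hypothesis AD : forall a, A a -> D (j a).
Hypothesis Acl : star_closed A mulV starV.
Hypothesis jh : star_hom A mulV starV mulW starW j.
Hypothesis jn : forall a, A a -> nW (j a) = nV a.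
Hypothesis Adense : forall F e, E F -> 0 < e -> exists2 a, A a & nV (F - a) < e.

(* F and l are the limits of a common sequence of elements of A. *)
Let rel F l := forall e, 0 < e -> exists a, [/\ A a, nV (F - a) < e & nW (l - j a) < e].

Let jsub a b : A a -> A b -> j (a - b) = j a - j b.
Proof.
move=> Aa Ab; have [h _ _] := jh.
by rewrite addrC -scaleN1r h// scaleN1r addrC.
Qed.

Let Asub a b : A a -> A b -> A (a - b).
Proof. by move=> Aa Ab; have [_ h _ _] := Acl; rewrite addrC -scaleN1r; exact: h. Qed.

Let inv_gt0 (m : nat) : 0 < (m.+1%:R)^-1 :> R.
Proof. by rewrite invr_gt0 ltr0n. Qed.

Let inv_small (e : R) : 0 < e -> exists M, forall m, (M <= m)%N -> m.+1%:R^-1 < e.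
Proof.
move=> e0; exists (Num.truncn e^-1) => m Mm.
rewrite -[e]invrK ltf_pV2 ?posrE ?invr_gt0 ?ltr0n//.
apply: lt_le_trans (truncnS_gt _) _; by rewrite ler_nat ltnS.
Qed.

Let rel_norm F l : E F -> D l -> rel F l -> nW l = nV F.
Proof.
move=> EF Dl r; apply/eqP; rewrite eq_le; apply/andP; split;
  apply/ler_addgt0Pr => e e0; have e2 : 0 < e / 2 by rewrite divr_gt0.
  have [a [Aa h1 h2]] := r _ e2; have Ea := AE Aa; have Da := AD Aa.
  have := nsa_norm_le aD Dl Da; have := nsa_norm_le aE Ea EF.
  rewrite (nsa_norm_distC aE Ea EF) jn//; lra.
have [a [Aa h1 h2]] := r _ e2; have Ea := AE Aa; have Da := AD Aa.
have := nsa_norm_le aE EF Ea; have := nsa_norm_le aD Da Dl.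
rewrite (nsa_norm_distC aD Da Dl) jn//; lra.
Qed.

Let rel_lin c F l F' l' : E F -> E F' -> D l -> D l' -> rel F l -> rel F' l' ->
  rel (c *: F + F') (c *: l + l').
Proof.
move=> EF EF' Dl Dl' r r' e e0; set b := complex.Re `|c|.
have b0 : 0 <= b by rewrite -lecR Re_normE; exact: normr_ge0.
(* Two errors below [e / (b + 1)], one of them scaled by [b], add up to less than [e]. *)
have d0 : 0 < e / (b + 1) by rewrite divr_gt0// ltr_wpDl.
have [a [Aa h1 h2]] := r _ d0; have [a' [Aa' h1' h2']] := r' _ d0.
have key x y : x < e / (b + 1) -> y < e / (b + 1) -> b * x + y < e.
  move=> hx hy; have -> : e = b * (e / (b + 1)) + e / (b + 1).
    by field; rewrite gt_eqF// ltr_wpDl.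
  by apply: ler_ltD => //; apply: ler_wpM2l => //; exact: ltW.
have [hj _ _] := jh; have [_ Al _ _] := Acl.
exists (c *: a + a'); split; first exact: Al.
  by apply: le_lt_trans (nsa_lin_dist aE _ EF EF' (AE Aa) (AE Aa')) _; exact: key.
rewrite hj//.
by apply: le_lt_trans (nsa_lin_dist aD _ Dl Dl' (AD Aa) (AD Aa')) _; exact: key.
Qed.

(** Subtracting the two pairs relates [0] to [l' - l], and related elements have equal norms. *)
Let rel_uniq F l l' : E F -> D l -> D l' -> rel F l -> rel F l' -> l = l'.
Proof.
move=> EF Dl Dl' r r'; have := rel_lin (-1) EF EF Dl Dl' r r'.
move=> /(rel_norm (nsa_lin aE _ EF EF) (nsa_lin aD _ Dl Dl')).
rewrite !scaleN1r addNr (nsa_norm0 aE) => /nW_eq0 h.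
apply/esym/eqP; rewrite -subr_eq0 addrC; apply/eqP/h.
by rewrite -scaleN1r; exact: (nsa_lin aD).
Qed.

Hypothesis Wdense : forall l e, D l -> 0 < e -> exists2 a, A a & nW (l - j a) < e.

(** Approximants within [1/(m+1)] of [F] are Cauchy; the isometry [j] carries this to [D], whose
    completeness supplies [l]. *)
Let rel_ex F : E F -> exists2 l, D l & rel F l.
Proof.
move=> EF; have ex m : exists a, A a /\ nV (F - a) < m.+1%:R^-1.
  by have [a Aa h] := Adense EF (inv_gt0 m); exists a.
have [a ha] := choice ex.
have Ea m : E (a m) by apply: AE; case: (ha m).
have Da m : D (j (a m)) by apply: AD; case: (ha m).
have [e e0|l Dl lim] := nsa_complete aD Da.
  have e2 : 0 < e / 2 by rewrite divr_gt0.
  have [M hM] := inv_small e2; exists M => m k /hM hm /hM hk.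
  have [Am /lt_trans/(_ hm) nm] := ha m; have [Ak /lt_trans/(_ hk) nk] := ha k; clear hm hk.
  rewrite -jsub// jn; last exact: Asub.
  have := nsa_norm_dist aE (Ea m) EF (Ea k).
  rewrite (nsa_norm_distC aE (Ea m) EF); lra.
exists l => // e e0; have [M hM] := inv_small e0; have [M' hM'] := lim _ e0.
have [Am nm] := ha (maxn M M'); exists (a (maxn M M')); split => //.
  by apply: lt_trans nm _; apply: hM; exact: leq_maxl.
by apply: hM'; exact: leq_maxr.
Qed.

(** The previous argument in the opposite direction, with completeness of [E] and density of the
    image of [j]. *)
Let rel_surj l : D l -> exists2 F, E F & rel F l.
Proof.
move=> Dl; have ex m : exists a, A a /\ nW (l - j a) < m.+1%:R^-1.
  by have [a Aa h] := Wdense Dl (inv_gt0 m); exists a.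
have [a ha] := choice ex.
have Ea m : E (a m) by apply: AE; case: (ha m).
have Da m : D (j (a m)) by apply: AD; case: (ha m).
have [e e0|F EF lim] := nsa_complete aE Ea.
  have e2 : 0 < e / 2 by rewrite divr_gt0.
  have [M hM] := inv_small e2; exists M => m k /hM hm /hM hk.
  have [Am /lt_trans/(_ hm) nm] := ha m; have [Ak /lt_trans/(_ hk) nk] := ha k; clear hm hk.
  rewrite -jn; last exact: Asub.
  rewrite jsub//; have := nsa_norm_dist aD (Da m) Dl (Da k).
  rewrite (nsa_norm_distC aD (Da m) Dl); lra.
exists F => // e e0; have [M hM] := inv_small e0; have [M' hM'] := lim _ e0.
have [Am nm] := ha (maxn M M'); exists (a (maxn M M')); split => //.
  by apply: hM'; exact: leq_maxr.
by apply: lt_trans nm _; apply: hM; exact: leq_maxl.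
Qed.

Let rel_mul F l F' l' : E F -> E F' -> D l -> D l' -> rel F l -> rel F' l' ->
  rel (mulV F F') (mulW l l').
Proof.
move=> EF EF' Dl Dl' r r' e e0; set B := nV F + nV F' + 2.
have F0 := nsa_ge0 aE EF; have F0' := nsa_ge0 aE EF'.
have B1 : 1 <= B by rewrite /B; lra.
have B0 : 0 < B := lt_le_trans ltr01 B1.
(* Distance below 1 keeps the approximants bounded by [B]; distance below [e / (2 * B)] makes each
   of the two error terms of the product less than [e / 2]. *)
have d0 : 0 < Num.min 1 (e / (2 * B)) by rewrite lt_min ltr01 divr_gt0// mulr_gt0.
have [a [Aa h1 h2]] := r _ d0; have [a' [Aa' h1' h2']] := r' _ d0.
have aB : nV a <= B.
  have := nsa_norm_le aE (AE Aa) EF; rewrite (nsa_norm_distC aE (AE Aa) EF) /B.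
  by move: h1; rewrite lt_min => /andP[]; lra.
have key x y u v : 0 <= u -> 0 <= v -> u <= B -> v <= B -> x < Num.min 1 (e / (2 * B)) ->
    y < Num.min 1 (e / (2 * B)) -> 0 <= x -> 0 <= y -> x * u + v * y < e.
  move=> u0 v0 uB vB; rewrite !lt_min => /andP[_ hx] /andP[_ hy] x0 y0.
  have xe : x * B < e / 2 by rewrite -ltr_pdivlMr// -mulrA -invfM.
  have ye : y * B < e / 2 by rewrite -ltr_pdivlMr// -mulrA -invfM.
  have := ler_wpM2l x0 uB; have := ler_wpM2r y0 vB; rewrite [B * y]mulrC; lra.
have [_ hj _] := jh; have [_ _ Am _] := Acl.
exists (mulV a a'); split; first exact: Am.
  apply: le_lt_trans (nsa_mul_dist aE EF EF' (AE Aa) (AE Aa')) _.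
  apply: key => //; try (by apply: (nsa_ge0 aE) => //; try apply: (nsa_sub aE) => //; exact: AE).
  by rewrite /B; lra.
rewrite hj//.
apply: le_lt_trans (nsa_mul_dist aD Dl Dl' (AD Aa) (AD Aa')) _.
apply: key => //; try (by apply: (nsa_ge0 aD) => //; try apply: (nsa_sub aD) => //; exact: AD).
  by rewrite (rel_norm EF' Dl' r') /B; lra.
by rewrite jn.
Qed.

Let rel_star F l : E F -> D l -> rel F l -> rel (starV F) (starW l).
Proof.
move=> EF Dl r e e0; have [a [Aa h1 h2]] := r _ e0.
have [_ _ hj] := jh; have [_ _ _ As] := Acl.
exists (starV a); split; first exact: As.
  by apply: le_lt_trans (nsa_star_dist aE EF (AE Aa)) _.
rewrite hj//; by apply: le_lt_trans (nsa_star_dist aD Dl (AD Aa)) _.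
Qed.

(** [rel] is the graph of a bijection and is compatible with all operations, so [Psi] inherits its
    properties from the uniqueness of related elements. *)
Lemma isometric_star_extension : exists Psi : V -> W,
  [/\ star_hom E mulV starV mulW starW Psi,
      forall F, E F -> D (Psi F) /\ nW (Psi F) = nV F &
      forall l, D l -> exists2 F, E F & Psi F = l].
Proof.
pose Psi F := xget 0 [set l | D l /\ rel F l].
have PsiP F : E F -> D (Psi F) /\ rel F (Psi F).
  by move=> EF; have [l Dl r] := rel_ex EF; apply: (@xgetPex _ 0 [set l | D l /\ rel F l]); exists l.
have PsiE F l : E F -> D l -> rel F l -> Psi F = l.
  by move=> EF Dl r; have [DP rP] := PsiP F EF; exact: (rel_uniq EF).
exists Psi; split.
- split=> [c F F' EF EF'|F F' EF EF'|F EF].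
  + have [D1 r1] := PsiP F EF; have [D2 r2] := PsiP F' EF'.
    by apply: PsiE; [exact: (nsa_lin aE)|exact: (nsa_lin aD)|exact: rel_lin].
  + have [D1 r1] := PsiP F EF; have [D2 r2] := PsiP F' EF'.
    by apply: PsiE; [exact: (nsa_mul aE)|exact: (nsa_mul aD)|exact: rel_mul].
  + have [D1 r1] := PsiP F EF.
    by apply: PsiE; [exact: (nsa_star aE)|exact: (nsa_star aD)|exact: rel_star].
- by move=> F EF; have [D1 r1] := PsiP F EF; split=> //; exact: rel_norm.
- by move=> l Dl; have [F EF r] := rel_surj Dl; exists F => //; exact: PsiE.
Qed.

End IsometricExtension.
End NormedStarAlgebras.

Section MatrixLimits.
Variables (R : realType) (n : nat).

Lemma real_cauchy_lim (u : nat -> R) :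
  (forall e, 0 < e -> exists M, forall m k, (M <= m)%N -> (M <= k)%N -> `|u m - u k| < e) ->
  exists l, forall e, 0 < e -> exists M, forall m, (M <= m)%N -> `|l - u m| < e.
Proof.
move=> cu; have /cvg_ex[l ul] : cvg (u @ \oo).
  apply: cauchy_cvg; apply: cauchy_exP => e e0; have [M hM] := cu e e0.
  by exists (u M); exists M => // m /= Mm; rewrite /ball /=; exact: hM.
exists l => e e0; have /cvgrPdist_lt/(_ e e0)[M _ hM] := ul.
by exists M => m Mm; exact: hM.
Qed.

Lemma opnorm_cauchy_lim (u : nat -> 'M[R[i]]_n) :
  (forall e, 0 < e -> exists M, forall m k, (M <= m)%N -> (M <= k)%N -> opnorm (u m - u k) < e) ->
  exists l, forall e, 0 < e -> exists M, forall m, (M <= m)%N -> opnorm (l - u m) < e.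
Proof.
move=> cu.
have cRe kl : exists z, forall e, 0 < e -> exists M, forall m, (M <= m)%N ->
    `|z - complex.Re (u m kl.1 kl.2)| < e.
  apply: real_cauchy_lim => e /cu[M hM]; exists M => m k Mm Mk.
  apply: le_lt_trans (hM m k Mm Mk); apply: le_trans (entry_le_opnorm _ kl.1 kl.2).
  apply: le_trans (Re_le_norm _); rewrite !mxE cReD; by case: (u k kl.1 kl.2).
have cIm kl : exists z, forall e, 0 < e -> exists M, forall m, (M <= m)%N ->
    `|z - complex.Im (u m kl.1 kl.2)| < e.
  apply: real_cauchy_lim => e /cu[M hM]; exists M => m k Mm Mk.
  apply: le_lt_trans (hM m k Mm Mk); apply: le_trans (entry_le_opnorm _ kl.1 kl.2).
  apply: le_trans (Im_le_norm _); rewrite !mxE cImD; by case: (u k kl.1 kl.2).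
have [a ha] := choice cRe; have [b hb] := choice cIm.
exists (\matrix_(k, l) Complex (a (k, l)) (b (k, l))) => e e0.
(* The factor 2 accounts for real and imaginary parts, [n * n] for the entries; the successor keeps
   the bound strict and covers [n = 0]. *)
pose d := e / (2 * (n * n).+1%:R); have nn0 : 0 < (n * n).+1%:R :> R by rewrite ltr0n.
have d0 : 0 < d by rewrite divr_gt0// mulr_gt0.
have [Ma hMa] := choice (fun kl => ha kl d d0); have [Mb hMb] := choice (fun kl => hb kl d d0).
exists (\max_(kl : 'I_n * 'I_n) maxn (Ma kl) (Mb kl)) => m Mm.
apply: le_lt_trans (opnorm_entry_sum _) _.
have : entry_sum (\matrix_(k, l) Complex (a (k, l)) (b (k, l)) - u m) <=
    \sum_(k < n) \sum_(l < n) (d + d).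
  apply: ler_sum => k _; apply: ler_sum => l _; rewrite !mxE.
  have := leq_trans (leq_bigmax (k, l)) Mm; rewrite geq_max => /andP[m1 m2].
  apply: le_trans (norm_le_ReIm _) _; rewrite cReD cImD.
  have := hMa _ _ m1; have := hMb _ _ m2; case: (u m k l) => x y /=; lra.
move=> /le_lt_trans; apply; rewrite !sumr_const !card_ord -mulrnA.
rewrite (_ : (d + d) *+ (n * n) = e * (n * n)%:R / (n * n).+1%:R); last first.
  by rewrite -mulr_natr /d; field; rewrite gt_eqF.
by rewrite ltr_pdivrMr// ltr_pM2l// ltr_nat.
Qed.

End MatrixLimits.

(** * Density of the Hecke algebra and completeness of [ell1] *)

Section Ell1Completeness.
Variables (R : realType) (n : nat) (Gs : topGroupType) (Hs : set Gs).
Variable sigmas : Gs -> 'M[R[i]]_n.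
Variables (mu : {measure set (borel Gs) -> \bar R}) (Delta : Gs -> R).
Hypothesis cot : compact_open_triple Hs sigmas.
Hypothesis haar : haar_measure mu.
Hypothesis muH : mu Hs = 1%E.
Hypothesis modD : modular_function mu Delta.
Implicit Types (f g F : Gs -> 'M[R[i]]_n).

Let tS := cot_triple cot.
Let sHs := triple_subgroup tS.
Let C := left_cosets [set: Gs] Hs.
Local Notation biequiv := (biequivariant Hs sigmas).
Local Notation N := (mnormint mu).
Local Notation hecke := (hecke_alg Hs sigmas).
Local Notation ell1 := (ell1 Hs sigmas mu).
Local Notation nrm F := (fine (N F)).

Lemma nrmE F : ell1 F -> (nrm F)%:E = N F.
Proof. by move=> eF; rewrite fineK//; exact: (normint_fin eF). Qed.

Lemma nrm_ge0 F : 0 <= nrm F.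
Proof. by rewrite fine_ge0// mnormint_ge0. Qed.

Let biequiv_sub f g : biequiv f -> biequiv g -> biequiv (f - g).
Proof. by move=> bf bg; rewrite addrC -scaleN1r; exact: (biequiv_lin (-1) bg bf). Qed.

(** Truncating to the double cosets generated by [X], rather than to [X], preserves biequivariance.
    The norm is additive because [f] and [F - f] have disjoint supports. *)
Lemma normint_truncation F (X : set (set Gs)) : biequiv F -> finite_set X -> X `<=` C ->
  exists f, [/\ hecke f, (\sum_(A \in X) (opnorm (F (coset_repr A)))%:E <= N f)%E &
     (N F = N f + N (F - f)%R)%E].
Proof.
move=> bF fX XC.
pose D := [set x | exists2 A, A \in finmap.enum_fset (fset_set X) & dcoset Hs (coset_repr A) Hs x].
have DE h x k : Hs h -> Hs k -> D x -> D (h * x * k)%g.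
  move=> Hh Hk [A AX [a [b [Ha Hb ->]]]]; exists A => //.
  exists (h * a)%g, (b * k)%g; split; [exact: (subgroupM sHs)|exact: (subgroupM sHs)|].
  by rewrite !mulgA.
have DE' h x k : Hs h -> Hs k -> D (h * x * k)%g -> D x.
  move=> Hh Hk /(DE h^-1%g _ k^-1%g (subgroupV sHs Hh) (subgroupV sHs Hk)).
  by rewrite !mulgA mulVg mul1g mulgK.
pose f x := if x \in D then F x else 0.
have fin x : D x -> f x = F x by move=> Dx; rewrite /f ifT// inE.
have fout x : ~ D x -> f x = 0 by move=> Dx; rewrite /f ifF//; apply: negbTE; rewrite notin_setE.
have bf : biequiv f.
  move=> h x k Hh Hk; have [Dx|Dx] := pselect (D x).
    by rewrite !fin//; [exact: bF|exact: DE].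
  rewrite (fout x Dx) fout; first by rewrite mulmx0 mul0mx.
  by move=> /(DE' _ _ _ Hh Hk).
have hf : hecke f.
  apply/(hecke_algP tS); split; first exact: bf.
  apply: (@fincovS _ D).
    by move=> x /=; apply: contraPP => /fout ->; rewrite eqxx.
  by apply: fincov_bigcup => A _; exact: (fincov_dcoset tS).
exists f; split; first exact: hf.
  rewrite (biequiv_normint cot haar muH bf); apply: esum_ge; exists X; first by split.
  rewrite le_eqVlt; apply/orP; left; apply/eqP; apply: eq_fsbigr => A; rewrite inE => XA.
  rewrite fin//; exists A; first by rewrite in_fset_set// inE.
  exact: (dcoset_in tS).
have bFf := biequiv_sub bF bf.
rewrite (biequiv_normint cot haar muH bF) (biequiv_normint cot haar muH bf).
rewrite (biequiv_normint cot haar muH bFf) -esumD; last 2 first.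
- by move=> A _; rewrite lee_fin opnorm_ge0.
- by move=> A _; rewrite lee_fin opnorm_ge0.
apply: eq_esum => A _; set x := coset_repr A.
rewrite -EFinD; congr EFin; rewrite -[(F - f) x]/(F x - f x).
have [Dx|Dx] := pselect (D x); first by rewrite (fin x Dx) subrr opnorm0 addr0.
by rewrite (fout x Dx) subr0 opnorm0 add0r.
Qed.

Lemma hecke_dense F e : ell1 F -> 0 < e -> exists2 f, hecke f & nrm (F - f) < e.
Proof.
move=> eF e0; have NF := normint_fin eF.
have NE := biequiv_normint cot haar muH eF.1.
rewrite NE in NF.
(* Finitely many cosets carry all but [e] of the norm; additivity then leaves less than [e] for
   [F - f]. *)
have [_ [X [fX XC] <-]] := ub_ereal_sup_adherent e0 NF.
rewrite -/(esum _ _) -NE => lt.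
have [f [hf le NFE]] := normint_truncation eF.1 fX XC.
exists f => //; have ef := hecke_ell1 cot haar muH hf.
have eFf : ell1 (F - f).
  by rewrite addrC -scaleN1r; exact: (ell1_lin cot (-1) ef eF).
have key : nrm f + nrm (F - f) - e < nrm f.
  have := lt_le_trans lt le; rewrite NFE -(nrmE ef) -(nrmE eFf) -EFinN -!EFinD lte_fin.
  exact: id.
by rewrite ltrBlDr ltrD2l in key.
Qed.

Lemma ell1_sub f g : ell1 f -> ell1 g -> ell1 (f - g).
Proof. by move=> ef eg; rewrite addrC -scaleN1r; exact: (ell1_lin cot (-1) eg ef). Qed.

Lemma opnorm_le_nrm F x : ell1 F -> opnorm (F x) <= nrm F.
Proof. by move=> eF; rewrite -lee_fin (nrmE eF); exact: (opnorm_le_normint cot haar muH x eF.1). Qed.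

Lemma ell1_bounded_sums F (c : R) : biequiv F ->
  (forall X, finite_set X -> X `<=` C -> \sum_(A \in X) opnorm (F (coset_repr A)) <= c) ->
  ell1 F /\ nrm F <= c.
Proof.
move=> bF h; have le : (N F <= c%:E)%E.
  rewrite (biequiv_normint cot haar muH bF); apply: ge_ereal_sup => _ [X [fX XC] <-].
  by rewrite (fsumEFin _ fX) lee_fin; exact: h.
have eF : ell1 F by split; [exact: bF|exact: (le_lt_trans le (ltry _))].
by split; [exact: eF|rewrite -lee_fin (nrmE eF)].
Qed.

Lemma ell1_finite_sum F X : ell1 F -> finite_set X -> X `<=` C ->
  \sum_(A \in X) opnorm (F (coset_repr A)) <= nrm F.
Proof.
move=> eF fX XC; rewrite -lee_fin (nrmE eF) (biequiv_normint cot haar muH eF.1).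
by apply: esum_ge; exists X; [split|rewrite -(fsumEFin _ fX)].
Qed.

(** Domination of the supremum norm yields a pointwise limit at every point. Convergence in norm is
    then checked on finite sets of cosets, in the manner of Fatou's lemma. *)
Lemma ell1_complete (u : nat -> Gs -> 'M[R[i]]_n) : (forall m, ell1 (u m)) ->
  (forall e, 0 < e -> exists M, forall m k, (M <= m)%N -> (M <= k)%N -> nrm (u m - u k) < e) ->
  exists2 F, ell1 F & forall e, 0 < e -> exists M, forall m, (M <= m)%N -> nrm (F - u m) < e.
Proof.
move=> eu cu.
have ex x : exists l, forall e, 0 < e -> exists M, forall m, (M <= m)%N -> opnorm (l - u m x) < e.
  apply: opnorm_cauchy_lim => e /cu[M hM]; exists M => m k Mm Mk.
  exact: (le_lt_trans (opnorm_le_nrm x (ell1_sub (eu m) (eu k))) (hM m k Mm Mk)).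
have [F hF] := choice ex.
have bF : biequiv F.
  move=> h x k Hh Hk; apply/eqP; rewrite -subr_eq0; apply/eqP; apply: opnorm_eq0.
  apply/eqP; rewrite eq_le opnorm_ge0 andbT; apply/ler_addgt0Pr => e e0; rewrite add0r.
  have e2 : 0 < e / 2 by rewrite divr_gt0.
  have [M1 h1] := hF (h * x * k)%g _ e2; have [M2 h2] := hF x _ e2.
  have l1 := h1 _ (leq_maxl M1 M2); have l2 := h2 _ (leq_maxr M1 M2).
  set m := maxn M1 M2 in l1 l2.
  have -> : F (h * x * k)%g - sigmas h *m F x *m sigmas k =
     (F (h * x * k)%g - u m (h * x * k)%g) + sigmas h *m (- (F x - u m x)) *m sigmas k.
    rewrite (eu m).1// opprB mulmxBr mulmxBl [in RHS]addrA subrK; by [].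
  apply: le_trans (opnormD _ _) _.
  have E := opnorm_unitary_mul (- (F x - u m x)) (triple_unitary tS Hh) (triple_unitary tS Hk).
  have E' := opnormN (F x - u m x).
  rewrite E E' [e]splitr; exact: (lerD (ltW l1) (ltW l2)).
have tail e : 0 < e -> exists M, forall m, (M <= m)%N -> ell1 (F - u m) /\ nrm (F - u m) <= e.
  move=> e0; have [M hM] := cu e e0; exists M => m Mm.
  apply: ell1_bounded_sums; first exact: (biequiv_sub bF (eu m).1).
  move=> X fX XC; apply/ler_addgt0Pr => d d0.
  (* An index [k] beyond [M] is chosen with [u k] within [d / c] of [F] at every representative from
     [X]; the total deviation is then at most [d]. The successor covers an empty [X]. *)
  pose c := (#|` fset_set X|%fset).+1; have c0 : 0 < c%:R :> R by rewrite ltr0n.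
  have dc : 0 < d / c%:R by rewrite divr_gt0.
  have [K hK] := choice (fun A : set Gs => hF (coset_repr A) _ dc).
  pose k := maxn M (\max_(A <- finmap.enum_fset (fset_set X)) K A).
  have Mk : (M <= k)%N by exact: leq_maxl.
  rewrite fsbig_finite//.
  apply: (@le_trans _ _ (\sum_(A <- finmap.enum_fset (fset_set X))
      (opnorm ((u k - u m) (coset_repr A)) + d / c%:R))).
    rewrite big_seq [leRHS]big_seq; apply: ler_sum => A AX.
    have Kk : (K A <= k)%N.
      apply: leq_trans (leq_maxr _ _); rewrite (big_rem A)//=; exact: leq_maxl.
    have := hK A _ Kk; set x := coset_repr A => hx.
    rewrite -[(F - u m) x]/(F x - u m x) -[(u k - u m) x]/(u k x - u m x).
    have -> : F x - u m x = (u k x - u m x) + (F x - u k x) by rewrite [RHS]addrC addrA subrK.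
    apply: (le_trans (opnormD (u k x - u m x) (F x - u k x))).
    exact: (lerD (lexx _) (ltW hx)).
  rewrite big_split /=; apply: lerD.
    rewrite -fsbig_finite//; apply: le_trans (ltW (hM k m Mk Mm)).
    exact: (ell1_finite_sum (ell1_sub (eu k) (eu m)) fX XC).
  rewrite big_const_seq count_predT iter_addr_0 -[leLHS]mulr_natl mulrCA.
  by rewrite ger_pMr// ler_pdivrMr// mul1r ler_nat /c leqW.
exists F; last first.
  move=> e e0; have e2 : 0 < e / 2 by rewrite divr_gt0.
  by have [M hM] := tail _ e2; exists M => m /hM[_]; lra.
have [M hM] := tail 1 ltr01; have [e1 _] := hM M (leqnn _).
have -> : F = 1 *: u M + (F - u M) by rewrite scale1r addrC subrK.
exact: (ell1_lin cot 1 (eu M) e1).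
Qed.

Lemma ell1_nsa : normed_star_algebra ell1 (convol mu) (grp_inv Delta) (fun F => nrm F).
Proof.
have e0 : ell1 0.
  split; last by rewrite normint0 ltry.
  by move=> h x k _ _; rewrite -[RHS]/(sigmas h *m 0 *m sigmas k) mulmx0 mul0mx.
split.
- split; [exact: e0|by move=> a f g; exact: (ell1_lin cot a)|
    by move=> f g; exact: (ell1_convol cot haar muH)|by move=> f; exact: (ell1_star cot haar muH modD)].
- by move=> f _; exact: nrm_ge0.
- by rewrite normint0.
- move=> a f g ef eg; have := normint_lin cot a ef eg.
  by rewrite -(nrmE ef) -(nrmE eg) -(nrmE (ell1_lin cot a ef eg)) -EFinM -EFinD lee_fin.
- move=> a f g h ef eg eh.
  by apply: convol_linl => x; exact: (ell1_convolvable cot haar muH).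
- move=> a f g h ef eg eh.
  by apply: convol_linr => x; exact: (ell1_convolvable cot haar muH).
- move=> f g ef eg; have := normint_convol cot haar muH ef eg.
  by rewrite -(nrmE ef) -(nrmE eg) -(nrmE (ell1_convol cot haar muH ef eg)) -EFinM lee_fin.
- move=> a f g ef eg; apply/funext => x.
  rewrite /grp_inv -[RHS]/(a^*%C *: ((Delta x^-1%g)%:C *: (f x^-1%g)^t*) + (Delta x^-1%g)%:C *: (g x^-1%g)^t*).
  by rewrite -[(a *: f + g) x^-1%g]/(a *: f x^-1%g + g x^-1%g) adjmxD adjmxZ scalerDr !scalerA mulrC.
- by move=> f ef; rewrite (normint_star cot haar muH modD ef).
- exact: ell1_complete.
Qed.

End Ell1Completeness.

Section BanachStarAlgebra.
Variables (R : realType) (L : completeNormedModType R[i]).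
Variables (mulL : L -> L -> L) (starL : L -> L).
Hypothesis bL : banach_star_algebra mulL starL.

(** The norm of a module over [R[i]] takes complex values; they are real, so the real part loses
    nothing. *)
Definition rnorm (x : L) : R := complex.Re `|x|.

Lemma rnormE x : (rnorm x)%:C = `|x|.
Proof. by rewrite /rnorm RRe_real// ger0_real. Qed.

Lemma rnorm_lim (u : nat -> L) :
  (forall e, 0 < e -> exists M, forall m k, (M <= m)%N -> (M <= k)%N -> rnorm (u m - u k) < e) ->
  exists2 F, [set: L] F & forall e, 0 < e -> exists M, forall m, (M <= m)%N -> rnorm (F - u m) < e.
Proof.
move=> cu; have /cvg_ex[l ul] : cvg (u @ \oo).
  apply: cauchy_cvg; apply: cauchy_exP => e e0.
  (* A positive element of [R[i]] is real, so balls with complex radii reduce to real tolerances. *)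
  have [er eE] : 0 < complex.Re e /\ e = (complex.Re e)%:C.
    have eE : e = (complex.Re e)%:C by rewrite RRe_real// gtr0_real.
    by split; rewrite // -ltcR -eE.
  have [M hM] := cu _ er; exists (u M); exists M => // m /= Mm.
  by rewrite -ball_normE /ball_ /= eE -rnormE ltcR; exact: hM.
exists l => // e e0; have e0C : 0 < e%:C by rewrite ltcR.
have /cvgrPdist_lt/(_ _ e0C)[M _ hM] := ul.
by exists M => m Mm; rewrite -ltcR rnormE; exact: hM.
Qed.

Lemma banach_nsa : normed_star_algebra [set: L] mulL starL rnorm.
Proof.
split=> //.
- by move=> f _; rewrite -lecR rnormE; exact: normr_ge0.
- by rewrite /rnorm normr0.
- move=> a f g _ _; rewrite -lecR rmorphD rmorphM /= !rnormE Re_normE.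
  by rewrite -normrZ; exact: ler_normD.
- by move=> a f g h _ _ _; exact: (bsa_linl bL).
- by move=> a f g h _ _ _; exact: (bsa_linr bL).
- by move=> f g _ _; rewrite -lecR rmorphM /= !rnormE; exact: (bsa_submul bL).
- by move=> a f g _ _; exact: (bsa_conj bL).
- by move=> f _; rewrite /rnorm (bsa_isom bL).
- by move=> u _; exact: rnorm_lim.
Qed.

End BanachStarAlgebra.

(** * The isomorphism between [p L^1 p] and the completion *)

Section CornerIsomorphism.
Variables (R : realType) (n : nat) (Gs : topGroupType) (Hs : set Gs).
Variable sigmas : Gs -> 'M[R[i]]_n.
Variables (mu : {measure set (borel Gs) -> \bar R}) (Delta : Gs -> R).
Hypothesis cot : compact_open_triple Hs sigmas.
Hypothesis haar : haar_measure mu.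
Hypothesis muH : mu Hs = 1%E.
Hypothesis modD : modular_function mu Delta.
Implicit Types (f g F : Gs -> 'M[R[i]]_n).

Let C := left_cosets [set: Gs] Hs.
Let p := proj_fun Hs sigmas.
Local Notation N := (mnormint mu).
Local Notation hecke := (hecke_alg Hs sigmas).
Local Notation ell1 := (ell1 Hs sigmas mu).
Local Notation P f := (convol mu (convol mu p f) p).

Variables (G : groupType) (H : set G) (sigma : G -> 'M[R[i]]_n).
Variable phi : (Gs -> 'M[R[i]]_n) -> (G -> 'M[R[i]]_n).
Hypothesis heckeC : star_closed hecke (convol mu) (grp_inv Delta).
Hypothesis phi_bij : set_bij hecke (hecke_alg H sigma) phi.
Hypothesis phi_hom : star_hom hecke (convol mu) (grp_inv Delta)
  (hecke_conv H) (hecke_inv H sigma) phi.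
Hypothesis phi_norm : forall f, hecke f -> hecke_norm1 H (phi f) = hecke_norm1 Hs f.

Lemma corner_L1_isomorphism (L : completeNormedModType R[i])
    (mulL : L -> L -> L) (starL : L -> L) (j : (G -> 'M[R[i]]_n) -> L) :
  l1_completion H sigma mulL starL j ->
  exists psi : (Gs -> 'M[R[i]]_n) -> L,
    [/\ star_hom (corner_L1 mu p) (convol mu) (grp_inv Delta) mulL starL psi,
        psi @` corner_L1 mu p = setT,
        forall f g, corner_L1 mu p f -> corner_L1 mu p g ->
          (psi f = psi g <-> ae_equal mu f g) &
        forall f, corner_L1 mu p f -> `|psi f| = (L1norm mu f)%:C].
Proof.
move=> lL; have nE := ell1_nsa cot haar muH modD; have nL := banach_nsa (l1_banach lL).
have phiH f : hecke f -> hecke_alg H sigma (phi f) by case: phi_bij => h _ _; exact: h.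
have jE f : hecke f -> rnorm (j (phi f)) = fine (N f).
  move=> hf; rewrite (hecke_normint cot haar muH hf) /= -(phi_norm hf).
  by rewrite /rnorm (l1_isometric lL (phiH f hf)).
have jh : star_hom hecke (convol mu) (grp_inv Delta) mulL starL (fun f => j (phi f)).
  have [h1 h2 h3] := phi_hom; have [g1 g2 g3] := l1_hom lL.
  by split=> [a f g hf hg|f g hf hg|f hf]; rewrite ?h1 ?h2 ?h3 ?g1 ?g2 ?g3//; exact: phiH.
have Ld l e : [set: L] l -> 0 < e -> exists2 f, hecke f & rnorm (l - j (phi f)) < e.
  move=> _ e0; have e0C : 0 < e%:C by rewrite ltcR.
  have B : nbhs l (ball l e%:C) by exact: nbhsx_ballx.
  have ne : (ball l e%:C)° !=set0 by exists l; exact: B.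
  have [z [Bx [g hg gx]]] := l1_dense lL ne (@open_interior _ _).
  rewrite -gx in Bx; have [_ _ /(_ g hg)[f hf fg]] := phi_bij.
  exists f; first exact: hf.
  rewrite fg -ltcR rnormE; have := interior_subset Bx; rewrite -ball_normE /ball_ /=; exact: id.
have w0 (w : L) : [set: L] w -> rnorm w = 0 -> w = 0.
  by move=> _ w0; apply/normr0_eq0; rewrite -rnormE w0.
(* The dense subalgebra of [ell1] is [hecke], sent to [L] by [j] after [phi]; the target is all of
   [L]. *)
have [Psi [PsiH PsiN PsiS]] := isometric_star_extension nE nL w0 (hecke_ell1 cot haar muH) (fun _ _ => I)
   heckeC jh jE (hecke_dense cot haar muH) Ld.
have PE f F : mintegrable mu f -> ell1 F -> ae_equal mu f F -> P f = F.
  exact: (pcorner_ae cot haar muH modD).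
have cP f : corner_L1 mu p f -> exists F, [/\ mintegrable mu f, ell1 F & ae_equal mu f F].
  by move=> /(corner_L1P cot haar muH modD)[fi [F eF fF]]; exists F.
have eI F : ell1 F -> mintegrable mu F := ell1_mintegrable cot (F := F).
have [Pl Pm Ps] := PsiH.
exists (fun f => Psi (P f)); split.
- split=> [a f g /cP[F [fi eF fF]] /cP[K [gi eK gK]]|f g /cP[F [fi eF fF]] /cP[K [gi eK gK]]|f /cP[F [fi eF fF]]].
  + have [i e] := corner_lin a fi gi fF gK.
    rewrite (PE _ _ fi eF fF) (PE _ _ gi eK gK) (PE _ _ i (ell1_lin cot a eF eK) e).
    exact: Pl.
  + have eFK := ell1_convol cot haar muH eF eK.
    rewrite (convol_ae cot haar muH modD fi.1 (biequiv_mmeasurable cot eF.1) gi.1 (biequiv_mmeasurable cot eK.1) fF gK).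
    rewrite (PE _ _ fi eF fF) (PE _ _ gi eK gK) (PE _ _ (eI _ eFK) eFK (ae_equal_refl mu _)).
    exact: Pm.
  + have eS := ell1_star cot haar muH modD eF; have ae := grp_inv_ae cot haar muH modD fF.
    have mS := mmeasurable_grp_inv cot muH modD fi.1.
    have iS : mintegrable mu (grp_inv Delta f).
      split; first exact: mS.
      by rewrite (mnormint_ae mS (biequiv_mmeasurable cot eS.1) ae); exact: eS.2.
    rewrite (PE _ _ iS eS ae) (PE _ _ fi eF fF); exact: Ps.
- apply/seteqP; split=> // l _; have [F eF FE] := PsiS l I.
  exists F; last by rewrite (PE _ _ (eI _ eF) eF (ae_equal_refl mu F)).
  apply/(corner_L1P cot haar muH modD); split; first exact: (eI _ eF).
  by exists F; [exact: eF|exact: ae_equal_refl].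
- move=> f g /cP[F [fi eF fF]] /cP[K [gi eK gK]].
  rewrite (PE _ _ fi eF fF) (PE _ _ gi eK gK); split=> [e|fg].
    suff FK : F = K.
      by apply: (ae_equal_trans fF); rewrite FK; exact: ae_equal_sym gK.
    have eFK := ell1_lin cot (-1) eK eF.
    (* [Psi] is isometric on [ell1] and sends [F - K] to zero. *)
    have nFK : fine (N ((-1) *: K + F)%R) = 0.
      have [_ <-] := PsiN _ eFK; rewrite (Pl (-1) K F eK eF) e scaleN1r addNr.
      by rewrite /rnorm normr0.
    have zFK : N ((-1) *: K + F)%R = 0%E by rewrite -(nrmE eFK) nFK.
    have := normint_eq0 cot haar muH eFK.1 zFK => /eqP.
    by rewrite scaleN1r addrC subr_eq0 => /eqP.
  congr Psi; apply: (biequiv_ae_eq cot haar muH eF.1 eK.1).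
  exact: (ae_equal_trans (ae_equal_sym fF) (ae_equal_trans fg gK)).
- move=> f /cP[F [fi eF fF]]; rewrite (PE _ _ fi eF fF).
  have [_ nF] := PsiN F eF; apply: (etrans (esym (rnormE (Psi F)))).
  have E := mnormint_ae fi.1 (biequiv_mmeasurable cot eF.1) fF.
  rewrite /L1norm /Rintegral -/(mnormint mu f) E nF.
  exact: erefl.
Qed.

End CornerIsomorphism.

(** * Restriction along the completion map *)

Section CosetCorrespondence.
Variables (G Gs : groupType) (iota : G -> Gs).
Hypothesis iotaM : forall x y, iota (x * y)%g = (iota x * iota y)%g.

Let iotaV x : iota x^-1%g = (iota x)^-1%g.
Proof.
have iota1 : iota 1%g = 1%g by apply: (@mulgI _ (iota 1%g)); rewrite -iotaM !mulg1.
by apply: (@mulgI _ (iota x)); rewrite -iotaM !mulgV.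
Qed.

Variables (A B : set G) (As Bs : set Gs).
Hypotheses (sB : subgroup B) (sBs : subgroup Bs).
Hypotheses (AE : iota @^-1` As = A) (BE : iota @^-1` Bs = B).
Hypothesis dec : forall y, As y -> exists2 a, A a & Bs ((iota a)^-1 * y)%g.

Let iotaB x y : Bs ((iota x)^-1 * iota y)%g = B (x^-1 * y)%g.
Proof. by rewrite -BE /= iotaM iotaV. Qed.

Let preim_lcoset a : iota @^-1` (ltrans (iota a) Bs) = ltrans a B.
Proof. by rewrite !ltransE; apply/seteqP; split=> x /=; rewrite iotaB. Qed.

Let lcoset_iota L : left_cosets As Bs L -> exists2 a, A a & L = ltrans (iota a) Bs.
Proof.
move=> [y Ay <-]; have [a Aa By] := dec Ay; exists a => //.
by apply/esym/(lcoset_eqP _ _ sBs).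
Qed.

(** By [dec] every coset is that of some [iota a], and its preimage is [a B]. The statement serves
    both for [Gs/Hs] and for the indices in the modular function. *)
Lemma lcosets_bij : set_bij (left_cosets As Bs) (left_cosets A B) (fun L => iota @^-1` L).
Proof.
split.
- by move=> L /lcoset_iota[a Aa ->]; rewrite /= preim_lcoset; exists a.
- move=> L L'; rewrite !inE => /lcoset_iota[a Aa ->] /lcoset_iota[b Ab ->].
  by rewrite !preim_lcoset => /(lcoset_eqP _ _ sB) Bab; apply/(lcoset_eqP _ _ sBs); rewrite iotaB.
- move=> _ [a Aa <-]; exists (ltrans (iota a) Bs); last exact: preim_lcoset.
  by exists (iota a) => //; rewrite -AE in Aa.
Qed.

Lemma subgroup_index_iota : finite_set (left_cosets A B) ->
  subgroup_index As Bs = subgroup_index A B.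
Proof.
move=> /finite_setP[k Ak]; rewrite /subgroup_index (card_fset_set Ak); apply: card_fset_set.
apply: (card_eq_trans _ Ak); apply/card_set_bijP; exists (fun L => iota @^-1` L).
exact: lcosets_bij.
Qed.

End CosetCorrespondence.

(** * The isomorphism of Hecke algebras *)

Section HeckeTransfer.
Variables (R : realType) (n : nat) (G : groupType) (H : set G).
Variable sigma : G -> 'M[R[i]]_n.
Variables (Gs : topGroupType) (iota : G -> Gs) (Hs : set Gs).
Variable sigmas : Gs -> 'M[R[i]]_n.
Hypothesis tH : hecke_triple H sigma.
Hypothesis sc : schlichting_completion H sigma iota Hs sigmas.

Let K := rep_ker H sigma.
Let Ks := rep_ker Hs sigmas.
Let sH := triple_subgroup tH.
Let cG := schlichting_group sc.
Let cot := schlichting_cot tH sc.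
Let tS := cot_triple cot.
Let sHs := triple_subgroup tS.
Let oHs := cot_open cot.
Let iotaM := completion_morph cG.
Let iotaV := iotaV cG.
Let HE : iota @^-1` Hs = H := schlichting_iotaE tH sc.
Let sK : subgroup K := rep_ker_subgroup tH.
Let sKs : subgroup Ks := rep_ker_subgroup tS.
Let oKs : open Ks := cot_ker_open cot.

Let iotaH x : Hs (iota x) = H x.
Proof. by rewrite -HE. Qed.

Let sigE h : H h -> sigmas (iota h) = sigma h.
Proof. exact: (schlichting_extends sc). Qed.

Let KE : iota @^-1` Ks = K.
Proof.
apply/seteqP; split=> x /= [Hx sx].
  by rewrite iotaH in Hx; split=> //; rewrite -sigE.
by split; rewrite /= ?iotaH// sigE.
Qed.

Lemma schlichting_lcoset y : exists x, Hs ((iota x)^-1 * y)%g.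
Proof.
have B : nbhs y (ltrans y Hs) by apply: ltrans_nbhs => //; exact: (subgroup1 sHs).
have [x] := iota_dense cG B; rewrite ltransE /= => Hx; exists x.
by have := subgroupV sHs Hx; rewrite invgM invgK.
Qed.

Lemma lcosets_iota_bij : set_bij (left_cosets setT Hs) (left_cosets setT H) (fun L => iota @^-1` L).
Proof.
apply: (lcosets_bij iotaM sH sHs) => // y _.
by have [x Hx] := schlichting_lcoset y; exists x.
Qed.

Lemma sum_lcosets_iota (X : zmodType) (Psi : Gs -> X) :
  (forall x h, Hs h -> Psi (x * h)%g = Psi x) ->
  \sum_(A \in left_cosets setT H) Psi (iota (coset_repr A)) =
  \sum_(A \in left_cosets setT Hs) Psi (coset_repr A).
Proof.
move=> PH; rewrite (reindex_fsbig (fun L => iota @^-1` L) _ _ _ lcosets_iota_bij).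
apply: eq_fsbigr => L; rewrite inE => CL.
have [LE Lr] := lcoset_repr sHs CL; set y := coset_repr L in LE Lr *.
have [x Hx] := schlichting_lcoset y.
(* Representatives of [L] and of its preimage are chosen independently; they lie in the same coset,
   on which [Psi] is constant. *)
have : L (iota (coset_repr (iota @^-1` L))).
  apply: (@coset_repr_in _ (iota @^-1` L)); exists x; rewrite /= LE ltransE /=.
  by have := subgroupV sHs Hx; rewrite invgM invgK.
by rewrite {1}LE ltransE /= => Hr; rewrite -[in LHS](mulVKg y (iota (coset_repr _))) PH.
Qed.

Lemma hecke_norm1_iota F : biequivariant Hs sigmas F ->
  hecke_norm1 H (F \o iota) = hecke_norm1 Hs F.
Proof.
move=> bF; apply: (sum_lcosets_iota (Psi := fun x => opnorm (F x))) => x h Hh.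
exact: (biequivariant_opnorm tS).
Qed.

Lemma hecke_conv_iota F F' : biequivariant Hs sigmas F -> biequivariant Hs sigmas F' ->
  hecke_conv H (F \o iota) (F' \o iota) = hecke_conv Hs F F' \o iota.
Proof.
move=> bF bF'; apply/funext => x; rewrite /hecke_conv /=.
rewrite -(sum_lcosets_iota (Psi := fun y => F y *m F' (y^-1 * iota x)%g)).
  by apply: eq_fsbigr => A _; rewrite iotaM iotaV.
move=> y h Hh; rewrite (biequivariantr tS _ bF Hh) (biequiv_div cot _ _ bF' Hh).
rewrite -mulmxA [sigmas h *m _]mulmxA -(invmx_unitary (triple_unitary tS Hh)).
by rewrite mulmxV ?mul1mx//; exact: (triple_unit tS).
Qed.

Lemma hecke_modular_iota x : hecke_modular Hs sigmas (iota x) = hecke_modular H sigma x.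
Proof.
have idx y : subgroup_index Ks (Ks `&` conjset (iota y) Ks) = subgroup_index K (K `&` conjset y K).
  have sM : subgroup (K `&` conjset y K) by apply: subgroupI => //; exact: subgroup_conjset.
  have sMs : subgroup (Ks `&` conjset (iota y) Ks) by apply: subgroupI => //; exact: subgroup_conjset.
  have oMs : open (Ks `&` conjset (iota y) Ks) by apply: openI => //; exact: open_conjset.
  apply: (subgroup_index_iota iotaM sM sMs KE).
  - by rewrite -KE !conjsetE; apply/seteqP; split=> z /=; rewrite !iotaM iotaV.
  (* [Ks] is the closure of the image of [K], so each of its cosets modulo the open subgroup
     contains an element of that image. *)
  - move=> z Kz'; have Kz : closure (iota @` K) z by rewrite -(schlichting_rep_ker tH sc).
    by have [_ [a Ka <-] Ma] := closure_decomp sMs oMs Kz; exists a.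
  - apply/(fincov_left_cosets _ sM); apply: fincovI => //; first exact: subgroup_conjset.
      by exists [:: 1%g] => a Ka; exists 1%g; rewrite ?mem_head// invg1 mul1g.
    apply: fincovS (@rep_ker_sub _ _ _ H sigma) _.
    exact: (fincov_conj_rep_ker tH).
by rewrite /hecke_modular -/Ks -/K -iotaV !idx.
Qed.

Lemma hecke_inv_iota F : hecke_inv H sigma (F \o iota) = hecke_inv Hs sigmas F \o iota.
Proof.
by apply/funext => x; rewrite /hecke_inv /= -hecke_modular_iota iotaV.
Qed.

Lemma hecke_alg_iota F : hecke_alg Hs sigmas F -> hecke_alg H sigma (F \o iota).
Proof.
move=> /(hecke_algP tS)[bF [s Hs_s]]; apply/(hecke_algP tH); split.
  move=> h x k Hh Hk; rewrite /= !iotaM bF ?iotaH//.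
  by rewrite !sigE.
have [g Hg] := choice schlichting_lcoset.
exists [seq g c | c <- s] => x /= Fx; have [c cs Hc] := Hs_s _ Fx.
exists (g c); first exact: map_f.
rewrite -iotaH iotaM iotaV -(mulVKg c (iota x)) mulgA.
exact: (subgroupM sHs (Hg c) Hc).
Qed.

Lemma hecke_iota_inj F F' : biequivariant Hs sigmas F -> biequivariant Hs sigmas F' ->
  F \o iota = F' \o iota -> F = F'.
Proof.
move=> bF bF' e; apply/funext => y; have [x Hx] := schlichting_lcoset y.
rewrite -(mulVKg (iota x) y) (biequivariantr tS _ bF Hx) (biequivariantr tS _ bF' Hx).
by rewrite -[F (iota x)]/((F \o iota) x) e.
Qed.

Lemma hecke_iota_surj g : hecke_alg H sigma g ->
  exists2 F, hecke_alg Hs sigmas F & F \o iota = g.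
Proof.
move=> /(hecke_algP tH)[bg [s Hs_s]]; have [r Hr] := choice schlichting_lcoset.
(* The value at y may be read off at any x with y in iota x Hs; for the left
   equivariance, x is adjusted by means of Ks :&: iota x Ks (iota x)^-1. *)
pose F y := g (r y) *m sigmas ((iota (r y))^-1 * y)%g.
have FE x y : Hs ((iota x)^-1 * y)%g -> F y = g x *m sigmas ((iota x)^-1 * y)%g.
  move=> Hx; pose h := (x^-1 * r y)%g.
  have Hh : H h.
    rewrite -iotaH /h iotaM iotaV -(mulVKg y (iota (r y))) mulgA.
    apply: (subgroupM sHs Hx); rewrite -(subgroup_invE _ sHs) invgM invgK; exact: Hr.
  rewrite /F -(mulVKg x (r y)) -/h (biequivariantr tH _ bg Hh) -mulmxA -(sigE Hh).
  have Hhy : Hs ((iota (x * h)%g)^-1 * y)%g by rewrite /h mulVKg; exact: Hr.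
  rewrite -(triple_morph tS _ Hhy); last by rewrite iotaH.
  by rewrite iotaM invgM !mulgA mulgV mul1g.
have FEr y : F y = g (r y) *m sigmas ((iota (r y))^-1 * y)%g by [].
exists F; last first.
  apply/funext => x; rewrite /= (FE x) mulVg; last exact: (subgroup1 sHs).
  by rewrite (triple_sigma1 tS) mulmx1.
apply/(hecke_algP tS); split; last first.
  exists [seq iota c | c <- s] => y /= Fy.
  have [|c cs Hc] := Hs_s (r y).
    by apply: contra Fy => /eqP; rewrite FEr => ->; rewrite mul0mx.
  exists (iota c); first exact: map_f.
  rewrite -(mulVKg (iota (r y)) y) mulgA; apply: (subgroupM sHs _ (Hr y)).
  by rewrite -iotaV -iotaM iotaH.
apply: biequivariantP => [h y Hh|y k Hk]; last first.
  have Hk' : Hs ((iota (r y))^-1 * (y * k))%g by rewrite mulgA; exact: (subgroupM sHs (Hr y) Hk).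
  by rewrite (FE _ _ Hk') FEr mulgA (triple_morph tS (Hr y) Hk) mulmxA.
set x := r y; set w := ((iota x)^-1 * y)%g; have Hw : Hs w := Hr y.
pose L := Ks `&` conjset (iota x) Ks.
have sL : subgroup L by apply: subgroupI => //; exact: subgroup_conjset.
have oL : open L by apply: openI => //; exact: open_conjset.
(* The remainder [l] of [h] acts trivially on the left, and so does its conjugate [l'] obtained by
   moving it across [iota x]. *)
have [h0 Hh0] := schlichting_decomp sc sL oL Hh.
set l := ((iota h0)^-1 * h)%g => -[[Hl sl]]; rewrite conjsetE => -[]; set l' := (_ * _ * _)%g => Hl' sl'.
have hE : h = (iota h0 * l)%g by rewrite /l mulVKg.
have E : ((iota (h0 * x)%g)^-1 * (h * y))%g = (l' * w)%g.
  by rewrite /l' /l /w iotaM invgM !mulgA mulgK.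
have Hlw : Hs (l' * w)%g := subgroupM sHs Hl' Hw.
rewrite (FE (h0 * x)%g); last by rewrite E.
rewrite E (triple_morph tS Hl' Hw) sl' mul1mx (biequivariantl tH _ bg Hh0) FEr -mulmxA.
rewrite hE (triple_morph tS _ Hl) ?iotaH// sl mulmx1 sigE//.
Qed.

Lemma hecke_iota_bij : set_bij (hecke_alg Hs sigmas) (hecke_alg H sigma) (fun F => F \o iota).
Proof.
split; first exact: hecke_alg_iota.
- by move=> F F'; rewrite !inE => -[_ bF] [_ bF'] /(hecke_iota_inj bF bF').
- by move=> g /hecke_iota_surj[F hF <-]; exists F.
Qed.

Variables (mu : {measure set (borel Gs) -> \bar R}) (Delta : Gs -> R).
Hypothesis haar : haar_measure mu.
Hypothesis muH : mu Hs = 1%E.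
Hypothesis modD : modular_function mu Delta.
Local Notation hecke := (hecke_alg Hs sigmas).

Lemma hecke_star_closed : star_closed hecke (convol mu) (grp_inv Delta).
Proof.
have hP := hecke_algP tS.
split.
- apply/hP; split; last by exists [::] => x /=; rewrite eqxx.
  by move=> h x k _ _; rewrite -[RHS]/(sigmas h *m 0 *m sigmas k) mulmx0 mul0mx.
- move=> a f g /hP[bf [s fs]] /hP[bg [t gt]]; apply/hP; split; first exact: biequiv_lin.
  exists (s ++ t) => x; rewrite /= -[(a *: f + g) x]/(a *: f x + g x) => fg.
  have [fx|fx] := eqVneq (f x) 0.
    rewrite fx scaler0 add0r in fg; have [c ct Hc] := gt _ fg.
    by exists c; rewrite // mem_cat ct orbT.
  by have [c cs Hc] := fs _ fx; exists c; rewrite // mem_cat cs.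
- move=> f g hf hg; have ef := hecke_ell1 cot haar muH hf; have eg := hecke_ell1 cot haar muH hg.
  have [_ [s fs]] := (hP f).1 hf; have [bg [t gt]] := (hP g).1 hg.
  apply/hP; split; first exact: (ell1_convol cot haar muH ef eg).1.
  exists [seq (c * d)%g | c <- s, d <- t] => x /=; rewrite convolE => /mint_neq0[y fgy].
  have fy : f y != 0 by apply: contra fgy => /eqP ->; rewrite mul0mx.
  have gy : g (y^-1 * x)%g != 0 by apply: contra fgy => /eqP ->; rewrite mulmx0.
  have [c cs Hc] := fs _ fy.
  (* [c^-1 * x] differs from [y^-1 * x] by the left factor [c^-1 * y] in [Hs], which acts
     invertibly; so [x] lies in some [c d Hs]. *)
  have gcx : g (c^-1 * x)%g != 0.
    rewrite -(mulVKg y x) mulgA (biequivariantl tS _ bg Hc).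
    by apply: contra gy => /eqP /(sigma_unitl tS Hc) ->.
  have [d dt Hd] := gt _ gcx; exists (c * d)%g; first by apply/allpairsP; exists (c, d).
  by rewrite invgM -mulgA.
- move=> f /hP[bf [s fs]]; apply/hP; split; first exact: (biequiv_star cot muH modD bf).
  (* Inversion turns the left cosets covering the support into right cosets, which are enclosed in
     double cosets to return to left cosets. *)
  apply: (@fincovS _ [set x | exists2 c, c \in s & dcoset Hs c^-1%g Hs x]); last first.
    by apply: fincov_bigcup => c _; exact: (fincov_dcoset tS).
  move=> x /= fx; have fV : f x^-1%g != 0.
    apply: contra fx => /eqP e; rewrite /grp_inv e.
    by apply/eqP/matrixP => k l; rewrite !mxE conjC0 mulr0.
  have [c cs Hc] := fs _ fV; exists c => //.
  exists ((c^-1 * x^-1)^-1)%g, 1%g; split; [exact: (subgroupV sHs Hc)|exact: (subgroup1 sHs)|].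
  by rewrite invgM !invgK mulgK mulg1.
Qed.

Lemma hecke_iota_hom : star_hom hecke (convol mu) (grp_inv Delta)
  (hecke_conv H) (hecke_inv H sigma) (fun F => F \o iota).
Proof.
split.
- by move=> a f g _ _; apply/funext.
- move=> f g hf hg; rewrite (hecke_convE cot haar muH hf hg).
  by rewrite (hecke_conv_iota (hecke_biequiv hf) (hecke_biequiv hg)).
- by move=> f _; rewrite (hecke_invE cot haar muH modD) hecke_inv_iota.
Qed.

(** Closure is transported from [Gs] along the bijective homomorphism, so the sums over [G/H] need
    no separate study of supports. *)
Lemma hecke_alg_star_closed : star_closed (hecke_alg H sigma) (hecke_conv H) (hecke_inv H sigma).
Proof.
have [_ l m st] := hecke_star_closed; have [hl hm hs] := hecke_iota_hom.
have [_ _ onto] := hecke_iota_bij.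
split.
- by rewrite (_ : 0 = (0 : Gs -> 'M[R[i]]_n) \o iota); [apply: hecke_alg_iota; case: hecke_star_closed|].
- move=> a _ _ /onto[f hf <-] /onto[g hg <-]; rewrite -hl//.
  by apply: hecke_alg_iota; exact: l.
- move=> _ _ /onto[f hf <-] /onto[g hg <-]; rewrite -hm//.
  by apply: hecke_alg_iota; exact: m.
- by move=> _ /onto[f hf <-]; rewrite -hs//; apply: hecke_alg_iota; exact: st.
Qed.

End HeckeTransfer.

Theorem theorem2p8 (R : realType) (n : nat) (G : groupType) (H : set G)
    (sigma : G -> 'M[R[i]]_n)
    (Gs : topGroupType) (iota : G -> Gs) (Hs : set Gs)
    (sigmas : Gs -> 'M[R[i]]_n)
    (mu : {measure set (borel Gs) -> \bar R}) (Delta : Gs -> R) :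
  hecke_triple H sigma -> reduced_triple H sigma ->
  schlichting_completion H sigma iota Hs sigmas ->
  haar_measure mu -> mu Hs = 1%E -> modular_function mu Delta ->
  let p := proj_fun Hs sigmas in
  [/\ (* p is a self-adjoint projection in C_c *)
      [/\ Cc p, grp_inv Delta p = p & convol mu p p = p],
      (* p C_c p = H_sigma(Gs, Hs) as *-algebras *)
      [/\ corner_Cc mu p = hecke_alg Hs sigmas,
          forall f g, hecke_alg Hs sigmas f -> hecke_alg Hs sigmas g ->
            convol mu f g = hecke_conv Hs f g &
          forall f, hecke_alg Hs sigmas f ->
            grp_inv Delta f = hecke_inv Hs sigmas f],
      (* p C_c p is *-isomorphic to H_sigma(G, H) *)
      [/\ star_closed (corner_Cc mu p) (convol mu) (grp_inv Delta),
          star_closed (hecke_alg H sigma) (hecke_conv H) (hecke_inv H sigma) &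
          exists phi : (Gs -> 'M[R[i]]_n) -> (G -> 'M[R[i]]_n),
            set_bij (corner_Cc mu p) (hecke_alg H sigma) phi /\
            star_hom (corner_Cc mu p) (convol mu) (grp_inv Delta)
              (hecke_conv H) (hecke_inv H sigma) phi] &
      (* p L^1 p (modulo a.e. equality) is isometrically *-isomorphic to
         l^1(G, H, sigma) *)
      star_closed (corner_L1 mu p) (convol mu) (grp_inv Delta) /\
      forall (L : completeNormedModType R[i])
             (mulL : L -> L -> L) (starL : L -> L)
             (j : (G -> 'M[R[i]]_n) -> L),
        l1_completion H sigma mulL starL j ->
        exists psi : (Gs -> 'M[R[i]]_n) -> L,
          [/\ star_hom (corner_L1 mu p) (convol mu) (grp_inv Delta)
                mulL starL psi,
              psi @` corner_L1 mu p = setT,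
              forall f g, corner_L1 mu p f -> corner_L1 mu p g ->
                (psi f = psi g <-> ae_equal mu f g) &
              forall f, corner_L1 mu p f -> `|psi f| = (L1norm mu f)%:C]].
Proof.
move=> tH rH sc haar muH modD p; have cot := schlichting_cot tH sc.
have cE := corner_Cc_hecke cot haar muH modD.
have hp := hecke_p cot; have bp := biequiv_p cot.
have hC := hecke_star_closed tH sc haar muH modD.
have hB := hecke_iota_bij tH sc.
have hH := hecke_iota_hom tH sc haar muH modD.
split.
- split; first exact: (hecke_Cc cot hp).
    exact: (grp_inv_p cot muH modD).
  by apply: (convol_pl cot muH) => h x; exact: (biequiv_l cot bp).
- split; first exact: cE.
    by move=> f g hf hg; exact: (hecke_convE cot haar muH hf hg).
  by move=> f _; exact: (hecke_invE cot haar muH modD f).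
- split; first by rewrite cE.
    exact: (hecke_alg_star_closed tH sc haar muH modD).
  by exists (fun F => F \o iota); rewrite cE.
- split; first exact: (corner_L1_star_closed cot haar muH modD).
  move=> L mulL starL j; apply: (corner_L1_isomorphism cot haar muH modD hC hB hH).
  by move=> f hf; exact: (hecke_norm1_iota tH sc (hecke_biequiv hf)).
Qed.
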